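(* Let $k>0$ and $R>0$ satisfy $$j_n(kR)\neq j_{n+2}(kR)\quad\text{for all } n\ge0.$$ Then for every integer $m\ge0$ and every $x\in\partial B_R$, $$\left(K^k_{\partial B_R}\right)^*[Y_m](x)=\lambda_{m,k,R}\,Y_m(\hat x),$$ where $$\lambda_{m,k,R}=\frac12-ik^2R^2j_m'(kR)h_m^{(1)}(kR)=-\frac12-ik^2R^2j_m(kR)h_m^{(1)\prime}(kR),$$ and on the boundary $\partial B_R$, $$S^k_{\partial B_R}[Y_m](x)=\chi_{m,k,R}\,Y_m(\hat x),\quad x\in\partial B_R,$$ where $\chi_{m,k,R}=-ikR^2h_m^{(1)}(kR)j_m(kR)$.
   Context: $B_R$ is the ball of radius $R$ centred at the origin in $\mathbb{R}^3$, $\hat x=x/|x|$, and $\nu$ is the outward unit normal on $\partial B_R$. $j_n$ and $h_n^{(1)}$ are the spherical Bessel and (first kind) spherical Hankel functions of order $n$; primes denote derivatives with respect to the argument. $Y_m$ denotes the spherical harmonics of order $m$, regarded as a function on $\partial B_R$ via $x\mapsto Y_m(\hat x)$. With $G^k(x)=-\frac{e^{ik|x|}}{4\pi|x|}$, the single layer potential is $$S^k_{\partial B_R}[\varphi](x)=\int_{\partial B_R}G^k(x-y)\varphi(y)\,ds(y),\quad x\in\mathbb{R}^3,\ \varphi\in L^2(\partial B_R),$$ and the Neumann-Poincaré operator is $$\left(K^k_{\partial B_R}\right)^*[\varphi](x)=\mathrm{p.v.}\int_{\partial B_R}\frac{\partial}{\partial\nu_x}G^k(x-y)\varphi(y)\,ds(y),\quad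 x\in\partial B_R.$$ *)

(* Defs.v *)
From mathcomp Require Import all_boot all_order all_algebra.
From mathcomp Require Import all_classical all_reals all_analysis.
From mathcomp Require Import complex.
(* The notations of mpoly clash with those of mathcomp-analysis. *)
From mathcomp Require mpoly.
Import(canonicals,coercions) mpoly.
Import Order.TTheory GRing.Theory Num.Theory.
Import numFieldNormedType.Exports.

Set Implicit Arguments.
Unset Strict Implicit.
Unset Printing Implicit Defensive.

Local Open Scope classical_set_scope.
Local Open Scope complex_scope.
Local Open Scope ring_scope.

Section Definitions.
Context {R : realType}.
Implicit Types (n m : nat) (k r t e : R) (x y v s : 'rV[R]_3) (A : set 'rV[R]_3)
  (f phi Y : 'rV[R]_3 -> R[i]).

(* The norm `|x| of the library on row vectors is the sup norm. *)
Definition enorm x : R := Num.sqrt (\sum_(i < 3) x 0 i ^+ 2).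

Definition hat x : 'rV[R]_3 := (enorm x)^-1 *: x.

(* Derivatives of complex-valued functions with respect to real variables are
   taken on real and imaginary parts. *)
Definition cderive1 (g : R -> R[i]) t : R[i] :=
  derive1 (fun u => complex.Re (g u)) t +i* derive1 (fun u => complex.Im (g u)) t.

Definition cderive f x v : R[i] :=
  'D_v (fun z => complex.Re (f z)) x +i* 'D_v (fun z => complex.Im (f z)) x.

(* j_n(t) = sum_p (-1)^p t^(n+2p) / (2^p p! 1*3*...*(2n+2p+1)), which is
   sqrt(pi/(2t)) J_(n+1/2)(t). *)
Definition sph_j n t : R :=
  limn (series (fun p : nat =>
    (-1) ^+ p * t ^+ (n + 2 * p) /
    (2 ^+ p * p`!%:R * \prod_(q < (n + p).+1) (2 * q + 1)%:R))).

(* y_n(t) = - (2n)!/(2^n n!) sum_p (-1)^p t^(2p-n-1) /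
            (2^p p! (-2n+1)(-2n+3)...(-2n+2p-1)), which is
   (-1)^(n+1) sqrt(pi/(2t)) J_(-n-1/2)(t). *)
Definition sph_y n t : R :=
  - ((2 * n)`!%:R / (2 ^+ n * n`!%:R)) *
  limn (series (fun p : nat =>
    (-1) ^+ p * (t ^+ (2 * p) / t ^+ n.+1) /
    (2 ^+ p * p`!%:R * \prod_(q < p) ((2 * q + 1)%:R - (2 * n)%:R)))).

Definition sph_h1 n t : R[i] := sph_j n t +i* sph_y n t.

(* Spherical harmonics of order m: restrictions to the unit sphere of the
   homogeneous harmonic polynomials of degree m in three variables. Only the
   values of Y on the unit sphere matter. *)
Definition spherical_harmonic m Y : Prop :=
  exists p : mpoly.mpoly 3 (R[i]),
    [/\ p \is mpoly.ishomog1 m mpoly.mdeg,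
        \sum_(i < 3) mpoly.mderiv i (mpoly.mderiv i p) = 0 &
        forall s, enorm s = 1 -> Y s = mpoly.meval (fun i => (s 0 i)%:C) p].

(* Integration over the sphere of radius r centred at the origin is the
   Lebesgue integral in spherical coordinates (theta, phi), with surface
   element r^2 sin theta dtheta dphi. *)
Definition sph_coord r (z : R * R) : 'rV[R]_3 :=
  r *: \row_(i < 3)
    [:: sin z.1 * cos z.2; sin z.1 * sin z.2; cos z.1]`_i.

Definition sph_dom r A : set (R * R) :=
  [set z | [/\ 0 <= z.1 <= pi, 0 <= z.2 <= 2 * pi & A (sph_coord r z)]].

Local Notation leb2 := (@lebesgue_measure R \x @lebesgue_measure R)%E.

Definition sph_dens r (g : 'rV[R]_3 -> R) (z : R * R) : R :=
  g (sph_coord r z) * (r ^+ 2 * sin z.1).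

(* The integral and lim are total functions; sphere_integrable and pv_exists
   say that the surface integral, resp. the principal value, exists. *)
Definition sphere_integrable r A f : Prop :=
  leb2.-integrable (sph_dom r A)
    (EFin \o sph_dens r (fun y => complex.Re (f y))) /\
  leb2.-integrable (sph_dom r A)
    (EFin \o sph_dens r (fun y => complex.Im (f y))).

Definition sphere_int r A f : R[i] :=
  (\int[leb2]_(z in sph_dom r A)
     sph_dens r (fun y => complex.Re (f y)) z) +i*
  (\int[leb2]_(z in sph_dom r A)
     sph_dens r (fun y => complex.Im (f y)) z).

Definition pv_trunc r x f e : R[i] :=
  sphere_int r [set y | e < enorm (x - y)] f.

Definition pv_int r x f : R[i] :=
  lim (complex.Re (pv_trunc r x f e) @[e --> 0^'+]) +i*
  lim (complex.Im (pv_trunc r x f e) @[e --> 0^'+]).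

Definition pv_exists r x f : Prop :=
  [/\ forall e, 0 < e -> sphere_integrable r [set y | e < enorm (x - y)] f,
      cvg (complex.Re (pv_trunc r x f e) @[e --> 0^'+]) &
      cvg (complex.Im (pv_trunc r x f e) @[e --> 0^'+])].

Definition G k x : R[i] :=
  - (cos (k * enorm x) +i* sin (k * enorm x)) / (4 * pi * enorm x)%:C.

Definition SL_integrand k phi x y : R[i] := G k (x - y) * phi y.

Definition SL k r phi x : R[i] := sphere_int r setT (SL_integrand k phi x).

(* On the sphere of radius r the outward unit normal at x is hat x. *)
Definition NP_integrand k phi x y : R[i] :=
  cderive (fun z => G k (z - y)) x (hat x) * phi y.

Definition NP k r phi x : R[i] := pv_int r x (NP_integrand k phi x).

Definition lambda m k r : R[i] :=
  2^-1 - 'i%C * (k ^+ 2 * r ^+ 2 * derive1 (sph_j m) (k * r))%:C * sph_h1 m (k * r).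

Definition chi m k r : R[i] :=
  - ('i%C * (k * r ^+ 2)%:C * sph_h1 m (k * r) * (sph_j m (k * r))%:C).

End Definitions.

(* Main.v *)
Require Import Defs.
From HB Require Import structures.
From mathcomp Require Import all_boot all_order all_algebra.
From mathcomp Require Import all_classical all_reals all_analysis.
From mathcomp Require Import measurable_realfun complex ring lra.
From mathcomp Require mpoly.
Import(canonicals,coercions) mpoly.
Import Order.TTheory GRing.Theory Num.Theory.
Import numFieldNormedType.Exports.

Local Open Scope classical_set_scope.
Local Open Scope complex_scope.
Local Open Scope ring_scope.

(** The kernel exp(ik rho)/rho, with rho = r |xi - eta| the chord length, is expanded in
powers of |xi - eta|. Each power |xi - eta|^(p-1), p >= 0, acts on spherical harmonics
of degree m as a scalar alpha p m. Indeed, applying the divergence theorem on the sphere to the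
fields |xi - eta|^(p-1) q(eta) xi and |xi - eta|^(p+1) grad q(eta), with q harmonic and
homogeneous, gives two linear relations, and eliminating the integral with the power
p + 1 expresses the integral against q through the one against its derivative along xi,
which is harmonic of degree m - 1. This leads by induction to m = 0, where the same relations give a
recursion in p. Summing over p produces Cauchy products of the series of j_m and
y_m, which are recognised with the Chu-Vandermonde identity.

The normal derivative of |x - y| is |x - y|/(2r) on the sphere, so the kernel of K* is only weakly
singular, the principal value is an absolutely convergent integral, and
lambda is obtained from chi by weighting the term of degree p by p - 1; the Wronskian of
j_m and y_m turns the result into the two stated forms. *)

(** * Power series of spherical Bessel functions *)

Section PowerSeries.
Set Implicit Arguments.
Unset Strict Implicit.
Context {R : realType}.
Implicit Types (a b c : nat -> R) (x z A B : R).

(** The powers |xi - eta|^(p-1) need not be differentiable at eta = xi, so the divergence theorem is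
    applied to powers of sqrt(|xi - eta|^2 + e), and e then tends to 0 by dominated convergence with
    a multiple of 1/|xi - eta| as bound. That this bound is integrable comes from the same source:
    for p = 0 and q = 1 the regularised identity controls the integral of (|xi - eta|^2 + e)^(-1/2)
    uniformly in e. The pole xi is arbitrary while the spherical coordinates stay fixed. They are
    never rotated towards xi, so even the integrals for q = 1 are extracted from these identities.
    The recursion for q = 1 goes by steps of two in p: it reaches all odd p from the area 4 pi, but
    determines the even ones only up to the value at p = 0, which is squeezed between neighbouring
    odd ones. The real part of exp(ik rho) involves even p and gives j_m y_m. The imaginary part
    involves odd p, that is even powers of the chord, which are polynomials, and gives j_m^2. *)

Lemma series_convolutionE a b n :
  series (fun p => \sum_(q < p.+1) a q * b (p - q)%N) n =
  \sum_(q < n) \sum_(r < n | (q + r < n)%N) a q * b r.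
Proof.
rewrite seriesEord /=.
under eq_bigr => p _ do rewrite -(big_mkord predT (fun q => a q * b (p - q)%N)).
under eq_bigr => p _.
  rewrite (big_nat_widen _ _ n)//; first last.
  rewrite big_mkord; over.
rewrite (exchange_big_dep predT) //=; apply: eq_bigr => q _.
rewrite -(big_mkord (fun r => (q + r < n)%N) (fun r => a q * b r)).
rewrite -(big_mkord (fun p => (q < p.+1)%N) (fun p => a q * b (p - q)%N)).
have qn : (q <= n)%N by apply: ltnW.
rewrite (big_cat_nat (leq0n q) qn) /= big_nat_cond big_pred0 ?add0r; last first.
  by move=> p; rewrite ltnS andbC ltnNge; case: leqP.
rewrite -[in LHS](add0n (q : nat)) big_addn [in RHS](big_cat_nat (leq0n _) (leq_subr q n)) /=.
rewrite [X in _ = _ + X]big_nat_cond [X in _ = _ + X]big_pred0 ?addr0; last first.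
  by move=> r; rewrite leq_subLR; case: (leqP n (q + r)) => //= _; rewrite andbF.
rewrite [X in X = _]big_nat_cond [X in _ = X]big_nat_cond; apply: eq_big => [i|i]; last by rewrite addnK.
by rewrite add0n ltnS leq_addl andbT ltn_subRL andbb.
Qed.


(** The product of the n-th partial sums is a sum over a square of indices, the n-th partial sum of
    the Cauchy product one over a triangle. Their difference avoids the square of side n/2, so it is
    bounded by the increment from n/2 to n of the product of the absolute series, which tends to
    0. *)
Lemma cvg_cauchy_product a b :
  cvgn [normed series a] -> cvgn [normed series b] ->
  series (fun p => \sum_(q < p.+1) a q * b (p - q)%N) @ \oo -->
    limn (series a) * limn (series b).
Proof.
move=> ca cb.
pose P (u v : R ^nat) n := series u n * series v n.
have PE u v n : P u v n = \sum_(q < n) \sum_(r < n) u q * v r.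
  rewrite /P !seriesEord /= mulr_suml; apply: eq_bigr => q _.
  by rewrite mulr_sumr.
have PB : P a b @ \oo --> limn (series a) * limn (series b).
  by apply: cvgM; apply: normed_cvg.
pose a' n := `|a n|; pose b' n := `|b n|.
have P'c : cvgn (P a' b') by apply: is_cvgM.
have dbl : (fun n => n./2) @ \oo --> \oo.
  apply/cvgnyPge => N; near=> n; rewrite geq_half_double.
  by near: n; exact: nbhs_infty_ge.
have E : (fun n => P a' b' n - P a' b' n./2) @ \oo --> (0 : R).
  have -> : (0 : R) = limn (P a' b') - limn (P a' b') by rewrite subrr.
  by apply: cvgB => //; apply: cvg_comp dbl _.
have : (fun n => P a b n -
   series (fun p => \sum_(q < p.+1) a q * b (p - q)%N) n) @ \oo --> (0 : R).
  apply: norm_cvg0; apply: (squeeze_cvgr _ (@cvg_cst _ _ _ _ _) E).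
  near=> n; rewrite normr_ge0 /= PE series_convolutionE -sumrB.
  rewrite (le_trans (ler_norm_sum _ _ _)) //.
  have -> : P a' b' n - P a' b' n./2 =
    \sum_(q < n) \sum_(r < n | ~~ ((q < n./2)%N && (r < n./2)%N)) a' q * b' r.
    rewrite !PE.
    have hn : (n./2 <= n)%N by rewrite -{2}[n]odd_double_half -addnn addnA leq_addl.
    rewrite -[X in _ - X](big_mkord predT (fun q => \sum_(r < n./2) a' q * b' r)).
    rewrite (big_nat_widen _ _ n) // big_mkord [X in _ - X]big_mkcond -sumrB.
    apply: eq_bigr => q _; case: ifP => /= ->; last by rewrite subr0; apply: eq_bigl.
    rewrite -[X in _ - X](big_mkord predT (fun r => a' q * b' r)).
    rewrite (big_nat_widen _ _ n) // big_mkord.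
    by rewrite [X in X - _](bigID (fun r : 'I_n => (r < n./2)%N)) /= addrAC subrr add0r.
  apply: ler_sum => q _.
  rewrite [X in X - _](bigID (fun r : 'I_n => (q + r < n)%N)) /= addrAC subrr add0r.
  rewrite (le_trans (ler_norm_sum _ _ _)) //.
  rewrite [leRHS]big_mkcond [leLHS]big_mkcond; apply: ler_sum => r _.
  case: ifP => qr; last by case: ifP => // _; exact: mulr_ge0 (normr_ge0 _) (normr_ge0 _).
  (* Two indices below n/2 have sum below n, so a pair outside the triangle is outside the small
     square. *)
  rewrite ifT; first by rewrite normrM lexx.
  apply: contra qr => /andP[q2 r2].
  rewrite (@leq_trans (n./2 + n./2)%N) //; last by rewrite addnn -geq_half_double.
  by rewrite -addSn leq_add // ltnW.
move=> /(cvgB PB); rewrite subr0; apply: cvg_trans.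
by apply: near_eq_cvg; near=> n; rewrite /= subKr.
Unshelve. all: by end_near. Qed.

(** * Pochhammer symbols and the Chu-Vandermonde identity *)

Definition falling x n : R := \prod_(i < n) (x - i%:R).

Lemma vandermonde_falling x y n :
  falling (x + y) n = \sum_(i < n.+1) falling x (n - i) * falling y i *+ 'C(n, i).
Proof.
have fS t k : falling t k.+1 = falling t k * (t - k%:R).
  by rewrite /falling big_ord_recr.
elim: n => [|n IHn]; first by rewrite big_ord_recl big_ord0 /falling !big_ord0 addr0 mul1r.
rewrite fS IHn mulr_suml.
(* The new factor splits as (x - (n - i)) + (y - i), and each summand lengthens one of the two
   falling factorials. Pascal's rule then recombines the terms. *)
have split_term (i : 'I_n.+1) :
    falling x (n - i) * falling y i *+ 'C(n, i) * (x + y - n%:R) =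
    falling x (n.+1 - i) * falling y i *+ 'C(n, i) +
    falling x (n - i) * falling y i.+1 *+ 'C(n, i).
  have le_in : (i <= n)%N by rewrite -ltnS.
  rewrite subSn // !fS natrB // -mulrnDl mulrnAl; congr (_ *+ _).
  by ring.
under eq_bigr do rewrite split_term.
rewrite big_split /= [X in X + _ = _]big_ord_recl [X in _ + X = _]big_ord_recr.
rewrite [RHS]big_ord_recl [X in _ = _ + X]big_ord_recr /=.
rewrite !bin0 /bump !subn0 !binn !subnn !leq0n !add1n !addrA; congr (_ + _).
rewrite -addrA -big_split; congr (_ + _); apply: eq_bigr => i _.
by rewrite subSS binS mulrnDr.
Qed.

Definition poch x n : R := \prod_(i < n) (x + i%:R).

Lemma poch_addn x m n : poch x (m + n) = poch x m * poch (x + m%:R) n.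
Proof.
rewrite /poch big_split_ord /=; congr (_ * _).
by apply: eq_bigr => i _; rewrite natrD addrA.
Qed.

Lemma pochS x n : poch x n.+1 = poch x n * (x + n%:R).
Proof. by rewrite /poch big_ord_recr. Qed.

Lemma poch_falling x n : poch x n = falling (x + n%:R - 1) n.
Proof.
rewrite /poch (reindex_inj rev_ord_inj); apply: eq_bigr => i _ /=.
by rewrite natrB // -natr1; ring.
Qed.

Lemma poch_neq0 x n : (forall q, x + q%:R != 0) -> poch x n != 0.
Proof. by move=> x0; apply/prodf_neq0 => i _. Qed.

(* Coefficients of 0F1(; A; -x/4); j_m and y_m are, up to powers of t, its values at
   x = t^2 for A = m + 3/2 and A = 1/2 - m. *)
Definition phi_coef A q : R := (-1) ^+ q / (4 ^+ q * q`!%:R * poch A q).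

Lemma phi_coef0 A : phi_coef A 0 = 1.
Proof. by rewrite /phi_coef /poch big_ord0 fact0 !expr0 !mulr1 divr1. Qed.

Lemma phi_coefS A q : A + q%:R != 0 ->
  4 * q.+1%:R * (A + q%:R) * phi_coef A q.+1 = - phi_coef A q.
Proof.
move=> Aq; rewrite /phi_coef pochS factS natrM !exprS.
(* If the Pochhammer symbol vanishes, both coefficients are 0 because the inverse of 0 is 0. *)
have [->|p0] := eqVneq (poch A q) 0; first by rewrite !(mul0r, mulr0) invr0 !mulr0 oppr0.
have f0 : q`!%:R != 0 :> R by rewrite pnatr_eq0 -lt0n fact_gt0.
have e0 : 4 ^+ q != 0 :> R by rewrite expf_neq0.
by field; rewrite nat1r p0 f0 e0 Aq pnatr_eq0.
Qed.

(** Over the common denominator, the term of index q becomes a binomial coefficient times two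
    falling factorials starting at A + p - 1 and B + p - 1, which is the Chu-Vandermonde sum. *)
Lemma phi_coef_convolution A B p :
  (forall q, A + q%:R != 0) -> (forall q, B + q%:R != 0) ->
  \sum_(q < p.+1) phi_coef A q * phi_coef B (p - q)%N =
  (-1) ^+ p * poch (A + B + p%:R - 1) p / (4 ^+ p * p`!%:R * poch A p * poch B p).
Proof.
move=> A0 B0.
have fact0 n : n`!%:R != 0 :> R by rewrite pnatr_eq0 -lt0n fact_gt0.
have four0 n : 4 ^+ n != 0 :> R by rewrite expf_neq0.
rewrite (_ : poch (A + B + p%:R - 1) p =
    falling ((A + p%:R - 1) + (B + p%:R - 1)) p); last first.
  by rewrite poch_falling; congr falling; ring.
rewrite vandermonde_falling mulr_sumr mulr_suml; apply: eq_bigr => q _.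
have qp : (q <= p)%N by rewrite -ltnS.
have -> : falling (A + p%:R - 1) (p - q) = poch A p / poch A q.
  rewrite -[in poch A p](subnKC qp) poch_addn mulrC mulKf ?poch_neq0 //.
  by rewrite poch_falling natrB //; congr falling; ring.
have -> : falling (B + p%:R - 1) q = poch B p / poch B (p - q).
  rewrite -[in poch B p](subnK qp) poch_addn mulrC mulKf ?poch_neq0 //.
  by rewrite poch_falling natrB //; congr falling; ring.
have Cq : ('C(p, q))%:R = p`!%:R / (q`!%:R * (p - q)`!%:R) :> R.
  apply: (mulIf (mulf_neq0 (fact0 q) (fact0 (p - q)%N))).
  by rewrite divfK ?mulf_neq0 // -!natrM bin_fact.
rewrite -[_ *+ 'C(p, q)]mulr_natr Cq /phi_coef.
rewrite -[in (-1) ^+ p](subnKC qp) -[in 4 ^+ p](subnKC qp) !exprD.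
field.
by rewrite !poch_neq0 ?four0 ?fact0.
Qed.

(** * Power series that converge absolutely on the whole line *)

Definition entire c := forall x, cvgn [normed series (fun n => c n * x ^+ n)].

Lemma entire_cvg c x : entire c -> cvgn (pseries c x).
Proof. by move=> ce; apply: normed_cvg; exact: ce. Qed.

(** A geometric factor is harmless: the series of [c] at M |x| does the domination. *)
Lemma entire_le c (d : nat -> R) (K M : R) :
  0 <= K -> 0 <= M -> (forall n, `|d n| <= K * (`|c n| * M ^+ n)) ->
  entire c -> entire d.
Proof.
move=> K0 M0 dc ce x.
apply: (@series_le_cvg _ _ (fun n => K * `|c n * (M * `|x|) ^+ n|)).
- by move=> n; exact: normr_ge0.
- by move=> n; rewrite mulr_ge0.
- move=> n /=; rewrite !normrM !normrX normrM normr_id (ger0_norm M0) exprMn.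
  by rewrite !mulrA ler_wpM2r ?exprn_ge0 // -mulrA dc.
- by apply: is_cvg_seriesZ; exact: ce.
Qed.

Lemma is_cvg_seriesS (u : R ^nat) : cvgn (series u) -> cvgn (series (fun n => u n.+1)).
Proof.
move=> /cvg_ex[/= l]; rewrite -cvg_shiftS => ul.
apply/cvg_ex; exists (l - u 0%N).
have : (fun n => series u n.+1 - u 0%N) @ \oo --> l - u 0%N.
  by apply: cvgB => //; exact: cvg_cst.
apply: cvg_trans; apply: near_eq_cvg; near=> n.
by rewrite /series/= big_nat_recl //= addrAC subrr add0r.
Unshelve. all: by end_near. Qed.

Lemma entire_diffs c : entire c -> entire (pseries_diffs c).
Proof.
(* Since X >= 1 we have |x|^n <= X^(n+1), and n + 1 <= 2^(n+1), so the series of [c] at 2 X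
   dominates. *)
move=> ce x; pose X : R := `|x| + 1.
have X1 : 1 <= X by rewrite lerDr.
have X0 : 0 <= X by rewrite (le_trans ler01).
apply: (@series_le_cvg _ _ (fun n => `|c n.+1 * (2 * X) ^+ n.+1|)).
- by move=> n; exact: normr_ge0.
- by move=> n; exact: normr_ge0.
- move=> n /=; rewrite /pseries_diffs !normrM normr_nat.
  rewrite [leRHS](_ : _ = `|c n.+1| * (2 ^+ n.+1 * X ^+ n.+1)); last first.
    by rewrite normrX (ger0_norm (mulr_ge0 (ler0n _ 2) X0)) exprMn.
  rewrite [_.+1%:R * _]mulrC -mulrA; apply: ler_wpM2l => //; apply: ler_pM => //.
    by rewrite -natrX ler_nat ltnW // ltn_expl.
  rewrite normrX (@le_trans _ _ (X ^+ n)) //; first by rewrite lerXn2r ?nnegrE // lerDl.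
  exact: ler_weXn2l.
- exact: (@is_cvg_seriesS (fun n => `|c n * (2 * X) ^+ n|) (ce _)).
Qed.

Lemma entire_natM c : entire c -> entire (fun n => n%:R * c n).
Proof.
apply: (@entire_le _ _ 1 2) => // n.
rewrite mul1r normrM normr_nat mulrC ler_wpM2l // -natrX ler_nat ltnW //.
by rewrite ltn_expl.
Qed.

Lemma is_derive_entire c x : entire c ->
  is_derive x (1 : R) (fun x => limn (pseries c x)) (limn (pseries (pseries_diffs c) x)).
Proof.
move=> ce; apply: (@pseries_snd_diffs _ _ (`|x| + 1)).
- exact: entire_cvg.
- exact/entire_cvg/entire_diffs.
- exact/entire_cvg/entire_diffs/entire_diffs.
- by rewrite [ltRHS]ger0_norm ?addr_ge0 // ltrDl.
Qed.

Lemma lim_natM_series c x : entire c ->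
  limn (series (fun n => n%:R * c n * x ^+ n)) =
  x * limn (pseries (pseries_diffs c) x).
Proof.
move=> ce; apply/cvg_lim => //.
have := pseries_diffs_equiv (@entire_cvg _ x (entire_diffs ce)).
move=> /(cvgMl_tmp (a := x)); apply: cvg_trans; apply: near_eq_cvg; near=> n.
rewrite /series/= mulr_sumr; apply: eq_bigr => -[|i] _; first by rewrite !mul0r mulr0.
by rewrite exprS /=; ring.
Unshelve. all: by end_near. Qed.


Lemma entire_inv_fact : entire (fun n => n`!%:R^-1).
Proof.
move=> x; apply: (@series_le_cvg _ _ (exp_coeff `|x|)).
- by move=> n; exact: normr_ge0.
- by move=> n; exact: exp_coeff_ge0.
- by move=> n /=; rewrite normrM normfV normr_nat normrX mulrC.
- exact: is_cvg_series_exp_coeff.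
Qed.

(** The hypothesis is what half-integers satisfy. It gives |poch A n| >= 2^-n, a loss absorbed by
    the factor 4^n of the denominator, and the series is compared with that of 1/n!. *)
Lemma entire_phi A : (forall q, 2^-1 <= `|A + q%:R|) -> entire (phi_coef A).
Proof.
move=> hA; apply: (entire_le ler01 ler01 _ entire_inv_fact) => n.
rewrite mul1r expr1n mulr1 /phi_coef !normrM normrX normrN1 expr1n mul1r.
rewrite !normfV !normrM normr_nat normrX normr_nat.
have : 2^-1 ^+ n <= `|poch A n|.
  elim: n => [|n IH]; first by rewrite /poch big_ord0 normr1.
  by rewrite exprSr pochS normrM ler_pM ?exprn_ge0.
have f0 : 0 < n`!%:R :> R by rewrite ltr0n fact_gt0.
have p0 : 0 < 2^-1 ^+ n :> R by rewrite exprn_gt0.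
move=> pn; have pp := lt_le_trans p0 pn.
rewrite lef_pV2 ?posrE ?mulr_gt0 ?exprn_gt0 //.
rewrite mulrAC; apply: (ler_peMl (ltW f0)); rewrite (@le_trans _ _ (4 ^+ n * 2^-1 ^+ n)) //; last first.
  by rewrite ler_wpM2l ?exprn_ge0.
by rewrite -exprMn exprn_ege1 //; lra.
Qed.

Definition conv a b p : R := \sum_(q < p.+1) a q * b (p - q)%N.

Lemma cvg_conv a b x : entire a -> entire b ->
  series (fun p => conv a b p * x ^+ p) @ \oo -->
    limn (pseries a x) * limn (pseries b x).
Proof.
move=> ea eb.
rewrite [X in series X](_ : _ = fun p =>
    \sum_(q < p.+1) (a q * x ^+ q) * (b (p - q)%N * x ^+ (p - q))); last first.
  apply/funext => p; rewrite /conv mulr_suml; apply: eq_bigr => q _.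
  have <- : x ^+ q * x ^+ (p - q) = x ^+ p by rewrite -exprD subnKC // -ltnS.
  by ring.
exact: (cvg_cauchy_product (ea x) (eb x)).
Qed.

Lemma natM_conv a b p :
  p%:R * conv a b p = conv (fun n => n%:R * a n) b p + conv a (fun n => n%:R * b n) p.
Proof.
rewrite /conv -big_split mulr_sumr; apply: eq_bigr => q _ /=.
by rewrite natrB -1?ltnS //; ring.
Qed.

Definition phi A z : R := limn (pseries (phi_coef A) z).
(* [dphi A z] is [z] times the derivative of [phi A] at [z]. *)
Definition dphi A z : R := limn (series (fun n => n%:R * phi_coef A n * z ^+ n)).

Lemma is_derive_phi A z : (forall q, 2^-1 <= `|A + q%:R|) -> z != 0 ->
  is_derive z (1 : R) (phi A) (z^-1 * dphi A z).
Proof.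
move=> hA z0; rewrite /dphi lim_natM_series; last exact: entire_phi.
by rewrite mulKf //; apply: is_derive_entire; exact: entire_phi.
Qed.

Lemma half_le_neq0 A : (forall q, 2^-1 <= `|A + q%:R|) -> forall q, A + q%:R != 0.
Proof. by move=> hA q; rewrite -normr_gt0 (lt_le_trans _ (hA q)). Qed.

Lemma cvg_phiM A B z :
  (forall q, 2^-1 <= `|A + q%:R|) -> (forall q, 2^-1 <= `|B + q%:R|) ->
  series (fun p => conv (phi_coef A) (phi_coef B) p * z ^+ p) @ \oo -->
    phi A z * phi B z.
Proof. by move=> hA hB; apply: cvg_conv; exact: entire_phi. Qed.

Lemma cvg_dphiM A B z :
  (forall q, 2^-1 <= `|A + q%:R|) -> (forall q, 2^-1 <= `|B + q%:R|) ->
  series (fun p => p%:R * conv (phi_coef A) (phi_coef B) p * z ^+ p) @ \oo -->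
    dphi A z * phi B z + phi A z * dphi B z.
Proof.
move=> hA hB.
have eA := entire_phi hA; have eB := entire_phi hB.
refine (cvg_trans _ (cvgD (cvg_conv (x := z) (entire_natM eA) eB)
  (cvg_conv (x := z) eA (entire_natM eB)))).
apply: near_eq_cvg; near=> n.
rewrite /series/= fctE -big_split; apply: eq_bigr => p _ /=.
by rewrite natM_conv mulrDl.
Unshelve. all: by end_near. Qed.

(** These are the Taylor coefficients of the Wronskian combination of [phi A] and [phi B]. With T =
    z d/dz, the function [phi A] solves T (T + A - 1) u = - z u / 4; for A + B = 2 the equations of
    the two functions combine so that all coefficients but the constant one cancel. *)
Lemma conv_wronskian A B p :
  (forall q, A + q%:R != 0) -> (forall q, B + q%:R != 0) -> A + B = 2 ->
  \sum_(q < p.+1) (2 * (p - q)%:R - 2 * q%:R + (B - A)) *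
     (phi_coef A q * phi_coef B (p - q)%N) = if p == 0 then B - A else 0.
Proof.
move=> A0 B0 AB; case: p => [|p].
  by rewrite big_ord1 /= subnn !phi_coef0; ring.
(* Multiplied by half the total degree, the weight becomes the difference of the two indicial
   polynomials. By the coefficient recurrences, [f q] and [g q.+1] are then both equal to minus a
   quarter of the same product of coefficients, and the sum telescopes. *)
apply: (@mulfI _ (2^-1 * p.+1%:R)); first by rewrite mulf_neq0 ?invr_eq0 ?pnatr_eq0.
rewrite mulr0 mulr_sumr.
pose f q := phi_coef A q * ((p.+1 - q)%:R * ((p.+1 - q)%:R + B - 1) * phi_coef B (p.+1 - q)).
pose g q := q%:R * (q%:R + A - 1) * phi_coef A q * phi_coef B (p.+1 - q).
rewrite (eq_bigr (fun q : 'I_p.+2 => f q - g q)); last first.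
  move=> q _; rewrite /f /g natrB -1?ltnS //.
  have -> : B = 2 - A by rewrite -AB addrAC subrr add0r.
  by field.
rewrite sumrB big_ord_recr [X in _ - X]big_ord_recl /f /g /= subnn !mul0r mulr0 addr0 add0r.
rewrite -sumrB big1 // => q _.
rewrite /= /bump leq0n add1n subSS subSn -1?ltnS //.
have := phi_coefS (A0 q); have := phi_coefS (B0 (p - q)%N).
rewrite -[(p - q).+1%:R]natr1 -[q.+1%:R]natr1.
set a := phi_coef A q; set b := phi_coef B (p - q).
set a1 := phi_coef A _; set b1 := phi_coef B _ => eb ea.
have -> : ((p - q)%:R + 1) * ((p - q)%:R + 1 + B - 1) * b1 = - b / 4.
  by rewrite -eb; field.
have -> : (q%:R + 1) * (q%:R + 1 + A - 1) * a1 = - a / 4.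
  by rewrite -ea; field.
by ring.
Qed.

Lemma phi_wronskian A B z :
  (forall q, 2^-1 <= `|A + q%:R|) -> (forall q, 2^-1 <= `|B + q%:R|) -> A + B = 2 ->
  2 * (phi A z * dphi B z - dphi A z * phi B z) + (B - A) * (phi A z * phi B z) = B - A.
Proof.
move=> hA hB AB; have eA := entire_phi hA; have eB := entire_phi hB.
have cA := cvg_conv (x := z) (entire_natM eA) eB; have cB := cvg_conv (x := z) eA (entire_natM eB).
pose S u v := series (fun p => conv u v p * z ^+ p).
have c : (fun n => 2 * (S (phi_coef A) (fun n => n%:R * phi_coef B n) n -
      S (fun n => n%:R * phi_coef A n) (phi_coef B) n) +
    (B - A) * S (phi_coef A) (phi_coef B) n) @ \oo -->
    2 * (phi A z * dphi B z - dphi A z * phi B z) + (B - A) * (phi A z * phi B z).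
  apply: cvgD; apply: cvgMl_tmp; last exact: cvg_phiM.
  exact: cvgB cB cA.
rewrite -(cvg_lim (@norm_hausdorff _ R) c).
apply: lim_near_cst; first exact: norm_hausdorff.
near=> n.
have -> : n = n.-1.+1 by rewrite prednK //; near: n; exact: nbhs_infty_gt.
rewrite /S /series/= -sumrB !mulr_sumr -big_split /= big_nat_recl //= big1.
  rewrite addr0 /conv !big_ord1 !phi_coef0 !expr0; ring.
move=> p _; transitivity ((\sum_(q < p.+2) (2 * (p.+1 - q)%:R - 2 * q%:R + (B - A)) *
     (phi_coef A q * phi_coef B (p.+1 - q)%N)) * z ^+ p.+1); last first.
  by rewrite conv_wronskian ?mul0r //; exact: half_le_neq0.
rewrite /conv !mulr_suml -sumrB !mulr_sumr -big_split; apply: eq_bigr => q _ /=.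
by ring.
Unshelve. all: by end_near. Qed.

Lemma conv_phi_rec A B p :
  (forall q, A + q%:R != 0) -> (forall q, B + q%:R != 0) ->
  4 * p.+1%:R * (A + p%:R) * (B + p%:R) * (A + B - 1 + p%:R) *
    conv (phi_coef A) (phi_coef B) p.+1 =
  - ((A + B - 1 + (2 * p)%:R) * (A + B + (2 * p)%:R)) *
    conv (phi_coef A) (phi_coef B) p.
Proof.
move=> A0 B0; rewrite /conv !phi_coef_convolution // !pochS !factS !natrM !exprS.
(* Both sides are the product of the factors from A + B + p - 1 to A + B + 2 p - 1, with the first,
   respectively the last, factor set apart. *)
have e : (A + B - 1 + p%:R) * poch (A + B + p.+1%:R - 1) p =
    poch (A + B + p%:R - 1) p * (A + B - 1 + (2 * p)%:R).
  rewrite (_ : _ + (2 * p)%:R = A + B + p%:R - 1 + p%:R); last by rewrite natrM; ring.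
  rewrite -pochS /poch big_ord_recl; congr (_ * _); first by rewrite /= addr0; ring.
  by apply: eq_bigr => i _; rewrite lift0 -[p.+1%:R]natr1 -[i.+1%:R]natr1; ring.
have four0 : 4 ^+ p != 0 :> R by rewrite expf_neq0.
have f0 : p`!%:R != 0 :> R by rewrite pnatr_eq0 -lt0n fact_gt0.
have pA := poch_neq0 p A0; have pB := poch_neq0 p B0.
have Ap := A0 p; have Bp := B0 p.
have S0 : p%:R + 1 != 0 :> R by rewrite natr1 pnatr_eq0.
rewrite -[p.+1%:R]natr1 in e *.
set u := poch (A + B + (p%:R + 1) - 1) p in e *; set v := poch (A + B + _ - 1) p in e *.
transitivity (- ((-1) ^+ p * ((A + B - 1 + p%:R) * u) * (A + B + (p%:R + 1) - 1 + p%:R) /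
    (4 ^+ p * p`!%:R * poch A p * poch B p))).
  by field; rewrite ?pA ?pB ?f0 ?four0 ?Ap ?Bp ?S0.
by rewrite e natrM; field; rewrite pA pB f0 four0.
Qed.

(* Eigenvalue of the kernel |xi - eta|^(p-1) on spherical harmonics of degree m. *)
Definition alpha p m : R :=
  4 * pi * 2 ^+ p / p.+1%:R * \prod_(i < m) (((2 * i + 1)%:R - p%:R) / ((2 * i + 3)%:R + p%:R)).

Lemma alphaS p m :
  alpha p m.+1 = alpha p m * (((2 * m + 1)%:R - p%:R) / ((2 * m + 3)%:R + p%:R)).
Proof. by rewrite /alpha big_ord_recr !mulrA. Qed.

(** Raising [p] by two shifts the numerators and denominators of the product by one index, so the
    quotient telescopes to its end factors. It is kept multiplied out because 2m - 1 - p can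
    vanish. *)
Lemma alpha_rec p m :
  ((2 * m)%:R - 1 - p%:R) * ((2 * m + 3)%:R + p%:R) * alpha p.+2 m =
  - 4 * p.+1%:R ^+ 2 * alpha p m.
Proof.
have p1 : 1 + p%:R != 0 :> R by rewrite nat1r pnatr_eq0.
have p3 : 3 + p%:R != 0 :> R by rewrite -natrD pnatr_eq0.
elim: m => [|m IHm].
  by rewrite /alpha !big_ord0 muln0 !exprS; field; rewrite p1 p3.
rewrite !alphaS.
have m0 := ler0n R m; have p0 := ler0n R p.
transitivity ((((2 * m)%:R - 1 - p%:R) * ((2 * m + 3)%:R + p%:R) * alpha p.+2 m) *
   (((2 * m + 1)%:R - p%:R) / ((2 * m + 3)%:R + p%:R))); last by rewrite IHm -!mulrA.
by field; apply/andP; split; rewrite gt_eqF //; lra.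
Qed.

(* Real and imaginary parts of i^n alpha n m / n!, the coefficient of k^n in the
   eigenvalue of exp(i k |xi - eta|) / |xi - eta|. *)
Definition even_coef p m : R := (-1) ^+ p / (2 * p)`!%:R * alpha (2 * p) m.
Definition odd_coef p m : R := (-1) ^+ p / (2 * p).+1`!%:R * alpha (2 * p).+1 m.

(** The double factorial (2m+1)!!. *)
Definition dfact m : R := \prod_(q < m.+1) (2 * q + 1)%:R.

Lemma dfactS m : dfact m.+1 = dfact m * (2 * m%:R + 3).
Proof. by rewrite /dfact big_ord_recr /= natrD natrM -natr1; congr (_ * _); ring. Qed.

Lemma dfact_gt0 m : 0 < dfact m.
Proof. by apply: prodr_gt0 => i _; rewrite ltr0n addn1. Qed.

Definition ordA m : R := m%:R + 3 / 2.
Definition ordB m : R := 1 / 2 - m%:R.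

Lemma ordA_ge m q : 2^-1 <= `|ordA m + q%:R|.
Proof.
have m0 := ler0n R m; have q0 := ler0n R q.
by rewrite /ordA ger0_norm; lra.
Qed.

Lemma ordB_ge m q : 2^-1 <= `|ordB m + q%:R|.
Proof.
rewrite /ordB; have [mq|qm] := leqP m q.
  have : m%:R <= q%:R :> R by rewrite ler_nat.
  by move=> ?; rewrite ger0_norm; lra.
have : q.+1%:R <= m%:R :> R by rewrite ler_nat.
by rewrite -natr1 => ?; rewrite ler0_norm; lra.
Qed.

(** Both sides obey the same first-order recursion in [p], by [alpha_rec] and by [conv_phi_rec] with
    A + B = 2. They agree at p = 0, where the product defining [alpha 0 m] telescopes to 4 pi /
    (2m+1). *)
Lemma even_coefE p m : even_coef p m =
  4 * pi / (2 * m%:R + 1) * conv (phi_coef (ordA m)) (phi_coef (ordB m)) p.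
Proof.
have hA := half_le_neq0 (ordA_ge m); have hB := half_le_neq0 (ordB_ge m).
have m0 := ler0n R m.
elim: p => [|p IHp].
  rewrite /even_coef /conv big_ord1 !phi_coef0 expr0 fact0 !mulr1 divr1 mul1r muln0.
  elim: m {hA hB m0} => [|m IHm].
    by rewrite /alpha big_ord0 expr0; field.
  have m0 := ler0n R m.
  rewrite alphaS IHm natrD natrM -natr1; field.
  by apply/andP; split; rewrite gt_eqF //; lra.
have p0 := ler0n R p.
have := conv_phi_rec p hA hB; have := alpha_rec (2 * p) m.
set c := conv _ _ p.+1; set c0 := conv _ _ p in IHp *.
move: IHp; rewrite /even_coef mulnS !add2n !factS !natrM (exprS (-1)).
set a := alpha _.+2 m; set a0 := alpha _ m.
set f := (2 * p)`!%:R; set s : R := (-1) ^+ p => IHp ea ec.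
have s0 : s != 0 by rewrite signr_eq0.
have f0 : f != 0 by rewrite pnatr_eq0 -lt0n fact_gt0.
have hAp := hA p; have hBp := hB p; rewrite /ordA /ordB in hAp hBp ec.
have n1 : 2 * m%:R + 1 != 0 :> R by rewrite gt_eqF //; lra.
have q1 : 2 * p%:R + 1 != 0 :> R by rewrite gt_eqF //; lra.
have q3 : p%:R + 1 != 0 :> R by rewrite gt_eqF //; lra.
have k1 : 2 * m%:R + 3 + 2 * p%:R != 0 :> R by rewrite gt_eqF //; lra.
(* This number is -2 times [ordB m] + p, hence nonzero. *)
have k2 : 2 * m%:R - 1 - 2 * p%:R != 0 :> R by apply: contra_neq hBp; lra.
have -> : c = (2 * p%:R + 1) * (2 * p%:R + 2) * c0 /
    ((p%:R + 1) ^+ 2 * (2 * m%:R + 3 + 2 * p%:R) * (2 * m%:R - 1 - 2 * p%:R)).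
  apply: canRL (mulfK _) _; first by rewrite !mulf_neq0 ?expf_neq0.
  by lra.
have -> : a = - 4 * (2 * p%:R + 1) ^+ 2 * a0 /
    ((2 * m%:R - 1 - 2 * p%:R) * (2 * m%:R + 3 + 2 * p%:R)).
  apply: canRL (mulfK _) _; first by rewrite !mulf_neq0.
  by lra.
have -> : a0 = (4 * pi / (2 * m%:R + 1) * c0) * f / s.
  by rewrite -IHp; field; rewrite s0 f0.
rewrite -[(2 * p).+2%:R]natr1 -[(2 * p).+1%:R]natr1 natrM.
field.
by rewrite k2 k1 q3 n1 s0 f0 q1 gt_eqF //; lra.
Qed.

(** The kernel |xi - eta|^(2p) is on the sphere a polynomial of degree p in eta, hence orthogonal to
    harmonics of degree m > p. In the product formula this is the vanishing of the factor i = p. *)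
Lemma odd_coef_lt p m : (p < m)%N -> odd_coef p m = 0.
Proof.
move=> pm; rewrite /odd_coef /alpha (bigD1 (Ordinal pm)) //= addn1 subrr.
by rewrite mul0r mul0r !mulr0.
Qed.

(** The coefficient at which the odd series starts, and so the initial value for [odd_coefE]. The
    induction raises the power by two with [alpha_rec], then the degree by one with [alphaS]. *)
Lemma alpha_odd_diag m :
  (-1) ^+ m / (2 * m).+1`!%:R * alpha (2 * m).+1 m = 4 * pi / dfact m ^+ 2.
Proof.
elim: m => [|m IHm].
  by rewrite /alpha /dfact big_ord0 big_ord1 muln0 !expr0 expr1 factS fact0 muln1 expr1n; field.
have m0 := ler0n R m.
have d0 : dfact m != 0 by rewrite gt_eqF ?dfact_gt0.
have := alpha_rec (2 * m).+1 m.
rewrite mulnS !add2n alphaS dfactS !factS !natrM (exprS (-1)).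
move: IHm; rewrite factS natrM.
set a := alpha _ m; set b := alpha _ m; set f := (2 * m)`!%:R; set s : R := (-1) ^+ m.
have f0 : f != 0 by rewrite pnatr_eq0 -lt0n fact_gt0.
have s0 : s != 0 by rewrite signr_eq0.
move=> IHm eb.
have q1 : 2 * m%:R + 1 != 0 :> R by rewrite gt_eqF //; lra.
have q2 : 2 * m%:R + 2 != 0 :> R by rewrite gt_eqF //; lra.
have q3 : 2 * m%:R + 3 != 0 :> R by rewrite gt_eqF //; lra.
have q4 : m%:R + 1 != 0 :> R by rewrite gt_eqF //; lra.
have -> : b = 2 * (m%:R + 1) * a.
  have e8 : 8 != 0 :> R by rewrite pnatr_eq0.
  apply: (mulfI (mulf_neq0 e8 q4)); apply: oppr_inj; rewrite -mulNr.
  transitivity (- 4 * (2 * m).+2%:R ^+ 2 * a); last by ring.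
  by rewrite -eb; ring.
have -> : a = (4 * pi / dfact m ^+ 2) * ((2 * m%:R + 1) * f) / s.
  by rewrite -IHm; field; rewrite s0 f0 gt_eqF //; lra.
field; rewrite d0 s0 f0 q3 !gt_eqF //; lra.
Qed.

(** The shift by [m] skips the coefficients that vanish and accounts for the factor t^(2m) of j_m^2.
    From there on the recursions of the two sides coincide, now with A = B. *)
Lemma odd_coefE p m : odd_coef (m + p) m =
  4 * pi / dfact m ^+ 2 * conv (phi_coef (ordA m)) (phi_coef (ordA m)) p.
Proof.
have hA := half_le_neq0 (ordA_ge m).
have m0 := ler0n R m.
have d0 : dfact m != 0 by rewrite gt_eqF ?dfact_gt0.
elim: p => [|p IHp].
  by rewrite addn0 /odd_coef alpha_odd_diag /conv big_ord1 !phi_coef0; ring.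
have p0 := ler0n R p.
have := conv_phi_rec p hA hA; have := alpha_rec (2 * (m + p)).+1 m.
set c := conv _ _ p.+1; set c0 := conv _ _ p in IHp *.
move: IHp; rewrite /odd_coef [(m + p.+1)%N]addnS mulnS !add2n !factS !natrM (exprS (-1)).
set a := alpha _.+3 m; set a0 := alpha _ m.
set f := (2 * (m + p))`!%:R; set s : R := (-1) ^+ (m + p) => IHp ea ec.
have f0 : f != 0 by rewrite pnatr_eq0 -lt0n fact_gt0.
have s0 : s != 0 by rewrite signr_eq0.
rewrite /ordA in ec.
have q1 : 2 * (m%:R + p%:R) + 1 != 0 :> R by rewrite gt_eqF //; lra.
have q3 : p%:R + 1 != 0 :> R by rewrite gt_eqF //; lra.
have k1 : 2 * m%:R + 2 + p%:R != 0 :> R by rewrite gt_eqF //; lra.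
have k2 : 2 * m%:R + 3 + 2 * p%:R != 0 :> R by rewrite gt_eqF //; lra.
have -> : c = - (2 * m%:R + 2 + 2 * p%:R) * c0 /
    ((p%:R + 1) * (2 * m%:R + 3 + 2 * p%:R) * (2 * m%:R + 2 + p%:R)).
  apply: canRL (mulfK _) _; first by rewrite !mulf_neq0.
  by apply: (mulfI k2); lra.
have -> : a = (2 * m%:R + 2 + 2 * p%:R) ^+ 2 * a0 / ((p%:R + 1) * (2 * m%:R + 2 + p%:R)).
  apply: canRL (mulfK _) _; first by rewrite !mulf_neq0.
  by lra.
have -> : a0 = (4 * pi / dfact m ^+ 2 * c0) * ((2 * (m%:R + p%:R) + 1) * f) / s.
  by rewrite -IHp; field; rewrite s0 f0 gt_eqF //; lra.
field; rewrite d0 s0 f0 !gt_eqF //; lra.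
Qed.

(** * Spherical Bessel functions: series, derivatives, Wronskian and products *)

Implicit Types (t : R).

Lemma sph_jE m t : sph_j m t = t ^+ m / dfact m * phi (ordA m) (t ^+ 2).
Proof.
rewrite /sph_j; apply/cvg_lim; first exact: norm_hausdorff.
rewrite [X in X @ \oo --> _](_ : _ = fun n => t ^+ m / dfact m *
    pseries (phi_coef (ordA m)) (t ^+ 2) n).
  by apply: cvgMl_tmp; apply: entire_cvg; exact/entire_phi/ordA_ge.
apply/funext => n; rewrite /pseries/series/= mulr_sumr; apply: eq_bigr => p _.
(* The first m + 1 odd factors form [dfact m]; each later one is 2 (m + 3/2 + i). *)
have -> : \prod_(q < (m + p).+1) (2 * q + 1)%:R = dfact m * (2 ^+ p * poch (ordA m) p) :> R.
  rewrite -addSn big_split_ord /=; congr (_ * _).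
  have -> : 2 ^+ p = \prod_(i < p) 2 :> R by rewrite prodr_const card_ord.
  rewrite /poch -big_split; apply: eq_bigr => i _ /=.
  by rewrite /ordA natrD natrM natrD -natr1; field.
rewrite /phi_coef exprD exprM (_ : 4 = 2 * 2 :> R) ?exprMn; last by rewrite -natrM.
field.
have d0 : dfact m != 0 :> R by rewrite gt_eqF ?dfact_gt0.
rewrite d0 poch_neq0 ?expf_neq0 ?pnatr_eq0 -?lt0n ?fact_gt0 //.
exact/half_le_neq0/ordA_ge.
Qed.

(** The double factorial (2m-1)!!, in the form in which it enters [sph_y]. *)
Definition cfact m : R := (2 * m)`!%:R / (2 ^+ m * m`!%:R).

Lemma dfact_cfact m : dfact m = cfact m * (2 * m%:R + 1).
Proof.
elim: m => [|m IHm]; first by rewrite /dfact /cfact big_ord1 muln0 fact0 expr0; field.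
rewrite dfactS IHm /cfact mulnS !add2n !factS !natrM exprS.
have f0 : m`!%:R != 0 :> R by rewrite pnatr_eq0 -lt0n fact_gt0.
have m0 := ler0n R m.
by field; rewrite f0 expf_neq0 ?pnatr_eq0 // gt_eqF //; lra.
Qed.

Lemma sph_yE m t : sph_y m t = - cfact m / t ^+ m.+1 * phi (ordB m) (t ^+ 2).
Proof.
rewrite /sph_y -/(cfact m) -mulrA; congr (_ * _); apply/cvg_lim; first exact: norm_hausdorff.
rewrite [X in X @ \oo --> _](_ : _ = fun n => (t ^+ m.+1)^-1 *
    pseries (phi_coef (ordB m)) (t ^+ 2) n).
  by apply: cvgMl_tmp; apply: entire_cvg; exact/entire_phi/ordB_ge.
apply/funext => n; rewrite /pseries/series/= mulr_sumr; apply: eq_bigr => p _.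
have -> : \prod_(q < p) ((2 * q + 1)%:R - (2 * m)%:R) = 2 ^+ p * poch (ordB m) p :> R.
  have -> : 2 ^+ p = \prod_(i < p) 2 :> R by rewrite prodr_const card_ord.
  rewrite /poch -big_split; apply: eq_bigr => i _ /=.
  by rewrite /ordB natrD !natrM; field.
rewrite /phi_coef exprM (_ : 4 = 2 * 2 :> R) ?exprMn; last by rewrite -natrM.
set u := (t ^+ m.+1)^-1; field.
rewrite poch_neq0 ?expf_neq0 ?pnatr_eq0 -?lt0n ?fact_gt0 //.
exact/half_le_neq0/ordB_ge.
Qed.

Lemma is_derive_mul (f g : R -> R) t df dg d :
  is_derive t (1 : R) f df -> is_derive t (1 : R) g dg ->
  df * g t + f t * dg = d -> is_derive t (1 : R) (fun u => f u * g u) d.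
Proof.
move=> hf hg <-; rewrite (_ : (fun u => _) = f * g) //.
apply: is_derive_eq.
by rewrite /GRing.scale /= addrC [g t * df]mulrC.
Qed.

Lemma is_derive_cstM (a : R) (f : R -> R) t df d :
  is_derive t (1 : R) f df -> a * df = d -> is_derive t (1 : R) (fun u => a * f u) d.
Proof. by move=> hf <-; rewrite (_ : (fun u => _) = a \*: f) //; apply: is_derive_eq. Qed.

Lemma is_derive_exp n t : is_derive t (1 : R) (fun u => u ^+ n) (n%:R * t ^+ n.-1).
Proof.
have -> : (fun u : R => u ^+ n) = id ^+ n by apply/funext => u; rewrite exprfctE.
by apply: is_derive_eq; rewrite /GRing.scale /= mulr1.
Qed.

(* [t] times the derivative at [t]. *)
Definition dsph_j m t : R :=
  m%:R * sph_j m t + 2 * (t ^+ m / dfact m) * dphi (ordA m) (t ^+ 2).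
Definition dsph_y m t : R :=
  - m.+1%:R * sph_y m t - 2 * (cfact m / t ^+ m.+1) * dphi (ordB m) (t ^+ 2).

Lemma is_derive_phi_sqr A t : (forall q, 2^-1 <= `|A + q%:R|) -> t != 0 ->
  is_derive t (1 : R) (fun t => phi A (t ^+ 2)) (2 / t * dphi A (t ^+ 2)).
Proof.
move=> hA t0.
have t20 : t ^+ 2 != 0 by rewrite expf_neq0.
have dp := is_derive_phi hA t20.
have -> : 2 / t * dphi A (t ^+ 2) = ((t ^+ 2)^-1 * dphi A (t ^+ 2)) * (2 * t).
  by field.
have d2 : is_derive t (1 : R) (fun t => t ^+ 2) (2 * t) := is_derive_exp 2 t.
exact: (@is_derive1_comp _ (phi A) (fun t => t ^+ 2)).
Qed.

Lemma is_derive_sph_j m t : t != 0 -> is_derive t (1 : R) (sph_j m) (t^-1 * dsph_j m t).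
Proof.
move=> t0.
have -> : sph_j m = (fun t => t ^+ m * ((dfact m)^-1 * phi (ordA m) (t ^+ 2))).
  by apply/funext => u; rewrite sph_jE mulrA.
have dp := is_derive_phi_sqr (ordA_ge m) t0.
apply: (is_derive_mul (is_derive_exp m t) (is_derive_cstM dp erefl)).
have d0 : dfact m != 0 :> R by rewrite gt_eqF ?dfact_gt0.
rewrite /dsph_j sph_jE; case: m d0 dp => [|m] d0 dp /=.
  by rewrite expr0; field; rewrite d0 t0.
by rewrite (exprS t m); field; rewrite d0 t0.
Qed.

Lemma is_derive_sph_y m t : t != 0 -> is_derive t (1 : R) (sph_y m) (t^-1 * dsph_y m t).
Proof.
move=> t0.
have -> : sph_y m = (fun t => (t ^+ m.+1)^-1 * (- cfact m * phi (ordB m) (t ^+ 2))).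
  by apply/funext => u; rewrite sph_yE; ring.
have dp := is_derive_phi_sqr (ordB_ge m) t0.
have tm : t ^+ m.+1 != 0 by rewrite expf_neq0.
have dv := is_deriveV (f := fun u => u ^+ m.+1) tm (is_derive_exp m.+1 t).
apply: (is_derive_mul dv (is_derive_cstM dp erefl)).
rewrite /dsph_y sph_yE /= /GRing.scale /= !(exprS t m); field.
by rewrite t0 expf_neq0.
Qed.

(** In terms of true derivatives this is j y' - j' y = 1/t^2. The parameters of the two series add
    up to 2, so [phi_wronskian] applies, and the prefactors multiply to -1/((2m+1) t). *)
Lemma sph_wronskian m t : t != 0 ->
  t * (sph_j m t * dsph_y m t - dsph_j m t * sph_y m t) = 1.
Proof.
move=> t0; rewrite /dsph_y /dsph_j sph_jE sph_yE.
have AB : ordA m + ordB m = 2 :> R by rewrite /ordA /ordB; field.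
have := phi_wronskian (t ^+ 2) (ordA_ge m) (ordB_ge m) AB.
set a := phi (ordA m) _; set b := phi _ _; set da := dphi (ordA m) _; set db := dphi (ordB m) _.
rewrite (_ : ordB m - ordA m = - (2 * m%:R + 1)); last by rewrite /ordA /ordB; field.
move=> W.
have m0 := ler0n R m.
have n1 : 2 * m%:R + 1 != 0 :> R by rewrite gt_eqF //; lra.
have d0 : dfact m != 0 :> R by rewrite gt_eqF ?dfact_gt0.
have := d0; rewrite dfact_cfact mulf_eq0 negb_or => /andP[c0 _].
transitivity (- (2 * (a * db - da * b) - (2 * m%:R + 1) * (a * b)) / (2 * m%:R + 1)).
  by rewrite (exprS t m); field; rewrite n1 c0 t0 expf_neq0.
by rewrite mulNr in W; rewrite W; field.
Qed.

Lemma sph_jyE m t : t != 0 ->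
  phi (ordA m) (t ^+ 2) * phi (ordB m) (t ^+ 2) =
  - (2 * m%:R + 1) * (t * (sph_j m t * sph_y m t)).
Proof.
move=> t0; rewrite sph_jE sph_yE.
have m0 := ler0n R m.
have n1 : 2 * m%:R + 1 != 0 :> R by rewrite gt_eqF //; lra.
have d0 : dfact m != 0 :> R by rewrite gt_eqF ?dfact_gt0.
have := d0; rewrite dfact_cfact mulf_eq0 negb_or => /andP[c0 _].
by rewrite (exprS t m); field; rewrite n1 c0 t0 expf_neq0.
Qed.

(** This is [sph_jyE] under the operator (t/2) d/dt, which is z d/dz for z = t^2. The summand
    without derivatives comes from the factor t. *)
Lemma dsph_jyE m t : t != 0 ->
  dphi (ordA m) (t ^+ 2) * phi (ordB m) (t ^+ 2) +
    phi (ordA m) (t ^+ 2) * dphi (ordB m) (t ^+ 2) =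
  - (2 * m%:R + 1) / 2 * (t * (sph_j m t * sph_y m t +
     dsph_j m t * sph_y m t + sph_j m t * dsph_y m t)).
Proof.
move=> t0; rewrite /dsph_j /dsph_y sph_jE sph_yE.
have m0 := ler0n R m.
have n1 : 2 * m%:R + 1 != 0 :> R by rewrite gt_eqF //; lra.
have d0 : dfact m != 0 :> R by rewrite gt_eqF ?dfact_gt0.
have := d0; rewrite dfact_cfact mulf_eq0 negb_or => /andP[c0 _].
by rewrite (exprS t m); field; rewrite n1 c0 t0 expf_neq0.
Qed.

Lemma cvg_even_coef m t : t != 0 ->
  series (fun p => even_coef p m * t ^+ (2 * p)) @ \oo -->
    - 4 * pi * (t * (sph_j m t * sph_y m t)).
Proof.
move=> t0; have m0 := ler0n R m.
have n1 : 2 * m%:R + 1 != 0 :> R by rewrite gt_eqF //; lra.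
have -> : - 4 * pi * (t * (sph_j m t * sph_y m t)) = 4 * pi / (2 * m%:R + 1) *
    (phi (ordA m) (t ^+ 2) * phi (ordB m) (t ^+ 2)).
  by rewrite sph_jyE //; field.
rewrite [X in X @ \oo --> _](_ : _ = fun n => 4 * pi / (2 * m%:R + 1) *
    series (fun p => conv (phi_coef (ordA m)) (phi_coef (ordB m)) p * (t ^+ 2) ^+ p) n).
  by apply: cvgMl_tmp; apply: cvg_phiM; [exact: ordA_ge|exact: ordB_ge].
apply/funext => n; rewrite /series/= mulr_sumr; apply: eq_bigr => p _.
by rewrite even_coefE exprM mulrA.
Qed.

(** The weight is the exponent, as brought down by t d/dt; it enters through the normal derivative
    of the kernel. *)
Lemma cvg_even_coef_natM m t : t != 0 ->
  series (fun p => (2 * p)%:R * even_coef p m * t ^+ (2 * p)) @ \oo -->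
    - 4 * pi * (t * (sph_j m t * sph_y m t +
       dsph_j m t * sph_y m t + sph_j m t * dsph_y m t)).
Proof.
move=> t0; have m0 := ler0n R m.
have n1 : 2 * m%:R + 1 != 0 :> R by rewrite gt_eqF //; lra.
have := dsph_jyE m t0; set J := _ + sph_j m t * dsph_y m t => JE.
have -> : - 4 * pi * (t * J) = 8 * pi / (2 * m%:R + 1) *
    (dphi (ordA m) (t ^+ 2) * phi (ordB m) (t ^+ 2) +
     phi (ordA m) (t ^+ 2) * dphi (ordB m) (t ^+ 2)).
  by rewrite JE; field.
rewrite [X in X @ \oo --> _](_ : _ = fun n => 8 * pi / (2 * m%:R + 1) *
    series (fun p => p%:R * conv (phi_coef (ordA m)) (phi_coef (ordB m)) p *
      (t ^+ 2) ^+ p) n).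
  by apply: cvgMl_tmp; apply: cvg_dphiM; [exact: ordA_ge|exact: ordB_ge].
apply/funext => n; rewrite /series/= mulr_sumr; apply: eq_bigr => p _.
by rewrite even_coefE exprM natrM; field.
Qed.

Lemma cvg_series_shift (u : nat -> R) m (l : R) : (forall p, (p < m)%N -> u p = 0) ->
  series (fun p => u (m + p)%N) @ \oo --> l -> series u @ \oo --> l.
Proof.
move=> u0 ul; rewrite -(cvg_shiftn m); move: ul; apply: cvg_trans.
apply: near_eq_cvg; near=> n.
rewrite /series/= [in RHS](big_cat_nat (leq0n m) (leq_addl n m)) /=.
rewrite [X in _ = X + _]big1_seq ?add0r; last first.
  by move=> p /andP[_]; rewrite mem_index_iota => /andP[_ pm]; exact: u0.
rewrite -[m in RHS]add0n big_addn addnK; apply: eq_bigr => p _.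
by rewrite addnC.
Unshelve. all: by end_near. Qed.

Lemma cvg_odd_coef m t :
  series (fun p => odd_coef p m * t ^+ (2 * p).+1) @ \oo -->
    4 * pi * (t * sph_j m t ^+ 2).
Proof.
apply: (cvg_series_shift (m := m)) => [p pm|]; first by rewrite odd_coef_lt ?mul0r.
have d0 : dfact m != 0 :> R by rewrite gt_eqF ?dfact_gt0.
rewrite [X in _ --> X](_ : _ = 4 * pi * t * (t ^+ m / dfact m) ^+ 2 *
    (phi (ordA m) (t ^+ 2) * phi (ordA m) (t ^+ 2))); last by rewrite sph_jE; ring.
rewrite [X in X @ \oo --> _](_ : _ = fun n => 4 * pi * t * (t ^+ m / dfact m) ^+ 2 *
    series (fun p => conv (phi_coef (ordA m)) (phi_coef (ordA m)) p * (t ^+ 2) ^+ p) n).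
  by apply: cvgMl_tmp; apply: cvg_phiM; exact: ordA_ge.
apply/funext => n; rewrite /series/= mulr_sumr; apply: eq_bigr => p _.
have -> : t ^+ (2 * (m + p)).+1 = t * (t ^+ m) ^+ 2 * (t ^+ 2) ^+ p.
  by rewrite -!exprM [(m * 2)%N]mulnC -mulrA -exprD -mulnDr -exprS.
by rewrite odd_coefE; field.
Qed.

Lemma cvg_odd_coef_natM m t :
  series (fun p => (2 * p).+1%:R * odd_coef p m * t ^+ (2 * p).+1) @ \oo -->
    4 * pi * (t * (sph_j m t ^+ 2 + 2 * (sph_j m t * dsph_j m t))).
Proof.
apply: (cvg_series_shift (m := m)) => [p pm|]; first by rewrite odd_coef_lt ?(mulr0, mul0r).
have d0 : dfact m != 0 :> R by rewrite gt_eqF ?dfact_gt0.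
rewrite [X in _ --> X](_ : _ =
    (2 * m%:R + 1) * (4 * pi * t * (t ^+ m / dfact m) ^+ 2) *
      (phi (ordA m) (t ^+ 2) * phi (ordA m) (t ^+ 2)) +
    8 * pi * t * (t ^+ m / dfact m) ^+ 2 *
    (dphi (ordA m) (t ^+ 2) * phi (ordA m) (t ^+ 2) +
     phi (ordA m) (t ^+ 2) * dphi (ordA m) (t ^+ 2))); last first.
  by rewrite /dsph_j sph_jE; ring.
rewrite [X in X @ \oo --> _](_ : _ = fun n =>
    (2 * m%:R + 1) * (4 * pi * t * (t ^+ m / dfact m) ^+ 2) *
    series (fun p => conv (phi_coef (ordA m)) (phi_coef (ordA m)) p * (t ^+ 2) ^+ p) n +
    8 * pi * t * (t ^+ m / dfact m) ^+ 2 *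
    series (fun p => p%:R * conv (phi_coef (ordA m)) (phi_coef (ordA m)) p *
      (t ^+ 2) ^+ p) n).
  apply: cvgD; apply: cvgMl_tmp; first by apply: cvg_phiM; exact: ordA_ge.
  by apply: cvg_dphiM; exact: ordA_ge.
apply/funext => n; rewrite /series/= !mulr_sumr -big_split; apply: eq_bigr => p _ /=.
have -> : t ^+ (2 * (m + p)).+1 = t * (t ^+ m) ^+ 2 * (t ^+ 2) ^+ p.
  by rewrite -!exprM [(m * 2)%N]mulnC -mulrA -exprD -mulnDr -exprS.
by rewrite odd_coefE; field.
Qed.

End PowerSeries.

(** * Integrals over the unit sphere *)

Section SphereIntegral.
Set Implicit Arguments.
Unset Strict Implicit.
Context {R : realType}.
Implicit Types (z : R * R) (f h : R * R -> R).

Local Notation leb2 := (@lebesgue_measure R \x @lebesgue_measure R)%E.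

(** Continuity provides bounds on the compact coordinate box and the fundamental theorem of calculus
    in each variable. Measurability, for the product sigma-algebra, is carried along through the
    same closure properties. *)
Definition cts_meas f := continuous f /\ measurable_fun [set: R * R] f.

Lemma cts_meas_cst (a : R) : cts_meas (fun=> a).
Proof. by split; [move=> z; exact: cvg_cst|exact: measurable_cst]. Qed.

Lemma cts_meas_fst : cts_meas (fun z => z.1).
Proof. by split; [move=> z; exact: cvg_fst|exact: measurable_fst]. Qed.

Lemma cts_meas_snd : cts_meas (fun z => z.2).
Proof. by split; [move=> z; exact: cvg_snd|exact: measurable_snd]. Qed.

Lemma cts_meas_add f h : cts_meas f -> cts_meas h -> cts_meas (fun z => f z + h z).
Proof.
move=> [cf mf] [ch mh]; split; last exact: measurable_funD.
by move=> z; apply: cvgD; [exact: cf|exact: ch].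
Qed.

Lemma cts_meas_mul f h : cts_meas f -> cts_meas h -> cts_meas (fun z => f z * h z).
Proof.
move=> [cf mf] [ch mh]; split; last exact: measurable_funM.
by move=> z; apply: cvgM; [exact: cf|exact: ch].
Qed.

Lemma cts_meas_sub f h : cts_meas f -> cts_meas h -> cts_meas (fun z => f z - h z).
Proof.
move=> [cf mf] [ch mh]; split; last exact: measurable_funB.
by move=> z; apply: cvgB; [exact: cf|exact: ch].
Qed.

Lemma cts_meas_comp (F : R -> R) f : continuous F -> cts_meas f -> cts_meas (fun z => F (f z)).
Proof.
move=> cF [cf mf]; split.
  by move=> z; apply: continuous_comp; [exact: cf|exact: cF].
by apply: measurableT_comp => //; exact: continuous_measurable_fun.
Qed.

Lemma cts_meas_exp f n : cts_meas f -> cts_meas (fun z => f z ^+ n).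
Proof. by move=> nf; apply: (cts_meas_comp (F := fun x => x ^+ n) _ nf); exact: exprn_continuous. Qed.

(** Zeros of [f] are allowed, the inverse of 0 being 0: the chord vanishes at the pole. *)
Lemma measurable_fun_inv f : (forall z, 0 <= f z) ->
  measurable_fun [set: R * R] f -> measurable_fun [set: R * R] (fun z => (f z)^-1).
Proof.
move=> f0 mf.
rewrite (_ : (fun z => _) = (fun z => f z `^ (-1))); last first.
  by apply/funext => z; rewrite powR_inv1.
exact: (measurableT_comp (@measurable_powR R (-1)) mf).
Qed.

Lemma cts_meas_inv f : (forall z, 0 < f z) -> cts_meas f -> cts_meas (fun z => (f z)^-1).
Proof.
move=> f0 [cf mf]; split; last by apply: measurable_fun_inv => // z; exact: ltW.
by move=> z; apply: cvgV; [rewrite gt_eqF|exact: cf].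
Qed.

Lemma cts_meas_sum (I : Type) (s : seq I) (f : I -> R * R -> R) :
  (forall i, cts_meas (f i)) -> cts_meas (fun z => \sum_(i <- s) f i z).
Proof.
move=> nf; elim: s => [|i s IHs].
  by under eq_fun do rewrite big_nil; exact: cts_meas_cst.
by under eq_fun do rewrite big_cons; exact: cts_meas_add.
Qed.

Definition polar_range : set R := `[0, pi].
Definition azimuth_range : set R := `[0, 2 * pi].
Definition box : set (R * R) := polar_range `*` azimuth_range.

Lemma measurable_box : measurable box.
Proof. by apply: measurableX; exact: measurable_itv. Qed.

Lemma box_ltoo : (leb2 box < +oo)%E.
Proof.
rewrite product_measure1E; [|exact: measurable_itv..].
rewrite /= !lebesgue_measure_itv /= !lte_fin.
by rewrite !mulr_gt0 ?pi_gt0 // -!EFinB -EFinM ltry.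
Qed.

Lemma cts_meas_bounded f : cts_meas f -> exists2 M, 0 <= M & forall z, box z -> `|f z| <= M.
Proof.
move=> [cf _].
have cb : compact box by apply: compact_setX; exact: segment_compact.
have cfb : compact (f @` box).
  by apply: continuous_compact cb; exact: continuous_subspaceT.
have [M [Mr HM]] := compact_bounded cfb.
exists (`|M| + 1); first by rewrite addr_ge0.
move=> z bz; apply: HM; first by rewrite ltr_pwDr // ler_norm.
by exists z.
Qed.

Lemma cts_meas_integrable f : cts_meas f -> leb2.-integrable box (EFin \o f).
Proof.
move=> nf; have [M M0 HM] := cts_meas_bounded nf.
apply: measurable_bounded_integrable.
- exact: measurable_box.
- exact: box_ltoo.
- by apply: measurable_funTS; exact: nf.2.
- exists M; split; first exact: num_real.
  by move=> x Mx z bz; apply: (le_trans (HM _ bz)); exact: ltW.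
Qed.

Lemma int_box_fst0 f : cts_meas f ->
  (forall y, (\int[lebesgue_measure]_(x in polar_range) (f (x, y))%:E = 0)%E) ->
  (\int[leb2]_(z in box) f z)%R = 0.
Proof.
move=> nf f0; rewrite /Rintegral integral_mkcond -integral21_prod_meas1; last first.
  exact/(@integrable_mkcond _ _ _ leb2 box (EFin \o f) measurable_box)/cts_meas_integrable.
transitivity (@fine R 0%E) => //; congr fine; apply: integral0_eq => y _.
have [yA|yA] := pselect (azimuth_range y).
  rewrite -(f0 y) [RHS]integral_mkcond; apply: eq_integral => x _.
  by rewrite !patchE /box in_setX (mem_set yA) andbT.
apply: integral0_eq => x _; rewrite patchE ifF //.
by apply/negbTE; rewrite notin_setE => -[].
Qed.

Lemma int_box_snd0 f : cts_meas f ->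
  (forall x, (\int[lebesgue_measure]_(y in azimuth_range) (f (x, y))%:E = 0)%E) ->
  (\int[leb2]_(z in box) f z)%R = 0.
Proof.
move=> nf f0; rewrite /Rintegral integral_mkcond -integral12_prod_meas1; last first.
  exact/(@integrable_mkcond _ _ _ leb2 box (EFin \o f) measurable_box)/cts_meas_integrable.
transitivity (@fine R 0%E) => //; congr fine; apply: integral0_eq => x _.
have [xA|xA] := pselect (polar_range x).
  rewrite -(f0 x) [RHS]integral_mkcond; apply: eq_integral => y _.
  by rewrite !patchE /box in_setX (mem_set xA).
apply: integral0_eq => y _; rewrite patchE ifF //.
by apply/negbTE; rewrite notin_setE => -[].
Qed.

Lemma integral_derive0 (F dF : R -> R) (a b : R) : a < b ->
  (forall x, is_derive x (1 : R) F (dF x)) -> continuous dF -> F a = F b ->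
  (\int[lebesgue_measure]_(x in [set` `[a, b]%R]) (dF x)%:E = 0)%E.
Proof.
move=> ab hF cdF Fab.
have cF : continuous F.
  move=> x; apply/differentiable_continuous/derivable1_diffP.
  by have := hF x => /@ex_derive.
rewrite (continuous_FTC2 (F := F)) //.
- by rewrite Fab -EFinB subrr.
- exact: continuous_subspaceT.
- split.
  + by move=> x _; have := hF x => /@ex_derive.
  + exact: (cvg_at_right_filter (cF a)).
  + exact: (cvg_at_left_filter (cF b)).
- by move=> x _; rewrite derive1E; have := hF x => /@derive_val.
Qed.

(* The orthonormal frame attached to the spherical coordinates z = (theta, phi). *)
Definition e_rad z (i : 'I_3) : R :=
  [:: sin z.1 * cos z.2; sin z.1 * sin z.2; cos z.1]`_i.
Definition e_pol z (i : 'I_3) : R :=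
  [:: cos z.1 * cos z.2; cos z.1 * sin z.2; - sin z.1]`_i.
Definition e_azi z (i : 'I_3) : R := [:: - sin z.2; cos z.2; 0]`_i.

Lemma ord3_ind (P : 'I_3 -> Prop) : P 0 -> P 1 -> P 2 -> forall i, P i.
Proof.
move=> P0 P1 P2 [[|[|[|//]]] h].
- by rewrite (_ : Ordinal h = 0); last exact: val_inj.
- by rewrite (_ : Ordinal h = 1); last exact: val_inj.
- by rewrite (_ : Ordinal h = 2); last exact: val_inj.
Qed.

Lemma sum3E (F : 'I_3 -> R) : \sum_i F i = F 0 + F 1 + F 2.
Proof.
rewrite !big_ord_recr big_ord0 /= add0r.
by congr (F _ + F _ + F _); apply: val_inj.
Qed.

Lemma cts_meas_sin1 : cts_meas (fun z => sin z.1).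
Proof. by apply: cts_meas_comp cts_meas_fst; exact: continuous_sin. Qed.
Lemma cts_meas_sin2 : cts_meas (fun z => sin z.2).
Proof. by apply: cts_meas_comp cts_meas_snd; exact: continuous_sin. Qed.
Lemma cts_meas_cos1 : cts_meas (fun z => cos z.1).
Proof. by apply: cts_meas_comp cts_meas_fst; exact: continuous_cos. Qed.
Lemma cts_meas_cos2 : cts_meas (fun z => cos z.2).
Proof. by apply: cts_meas_comp cts_meas_snd; exact: continuous_cos. Qed.

Lemma cts_meas_opp f : cts_meas f -> cts_meas (fun z => - f z).
Proof. by move=> nf; under eq_fun do rewrite -sub0r; exact: cts_meas_sub (cts_meas_cst 0) nf. Qed.

Hint Resolve cts_meas_cst cts_meas_sin1 cts_meas_sin2 cts_meas_cos1 cts_meas_cos2 cts_meas_add cts_meas_mul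
  cts_meas_sub cts_meas_opp cts_meas_exp cts_meas_sum : cts_meas.

Lemma cts_meas_e_rad i : cts_meas (fun z => e_rad z i).
Proof. by elim/ord3_ind: i; rewrite /e_rad /=; auto with cts_meas. Qed.
Lemma cts_meas_e_pol i : cts_meas (fun z => e_pol z i).
Proof. by elim/ord3_ind: i; rewrite /e_pol /=; auto with cts_meas. Qed.
Lemma cts_meas_e_azi i : cts_meas (fun z => e_azi z i).
Proof. by elim/ord3_ind: i; rewrite /e_azi /=; auto with cts_meas. Qed.

Hint Resolve cts_meas_e_rad cts_meas_e_pol cts_meas_e_azi : cts_meas.

(* [g] plays the role of the ambient gradient; only its components tangent to
   the sphere are constrained. *)
Definition C1 f (g : 'I_3 -> R * R -> R) :=
  [/\ cts_meas f, forall j, cts_meas (g j),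
      forall a b, is_derive a (1 : R) (fun a => f (a, b)) (\sum_j g j (a, b) * e_pol (a, b) j),
      forall a b, is_derive b (1 : R) (fun b => f (a, b))
        (sin a * \sum_j g j (a, b) * e_azi (a, b) j) &
      forall a, f (a, 2 * pi) = f (a, 0)].

Lemma is_derive_add (f g : R -> R) (t df dg d : R) :
  is_derive t (1 : R) f df -> is_derive t (1 : R) g dg ->
  df + dg = d -> is_derive t (1 : R) (fun u => f u + g u) d.
Proof. by move=> hf hg <-; exact: is_deriveD. Qed.

Lemma is_derive_compE (F f : R -> R) (t dF df d : R) :
  is_derive (f t) (1 : R) F dF -> is_derive t (1 : R) f df ->
  dF * df = d -> is_derive t (1 : R) (fun u => F (f u)) d.
Proof. by move=> hF hf <-; exact: (@is_derive1_comp _ F f). Qed.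

Lemma C1_cst (a : R) : C1 (fun=> a) (fun=> fun=> 0).
Proof.
have s0 (F : 'I_3 -> R) : \sum_j 0 * F j = 0.
  by rewrite big1 // => j _; rewrite mul0r.
split; auto with cts_meas.
  by move=> c b; rewrite s0; exact: is_derive_cst.
by move=> c b; rewrite s0 mulr0; exact: is_derive_cst.
Qed.

Lemma C1_add f1 f2 g1 g2 : C1 f1 g1 -> C1 f2 g2 ->
  C1 (fun z => f1 z + f2 z) (fun j z => g1 j z + g2 j z).
Proof.
move=> [n1 m1 d1 e1 p1] [n2 m2 d2 e2 p2]; split; auto with cts_meas.
- move=> a b; apply: (is_derive_add (d1 a b) (d2 a b)).
  by rewrite !sum3E; ring.
- move=> a b; apply: (is_derive_add (e1 a b) (e2 a b)).
  by rewrite !sum3E; ring.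
- by move=> a; rewrite p1 p2.
Qed.

Lemma C1_mul f1 f2 g1 g2 : C1 f1 g1 -> C1 f2 g2 ->
  C1 (fun z => f1 z * f2 z) (fun j z => g1 j z * f2 z + f1 z * g2 j z).
Proof.
move=> [n1 m1 d1 e1 p1] [n2 m2 d2 e2 p2]; split; auto with cts_meas.
- move=> a b; apply: (is_derive_mul (d1 a b) (d2 a b)).
  by rewrite !sum3E; ring.
- move=> a b; apply: (is_derive_mul (e1 a b) (e2 a b)).
  by rewrite !sum3E; ring.
- by move=> a; rewrite p1 p2.
Qed.

Lemma C1_comp (F dF : R -> R) f g : C1 f g ->
  (forall z, is_derive (f z) (1 : R) F (dF (f z))) ->
  cts_meas (fun z => F (f z)) -> cts_meas (fun z => dF (f z)) ->
  C1 (fun z => F (f z)) (fun j z => dF (f z) * g j z).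
Proof.
move=> [n1 m1 d1 e1 p1] hF nF ndF; split; auto with cts_meas.
- move=> a b; apply: (is_derive_compE (hF (a, b)) (d1 a b)).
  by rewrite !sum3E; ring.
- move=> a b; apply: (is_derive_compE (hF (a, b)) (e1 a b)).
  by rewrite !sum3E; ring.
- by move=> a; rewrite p1.
Qed.

Lemma C1_ext f g1 g2 : (forall j z, g1 j z = g2 j z) -> C1 f g1 -> C1 f g2.
Proof. by move=> g12; have -> : g1 = g2 by apply/funext => j; apply/funext. Qed.

Lemma cos_2pi : cos (2 * pi : R) = 1.
Proof. by rewrite mulr_natl cos2pi. Qed.
Lemma sin_2pi : sin (2 * pi : R) = 0.
Proof. by rewrite mulr_natl sin2pi. Qed.

Lemma C1_e_rad i : C1 (fun z => e_rad z i) (fun j z => (i == j)%:R).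
Proof.
split; auto with cts_meas.
- move=> a b; elim/ord3_ind: i; rewrite sum3E /e_rad /e_pol /= !mul0r mul1r ?(addr0, add0r).
  + by apply: (is_derive_mul (is_derive_sin a) (is_derive_cst _ _ _)) => /=; ring.
  + by apply: (is_derive_mul (is_derive_sin a) (is_derive_cst _ _ _)) => /=; ring.
  + exact: is_derive_cos.
- move=> a b; elim/ord3_ind: i; rewrite sum3E /e_rad /e_azi /= !mul0r mul1r ?(addr0, add0r).
  + exact: (is_derive_cstM (is_derive_cos b) erefl).
  + exact: (is_derive_cstM (is_derive_sin b) erefl).
  + by rewrite mulr0; exact: is_derive_cst.
- by move=> a; elim/ord3_ind: i; rewrite /e_rad /= ?cos_2pi ?sin_2pi ?cos0 ?sin0.
Qed.

(** * Polynomials on the sphere and the divergence theorem *)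

Definition peval (p : mpoly.mpoly 3 R) z : R := mpoly.meval (e_rad z) p.

Lemma C1_peval p : C1 (peval p) (fun j => peval (mpoly.mderiv j p)).
Proof.
have CM (p1 p2 : mpoly.mpoly 3 R) : C1 (peval p1) (fun j => peval (mpoly.mderiv j p1)) ->
    C1 (peval p2) (fun j => peval (mpoly.mderiv j p2)) ->
    C1 (peval (p1 * p2)) (fun j => peval (mpoly.mderiv j (p1 * p2))).
  move=> C_1 C_2; have := C1_mul C_1 C_2.
  rewrite (_ : (fun z => _) = peval (p1 * p2)); last first.
    by apply/funext => z; rewrite /peval mpoly.mevalM.
  apply: C1_ext => j z; rewrite /peval mpoly.mderivM mpoly.mevalD !mpoly.mevalM.
  by rewrite addrC [X in _ + X]mulrC addrC mulrC.
have Ccst (c : R) : C1 (peval (mpoly.mpolyC 3 c)) (fun j => peval (mpoly.mderiv j (mpoly.mpolyC 3 c))).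
  rewrite (_ : peval _ = fun=> c); last by apply/funext => z; rewrite /peval mpoly.mevalC.
  apply: C1_ext (C1_cst c) => j z.
  by rewrite mpoly.mderivC /peval mpoly.meval0.
have CX (m : mpoly.multinom 3) : C1 (peval (mpoly.mpolyX R m)) (fun j => peval (mpoly.mderiv j (mpoly.mpolyX R m))).
  rewrite mpoly.mpolyXE_id; elim/big_ind: _ => //.
    by have := Ccst 1; rewrite mpoly.mpolyC1.
  move=> i _; elim: (m i) => [|n IHn]; first by rewrite expr0 -mpoly.mpolyC1; exact: Ccst.
  rewrite exprS; apply: CM => //.
  rewrite (_ : peval _ = fun z => e_rad z i); last first.
    by apply/funext => z; rewrite /peval mpoly.mevalXU.
  apply: C1_ext (C1_e_rad i) => j z.
  rewrite /peval mpoly.mderivX mpoly.mnm1E mpoly.mevalZ mpoly.mevalX.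
  have [->|ij] := eqVneq i j; last by rewrite mul0r.
  rewrite mul1r big1 // => l _; rewrite mpoly.mnmBE mpoly.mnm1E.
  by rewrite subnn expr0.
elim/mpoly.mpolyind: p => [|c m p _ _ IHp].
  by have := Ccst 0; rewrite mpoly.mpolyC0.
have := C1_add (CM _ _ (Ccst c) (CX m)) IHp.
rewrite (_ : (fun z => _) = peval (c *: mpoly.mpolyX R m + p)); last first.
  by apply/funext => z; rewrite /peval mpoly.mevalD mpoly.mul_mpolyC.
apply: C1_ext => j z; rewrite /peval mpoly.mderivD mpoly.mevalD.
by rewrite mpoly.mul_mpolyC.
Qed.

(** The integrand is the i-th component of the tangential gradient, minus the curvature term. In
    coordinates it is the theta-derivative of sin theta [e_pol] f plus the phi-derivative of [e_azi]
    f. The first integrates to 0 because sin vanishes at 0 and pi, the second by periodicity; the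
    density sin theta cancels the singularity of the coordinates. *)
Lemma sphere_divergence f g i : C1 f g ->
  \int[leb2]_(z in box)
     ((g i z - e_rad z i * \sum_j e_rad z j * g j z - 2 * e_rad z i * f z) * sin z.1) = 0.
Proof.
move=> [nf ng d1 d2 per].
pose F z := sin z.1 * (e_pol z i * f z).
pose dF z := cos z.1 * (e_pol z i * f z) +
  sin z.1 * (- e_rad z i * f z + e_pol z i * \sum_j g j z * e_pol z j).
pose H z := e_azi z i * f z.
(* Minus the phi-derivative of [e_azi]. *)
pose w z : R := [:: cos z.2; sin z.2; 0]`_i.
pose dH z := - w z * f z + e_azi z i * (sin z.1 * \sum_j g j z * e_azi z j).
have nw : cts_meas w.
  suff: forall i : 'I_3, cts_meas (fun z => [:: cos z.2; sin z.2; 0]`_i) by exact.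
  by elim/ord3_ind => /=; auto with cts_meas.
have ndF : cts_meas dF by rewrite /dF; auto 10 with cts_meas.
have ndH : cts_meas dH by rewrite /dH; auto 10 with cts_meas.
have -> : \int[leb2]_(z in box)
     ((g i z - e_rad z i * \sum_j e_rad z j * g j z - 2 * e_rad z i * f z) * sin z.1) =
   \int[leb2]_(z in box) (dF z + dH z).
  congr Rintegral; apply/funext => -[a b]; rewrite /dF /dH /w !sum3E.
  (* The integrands agree modulo sin^2 + cos^2 = 1 for the two angles. For each component, the
     displayed multiples of these two relations turn the equality into a ring identity. *)
  have e1 : sin a * sin a + cos a * cos a - 1 = 0.
    by rewrite -!expr2 [X in X - 1]addrC cos2Dsin2 subrr.
  have e2 : sin b * sin b + cos b * cos b - 1 = 0.
    by rewrite -!expr2 [X in X - 1]addrC cos2Dsin2 subrr.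
  elim/ord3_ind: i {F dF H dH w nw ndF ndH}; rewrite /e_rad /e_pol /e_azi /=;
    move: (g 0 _) (g 1 _) (g 2 _) (f _) => G0 G1 G2 f0;
    move: e1 e2; set s := sin a; set c := cos a; set S := sin b; set C := cos b => e1 e2.
  - transitivity (c * (c * C * f0) + s * (- (s * C) * f0 + c * C *
      (G0 * (c * C) + G1 * (c * S) + G2 * - s)) +
      (- C * f0 + - S * (s * (G0 * - S + G1 * C + G2 * 0))) +
      (s * s + c * c - 1) * (- (s * G0 * C * C) - s * C * S * G1 - C * f0) -
      (S * S + C * C - 1) * (s * G0)); first by ring.
    by rewrite e1 e2; ring.
  - transitivity (c * (c * S * f0) + s * (- (s * S) * f0 + c * S *
      (G0 * (c * C) + G1 * (c * S) + G2 * - s)) +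
      (- S * f0 + C * (s * (G0 * - S + G1 * C + G2 * 0))) +
      (s * s + c * c - 1) * (- (s * G1 * S * S) - s * C * S * G0 - S * f0) -
      (S * S + C * C - 1) * (s * G1)); first by ring.
    by rewrite e1 e2; ring.
  - transitivity (c * (- s * f0) + s * (- c * f0 + - s *
      (G0 * (c * C) + G1 * (c * S) + G2 * - s)) +
      (- 0 * f0 + 0 * (s * (G0 * - S + G1 * C + G2 * 0))) -
      (s * s + c * c - 1) * (s * G2)); first by ring.
    by rewrite e1; ring.
rewrite RintegralD; [|exact: measurable_box|exact: cts_meas_integrable..].
have nice1 h y : cts_meas h -> continuous (fun x => h (x, y)).
  move=> [ch _] x; apply: (continuous_comp (f := fun x => (x, y)) _ (ch (x, y))).
  refine (@cvg_pair R R R (nbhs x) (nbhs x) (nbhs y) _ _ _ id (fun=> y) _ _).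
    exact: cvg_id.
  exact: cvg_cst.
have nice2 h x : cts_meas h -> continuous (fun y => h (x, y)).
  move=> [ch _] y; apply: (continuous_comp (f := fun y => (x, y)) _ (ch (x, y))).
  refine (@cvg_pair R R R (nbhs y) (nbhs x) (nbhs y) _ _ _ (fun=> x) id _ _).
    exact: cvg_cst.
  exact: cvg_id.
rewrite int_box_fst0 ?int_box_snd0 ?addr0 // => [x|y].
- apply: (integral_derive0 (F := fun y => H (x, y))).
  + by rewrite mulr_gt0 ?pi_gt0.
  + move=> y; apply: (is_derive_mul _ (d2 x y) erefl).
    suff: forall i : 'I_3, is_derive y (1 : R) (fun b => e_azi (x, b) i)
      (- [:: cos y; sin y; 0]`_i) by exact.
    elim/ord3_ind; rewrite /e_azi /=.
    * by apply: is_derive_eq.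
    * exact: is_derive_cos.
    * by rewrite oppr0; exact: is_derive_cst.
  + exact: nice2.
  + rewrite /H per; congr (_ * _).
    by elim/ord3_ind: i {F dF H dH w nw ndF ndH}; rewrite /e_azi /= ?cos_2pi ?sin_2pi ?cos0 ?sin0.
- apply: (integral_derive0 (F := fun x => F (x, y))).
  + exact: pi_gt0.
  + move=> x; apply: (is_derive_mul (is_derive_sin x) _ erefl).
    apply: (is_derive_mul _ (d1 x y) erefl).
    suff: forall i : 'I_3, is_derive x (1 : R) (fun a => e_pol (a, y) i)
      (- e_rad (x, y) i) by exact.
    elim/ord3_ind; rewrite /e_pol /e_rad /=.
    * by apply: (is_derive_mul (is_derive_cos x) (is_derive_cst _ _ _)) => /=; ring.
    * by apply: (is_derive_mul (is_derive_cos x) (is_derive_cst _ _ _)) => /=; ring.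
    * by apply: is_derive_eq.
  + exact: nice1.
  + by rewrite /F /= sin0 sinpi !mul0r.
Qed.
Lemma sphere_divergence_vec (f : 'I_3 -> R * R -> R) (g : 'I_3 -> 'I_3 -> R * R -> R) :
  (forall i, C1 (f i) (g i)) ->
  \int[leb2]_(z in box)
     ((\sum_i (g i i z - e_rad z i * \sum_j e_rad z j * g i j z - 2 * e_rad z i * f i z)) * sin z.1) = 0.
Proof.
move=> Cf.
pose h i z := (g i i z - e_rad z i * \sum_j e_rad z j * g i j z - 2 * e_rad z i * f i z) * sin z.1.
have nh i : cts_meas (h i).
  have [nf ng _ _ _] := Cf i; rewrite /h.
  apply: cts_meas_mul; last exact: cts_meas_sin1.
  apply: cts_meas_sub; last by apply: cts_meas_mul nf; auto with cts_meas.
  apply: cts_meas_sub; first exact: ng.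
  apply: cts_meas_mul; first exact: cts_meas_e_rad.
  by apply: cts_meas_sum => j; apply: cts_meas_mul; [exact: cts_meas_e_rad|exact: ng].
have ih i : leb2.-integrable box (EFin \o h i) by exact: cts_meas_integrable.
have -> : \int[leb2]_(z in box) ((\sum_i (g i i z - e_rad z i * \sum_j e_rad z j * g i j z -
    2 * e_rad z i * f i z)) * sin z.1) = \int[leb2]_(z in box) (h 0 z + h 1 z + h 2 z).
  by congr Rintegral; apply/funext => z; rewrite [X in X * _]sum3E mulrDl [X in X + _]mulrDl.
rewrite RintegralD; [|exact: measurable_box| |exact: ih]; last first.
  by apply: cts_meas_integrable; exact: cts_meas_add.
rewrite RintegralD; [|exact: measurable_box|exact: ih|exact: ih].
by rewrite /h !sphere_divergence ?addr0.
Qed.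

(** * Homogeneous and harmonic polynomials *)

Definition homogeneous m (p : mpoly.mpoly 3 R) : Prop := p \is mpoly.ishomog1 m mpoly.mdeg.

Lemma euler_homogeneous m p (x : 'I_3 -> R) : homogeneous m p ->
  \sum_i x i * mpoly.meval x (mpoly.mderiv i p) = m%:R * mpoly.meval x p.
Proof.
move=> /mpoly.dhomogP hp.
rewrite {2}(mpoly.mpolyE p) raddf_sum mulr_sumr.
under eq_bigr do rewrite /mpoly.mderiv raddf_sum mulr_sumr.
rewrite exchange_big; apply: eq_big_seq => M /hp hM /=.
have -> : m = (\sum_i M i)%N by rewrite -mpoly.mdegE -hM.
rewrite mpoly.mevalZ mpoly.mevalX natr_sum mulr_suml.
apply: eq_bigr => i _; rewrite mpoly.mevalZ mpoly.mevalX.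
have [Mi|Mi] := posnP (M i); first by rewrite Mi !mul0r mulr0.
have -> : \prod_i0 x i0 ^+ M i0 =
    x i * \prod_i0 x i0 ^+ (mpoly.mnm_sub M (mpoly.mnm1 i)) i0.
  rewrite (bigD1 i) //= [in RHS](bigD1 i) //= mulrA; congr (_ * _).
    by rewrite mpoly.mnmBE mpoly.mnm1E eqxx subn1 -exprS prednK.
  apply: eq_bigr => j ji; rewrite mpoly.mnmBE mpoly.mnm1E eq_sym (negbTE ji).
  by rewrite subn0.
by ring.
Qed.

Lemma homogeneous_mderiv m p i : homogeneous m.+1 p -> homogeneous m (mpoly.mderiv i p).
Proof.
move=> /mpoly.dhomogP hp; apply/mpoly.dhomogP => M.
rewrite mpoly.mcoeff_msupp mpoly.mcoeff_deriv => hM.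
have /hp : (mpoly.mnm_add M (mpoly.mnm1 i)) \in mpoly.msupp p.
  by rewrite mpoly.mcoeff_msupp; apply: contra_neq hM => ->; rewrite mul0rn.
by move=> /= hd; apply: succn_inj; rewrite -hd mpoly.mdegD mpoly.mdeg1 addn1.
Qed.

Lemma mderiv_homogeneous0 p i : homogeneous 0 p -> mpoly.mderiv i p = 0.
Proof.
move=> /mpoly.dhomogP hp; apply/mpoly.mpolyP => M.
rewrite mpoly.mcoeff0 mpoly.mcoeff_deriv.
rewrite mpoly.memN_msupp_eq0 ?mul0rn //; apply/negP => /hp /= /eqP.
by rewrite mpoly.mdegD mpoly.mdeg1 addn1.
Qed.

Definition harmonic_poly (p : mpoly.mpoly 3 R) : Prop :=
  \sum_i mpoly.mderiv i (mpoly.mderiv i p) = 0.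

Lemma harmonic_mderiv p i : harmonic_poly p -> harmonic_poly (mpoly.mderiv i p).
Proof.
move=> hp; rewrite /harmonic_poly; under eq_bigr => j _.
  rewrite [mpoly.mderiv j (mpoly.mderiv i p)]mpoly.mderiv_comm mpoly.mderiv_comm; over.
by rewrite -raddf_sum hp raddf0.
Qed.

Definition mderiv_along (xi : 'I_3 -> R) (p : mpoly.mpoly 3 R) : mpoly.mpoly 3 R :=
  \sum_i xi i *: mpoly.mderiv i p.

Lemma homogeneous_mderiv_along xi m p :
  homogeneous m.+1 p -> homogeneous m (mderiv_along xi p).
Proof.
move=> hp; apply: rpred_sum => i _; apply: mpoly.dhomogZ.
exact: homogeneous_mderiv.
Qed.

Lemma harmonic_mderiv_along xi p : harmonic_poly p -> harmonic_poly (mderiv_along xi p).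
Proof.
move=> hp; rewrite /harmonic_poly /mderiv_along.
have mderiv_sum j (F : 'I_3 -> mpoly.mpoly 3 R) :
    mpoly.mderiv j (\sum_i F i) = \sum_i mpoly.mderiv j (F i).
  exact: (raddf_sum (mpoly.mderiv j)).
under eq_bigr => j _.
  rewrite !mderiv_sum; under eq_bigr do rewrite !mpoly.mderivZ.
  over.
rewrite exchange_big big1 // => i _ /=; rewrite -scaler_sumr.
by rewrite (harmonic_mderiv i hp) scaler0.
Qed.

Lemma meval_mderiv_along xi p (x : 'I_3 -> R) :
  mpoly.meval x (mderiv_along xi p) = \sum_i xi i * mpoly.meval x (mpoly.mderiv i p).
Proof.
by rewrite /mderiv_along raddf_sum; apply: eq_bigr => i _ /=; rewrite mpoly.mevalZ.
Qed.

Lemma is_derive_affine (a b t : R) : is_derive t (1 : R) (fun x => a + b * x) b.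
Proof.
rewrite (_ : (fun x => _) = cst a + b \*: id) //.
by apply: is_derive_eq; rewrite add0r /GRing.scale /= mulr1.
Qed.

(** * Regularised powers of the chord and their divergence identities *)

Section FixedPole.
Variable xi : 'I_3 -> R.
Hypothesis xi_unit : \sum_i xi i ^+ 2 = 1.

Definition dotp z := \sum_i xi i * e_rad z i.
(** The squared distance from xi, by [chord2E]. Being affine in [dotp], it lets the kernels be
    differentiated as functions of [dotp], whose ambient gradient is the constant vector xi. *)
Definition chord2 z := 2 - 2 * dotp z.
Definition chord z := Num.sqrt (chord2 z).
(** For e > 0 this stays positive at the pole, so all its powers are smooth. *)
Definition rchord e z := Num.sqrt (chord2 z + e).

Lemma e_rad_unit z : \sum_i e_rad z i ^+ 2 = 1.
Proof.
rewrite sum3E /e_rad /= !exprMn -mulrDr cos2Dsin2 mulr1.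
by rewrite addrC cos2Dsin2.
Qed.

Lemma chord2E z : chord2 z = \sum_i (xi i - e_rad z i) ^+ 2.
Proof.
have := xi_unit; have := e_rad_unit z; rewrite /chord2 /dotp !sum3E => h1 h2.
by transitivity ((xi 0 ^+ 2 + xi 1 ^+ 2 + xi 2 ^+ 2) + (e_rad z 0 ^+ 2 + e_rad z 1 ^+ 2 + e_rad z 2 ^+ 2)
  - 2 * (xi 0 * e_rad z 0 + xi 1 * e_rad z 1 + xi 2 * e_rad z 2)); [rewrite h1 h2; ring|ring].
Qed.

Lemma chord2_ge0 z : 0 <= chord2 z.
Proof. by rewrite chord2E sumr_ge0 // => i _; rewrite sqr_ge0. Qed.

Lemma chord2_le4 z : chord2 z <= 4.
Proof.
have h : 0 <= \sum_i (xi i + e_rad z i) ^+ 2 by rewrite sumr_ge0 // => i _; rewrite sqr_ge0.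
have := xi_unit; have := e_rad_unit z; move: h; rewrite /chord2 /dotp !sum3E; nra.
Qed.

Lemma chord_ge0 z : 0 <= chord z. Proof. exact: sqrtr_ge0. Qed.

Lemma sqr_chord z : chord z ^+ 2 = chord2 z.
Proof. by rewrite sqr_sqrtr ?chord2_ge0. Qed.

Lemma chord_le2 z : chord z <= 2.
Proof.
rewrite -(@ler_pXn2r _ 2) // ?nnegrE ?chord_ge0 // sqr_chord.
by rewrite -natrX (le_trans (chord2_le4 z)).
Qed.

Lemma dotpE z : dotp z = 1 - chord z ^+ 2 / 2.
Proof. by rewrite sqr_chord /chord2; field. Qed.

Lemma sqr_rchord e z : 0 < e -> rchord e z ^+ 2 = chord z ^+ 2 + e.
Proof. by move=> e0; rewrite sqr_chord sqr_sqrtr // addr_ge0 ?chord2_ge0 // ltW. Qed.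

Lemma rchord_gt0 e z : 0 < e -> 0 < rchord e z.
Proof. by move=> e0; rewrite sqrtr_gt0 ltr_wpDl ?chord2_ge0. Qed.

Lemma cts_meas_dotp : cts_meas dotp.
Proof. by apply: cts_meas_sum => i; apply: cts_meas_mul; auto with cts_meas. Qed.

Lemma cts_meas_chord2 : cts_meas chord2.
Proof. by apply: cts_meas_sub; [exact: cts_meas_cst|apply: cts_meas_mul cts_meas_dotp; exact: cts_meas_cst]. Qed.

Lemma cts_meas_chord : cts_meas chord.
Proof. by apply: cts_meas_comp cts_meas_chord2; exact: sqrt_continuous. Qed.

Lemma cts_meas_rchord e : cts_meas (rchord e).
Proof.
apply: (cts_meas_comp (F := Num.sqrt)); first exact: sqrt_continuous.
by apply: cts_meas_add cts_meas_chord2 (cts_meas_cst e).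
Qed.

Lemma C1_dotp : C1 dotp (fun j => fun=> xi j).
Proof.
have C1s i : C1 (fun z => xi i * e_rad z i) (fun j z => xi i * (i == j)%:R).
  by apply: C1_ext (C1_mul (C1_cst (xi i)) (C1_e_rad i)) => j z; rewrite mul0r add0r.
have := C1_add (C1_add (C1s 0) (C1s 1)) (C1s 2).
rewrite (_ : (fun z => _) = dotp); last by apply/funext => z; rewrite /dotp sum3E.
apply: C1_ext => j z; elim/ord3_ind: j; rewrite /= !mulr0 mulr1; by rewrite ?(addr0, add0r).
Qed.

(* A smooth approximation, as [e] tends to [0], of [chord z ^ (p - 1)]. *)
Definition kern p e z := rchord e z ^+ p / rchord e z.
(* The derivative of [kern p e] as a function of [dotp]. *)
Definition dkern p e z := - (p%:R - 1) * rchord e z ^+ p / rchord e z ^+ 3.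

Lemma cts_meas_rchordV e : 0 < e -> cts_meas (fun z => (rchord e z)^-1).
Proof. by move=> e0; apply: cts_meas_inv (cts_meas_rchord e) => z; exact: rchord_gt0. Qed.

Lemma cts_meas_kern p e : 0 < e -> cts_meas (kern p e).
Proof.
move=> e0; apply: cts_meas_mul; last exact: cts_meas_rchordV.
by apply: cts_meas_exp; exact: cts_meas_rchord.
Qed.

Lemma cts_meas_dkern p e : 0 < e -> cts_meas (dkern p e).
Proof.
move=> e0; apply: cts_meas_mul; first by apply: cts_meas_mul (cts_meas_cst _) (cts_meas_exp _ (cts_meas_rchord e)).
under eq_fun do rewrite -exprVn.
exact: cts_meas_exp (cts_meas_rchordV e0).
Qed.

Lemma C1_kern p e : 0 < e -> C1 (kern p e) (fun j z => dkern p e z * xi j).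
Proof.
move=> e0.
pose S x := Num.sqrt (2 - 2 * x + e).
apply: (C1_comp (F := fun x => S x ^+ p / S x)
  (dF := fun x => - (p%:R - 1) * S x ^+ p / S x ^+ 3) C1_dotp).
- move=> z; set x := dotp z.
  have Sx : 0 < S x by exact: rchord_gt0.
  have dl : is_derive x (1 : R) (fun x => 2 - 2 * x + e) (- 2).
    rewrite (_ : (fun x => _) = (fun x => (2 + e) + (- 2) * x)); last first.
      by apply/funext => y; ring.
    exact: is_derive_affine.
  have arg0 : 0 < 2 - 2 * x + e by rewrite -sqrtr_gt0.
  have dS : is_derive x (1 : R) S (- (S x)^-1).
    apply: (is_derive_compE (f := fun x => 2 - 2 * x + e) (is_derive1_sqrt arg0) dl).
    by rewrite -/(S x); field; rewrite gt_eqF.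
  have dV := is_deriveV (f := S) (lt0r_neq0 Sx) dS.
  have dX : is_derive x (1 : R) (fun x => S x ^+ p) (p%:R * S x ^+ p.-1 * - (S x)^-1).
    exact: (is_derive_compE (is_derive_exp p (S x)) dS erefl).
  apply: (is_derive_mul dX dV).
  rewrite /GRing.scale /=; case: p {dX} => [|p] /=.
    by rewrite !expr0; field; rewrite gt_eqF.
  by rewrite exprS; field; rewrite gt_eqF.
- exact: cts_meas_kern.
- exact: cts_meas_dkern.
Qed.

(* The tangential divergence theorem for the field [kern * q * xi]. *)
Lemma kern_identity1 m q p e : homogeneous m q -> 0 < e ->
  \int[leb2]_(z in box) (((1 - dotp z ^+ 2) * dkern p e z * peval q z
     + kern p e z * peval (mderiv_along xi q) z
     - m.+2%:R * dotp z * kern p e z * peval q z) * sin z.1) = 0.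
Proof.
move=> hq e0; have Ck := C1_mul (C1_kern p e0) (C1_peval q).
have Cf i : C1 (fun z => xi i * (kern p e z * peval q z)) (fun j z => xi i *
    (dkern p e z * xi j * peval q z + kern p e z * peval (mpoly.mderiv j q) z)).
  by apply: C1_ext (C1_mul (C1_cst (xi i)) Ck) => j z; rewrite mul0r add0r.
rewrite -[RHS](sphere_divergence_vec Cf); congr Rintegral; apply/funext => z.
congr (_ * _).
have := euler_homogeneous (e_rad z) hq; have := xi_unit.
rewrite /peval meval_mderiv_along -[m.+2%:R]natr1 -[m.+1%:R]natr1 /dotp !sum3E.
set q0 := mpoly.meval _ q; set d0 := mpoly.meval _ (mpoly.mderiv 0 q).
set d1 := mpoly.meval _ (mpoly.mderiv 1 q); set d2 := mpoly.meval _ (mpoly.mderiv 2 q).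
move: (e_rad z 0) (e_rad z 1) (e_rad z 2) (kern p e z) (dkern p e z) => a b c K dK hX hE.
(* The divergence is regrouped so that |xi|^2 and the radial derivative of [q] appear as subterms,
   to be replaced by 1 and by m q. *)
transitivity ((xi 0 ^+ 2 + xi 1 ^+ 2 + xi 2 ^+ 2 - (xi 0 * a + xi 1 * b + xi 2 * c) ^+ 2) * dK * q0 +
  K * (xi 0 * d0 + xi 1 * d1 + xi 2 * d2) -
  (xi 0 * a + xi 1 * b + xi 2 * c) * K * (a * d0 + b * d1 + c * d2) -
  2 * (xi 0 * a + xi 1 * b + xi 2 * c) * K * q0); last by ring.
by rewrite hX hE; ring.
Qed.

(* The tangential divergence theorem for the field [kern * grad q]. *)
Lemma kern_identity2 m q p e : homogeneous m q -> harmonic_poly q -> 0 < e ->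
  \int[leb2]_(z in box) ((dkern p e z * peval (mderiv_along xi q) z
     - m%:R * dotp z * dkern p e z * peval q z
     - m%:R * m.+1%:R * kern p e z * peval q z) * sin z.1) = 0.
Proof.
move=> hq hh e0.
have Cf i : C1 (fun z => kern p e z * peval (mpoly.mderiv i q) z) (fun j z =>
    dkern p e z * xi j * peval (mpoly.mderiv i q) z +
    kern p e z * peval (mpoly.mderiv j (mpoly.mderiv i q)) z).
  exact: C1_mul (C1_kern p e0) (C1_peval _).
rewrite -[RHS](sphere_divergence_vec Cf); congr Rintegral; apply/funext => z.
congr (_ * _).
have hE2 i : \sum_j e_rad z j * mpoly.meval (e_rad z) (mpoly.mderiv j (mpoly.mderiv i q)) =
    (m%:R - 1) * mpoly.meval (e_rad z) (mpoly.mderiv i q).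
  (* For m = 0 the factor m - 1 is the real number -1, but it multiplies a zero derivative. *)
  case: m hq => [|m'] hq; first by rewrite mderiv_homogeneous0 // mpoly.meval0 mulr0 big1 // => j _;
    rewrite raddf0 mpoly.meval0 mulr0.
  by rewrite (euler_homogeneous _ (homogeneous_mderiv i hq)) -natr1 addrK.
have hL : \sum_i mpoly.meval (e_rad z) (mpoly.mderiv i (mpoly.mderiv i q)) = 0.
  by have := congr1 (mpoly.meval (e_rad z)) hh; rewrite raddf_sum mpoly.meval0.
have := hL; have := hE2 0; have := hE2 1; have := hE2 2.
have := euler_homogeneous (e_rad z) hq; have := xi_unit.
rewrite /peval meval_mderiv_along -[m.+1%:R]natr1 /dotp !sum3E.
set q0 := mpoly.meval _ q; set d0 := mpoly.meval _ (mpoly.mderiv 0 q).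
set d1 := mpoly.meval _ (mpoly.mderiv 1 q); set d2 := mpoly.meval _ (mpoly.mderiv 2 q).
(* The values are generalised in the order in which the hypotheses present them: [d0j], [d1j], [d2j]
   are the j-th derivatives of the gradient components 2, 1, 0. The Laplacian is thus
   [d20 + d11 + d02]. *)
move: (mpoly.meval _ _) => d00; move: (mpoly.meval _ _) => d01; move: (mpoly.meval _ _) => d02.
move: (mpoly.meval _ _) => d10; move: (mpoly.meval _ _) => d11; move: (mpoly.meval _ _) => d12.
move: (mpoly.meval _ _) => d20; move: (mpoly.meval _ _) => d21; move: (mpoly.meval _ _) => d22.
move: (e_rad z 0) (e_rad z 1) (e_rad z 2) (kern p e z) (dkern p e z) => a b c K dK hX hE h2 h1 h0 hl.
transitivity (dK * (xi 0 * d0 + xi 1 * d1 + xi 2 * d2) + K * (d20 + d11 + d02) -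
  (xi 0 * a + xi 1 * b + xi 2 * c) * dK * (a * d0 + b * d1 + c * d2) -
  K * (a * (a * d20 + b * d21 + c * d22) + b * (a * d10 + b * d11 + c * d12) +
    c * (a * d00 + b * d01 + c * d02)) - 2 * K * (a * d0 + b * d1 + c * d2)); last by ring.
rewrite h0 h1 h2 hl.
rewrite (_ : a * ((m%:R - 1) * d0) + b * ((m%:R - 1) * d1) + c * ((m%:R - 1) * d2) =
  (m%:R - 1) * (a * d0 + b * d1 + c * d2)); last by ring.
by rewrite hE; ring.
Qed.

End FixedPole.

(** * Integrability of the inverse chord and dominated convergence *)

Section WeaklySingular.
Variable xi : 'I_3 -> R.
Hypothesis xi_unit : \sum_i xi i ^+ 2 = 1.

Lemma box_sin_ge0 z : box z -> 0 <= sin z.1.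
Proof. by case=> /=; rewrite /polar_range/= in_itv /= => h _; exact: sin_ge0_pi. Qed.

Lemma homogeneous1 : homogeneous 0 (1 : mpoly.mpoly 3 R).
Proof. exact: mpoly.dhomog1. Qed.

Lemma mderiv1 i : mpoly.mderiv i (1 : mpoly.mpoly 3 R) = 0.
Proof. by rewrite -mpoly.mpolyC1 mpoly.mderivC. Qed.

Lemma cts_meas_le_int (f h : R * R -> R) : cts_meas f -> cts_meas h ->
  (forall z, box z -> f z <= h z) ->
  \int[leb2]_(z in box) (f z * sin z.1) <= \int[leb2]_(z in box) (h z * sin z.1).
Proof.
move=> nf nh fh; apply: le_Rintegral; first exact: measurable_box.
- by apply: cts_meas_integrable; apply: cts_meas_mul nf cts_meas_sin1.
- by apply: cts_meas_integrable; apply: cts_meas_mul nh cts_meas_sin1.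
- by move=> z bz; rewrite ler_wpM2r ?box_sin_ge0 ?fh.
Qed.

(** What matters is uniformity in [e]. The integrand [h] of [kern_identity1] for p = 0 and q = 1 has
    integral 0, and 1/rchord <= 3/2 - h pointwise. *)
Lemma int_rchordV_le e : 0 < e ->
  \int[leb2]_(z in box) ((rchord xi e z)^-1 * sin z.1) <=
  3 / 2 * \int[leb2]_(z in box) (sin z.1).
Proof.
move=> e0.
have nu := cts_meas_rchordV xi_unit e0.
pose h z := (1 - dotp xi z ^+ 2) * dkern xi 0 e z * peval 1 z
     + kern xi 0 e z * peval (mderiv_along xi 1) z
     - 2 * dotp xi z * kern xi 0 e z * peval 1 z.
have h0 : \int[leb2]_(z in box) (h z * sin z.1) = 0.
  exact: (kern_identity1 xi_unit 0 homogeneous1 e0).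
have nh : cts_meas h.
  have nd := cts_meas_dotp xi; have nk := cts_meas_kern xi_unit 0 e0; have ndk := cts_meas_dkern xi_unit 0 e0.
  have [n1 _ _ _ _] := C1_peval (1 : mpoly.mpoly 3 R).
  have [n2 _ _ _ _] := C1_peval (mderiv_along xi 1).
  apply: cts_meas_sub; last by apply: cts_meas_mul n1; apply: cts_meas_mul nk; apply: cts_meas_mul nd; exact: cts_meas_cst.
  apply: cts_meas_add; last exact: cts_meas_mul.
  apply: cts_meas_mul n1; apply: cts_meas_mul ndk; apply: cts_meas_sub (cts_meas_cst _) _.
  exact: cts_meas_exp.
rewrite -RintegralZl; [|exact: measurable_box|exact: cts_meas_integrable cts_meas_sin1].
have -> : \int[leb2]_(z in box) (3 / 2 * sin z.1) =
    \int[leb2]_(z in box) ((3 / 2 - h z) * sin z.1).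
  have -> : \int[leb2]_(z in box) ((3 / 2 - h z) * sin z.1) =
      \int[leb2]_(z in box) (3 / 2 * sin z.1 - h z * sin z.1).
    by congr Rintegral; apply/funext => z; rewrite mulrBl.
  rewrite RintegralB ?h0 ?subr0 //; first exact: measurable_box.
  - by apply: cts_meas_integrable; apply: cts_meas_mul cts_meas_sin1; exact: cts_meas_cst.
  - by apply: cts_meas_integrable; apply: cts_meas_mul cts_meas_sin1.
apply: cts_meas_le_int => // [|z bz]; first by apply: cts_meas_sub nh; exact: cts_meas_cst.
have w0 := rchord_gt0 xi_unit z e0; have w2 := sqr_rchord xi_unit z e0.
have s0 := chord_ge0 xi z; have s2 := chord_le2 xi_unit z.
rewrite /h /dkern /kern /peval meval_mderiv_along mpoly.meval1 big1 => [|i _]; last first.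
  by rewrite mderiv1 mpoly.meval0 mulr0.
rewrite (dotpE xi_unit) !expr0 mulr0 addr0 !mulr1 sub0r opprK mul1r.
move: (chord xi z) (rchord xi e z) w0 w2 s0 s2 => s w w0 w2 s0 s2.
have sw : s <= w by rewrite -(@ler_pXn2r _ 2) ?nnegrE ?(ltW w0) // w2 lerDl ltW.
have v0 : 0 < w^-1 by rewrite invr_gt0.
have a0 : 0 <= s / w by rewrite divr_ge0 // ltW.
have a1 : s / w <= 1 by rewrite ler_pdivrMr // mul1r.
(* Bounding (s/w)^2 by 1 leaves at least 3/2 + 1/w - (3/4) s^2/w. As s <= w and s <= 2, we have
   s^2/w <= 2, whence the constant 3/2. *)
have -> : 3 / 2 - ((1 - (1 - s ^+ 2 / 2) ^+ 2) / w ^+ 3 - 2 * (1 - s ^+ 2 / 2) * (1 / w)) =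
    3 / 2 - (1 - s ^+ 2 / 4) * ((s / w) ^+ 2 * w^-1) + 2 * w^-1 - s * (s / w).
  by field; rewrite gt_eqF.
have h1 : (s / w) ^+ 2 * w^-1 <= w^-1 by rewrite ger_pMl // expr_le1.
have h2 : 0 <= 1 - s ^+ 2 / 4 by nra.
have h3 : (1 - s ^+ 2 / 4) * ((s / w) ^+ 2 * w^-1) <= (1 - s ^+ 2 / 4) * w^-1.
  by rewrite ler_wpM2l.
have h4 : s ^+ 2 / 4 * w^-1 = s * (s / w) / 4 by field; rewrite gt_eqF.
have h5 : s * (s / w) <= 2 by nra.
by lra.
Qed.

(** Its value at the pole is 0 by the convention on inverses; the pole is negligible. *)
Definition inv_chord z := (chord xi z)^-1.

Lemma measurable_chord : measurable_fun [set: R * R] (chord xi).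
Proof. by have [] := cts_meas_chord xi. Qed.

Lemma measurable_inv_chord : measurable_fun [set: R * R] inv_chord.
Proof. by apply: measurable_fun_inv measurable_chord => z; exact: chord_ge0. Qed.

Lemma integrable_inv_chord :
  leb2.-integrable box (EFin \o (fun z => inv_chord z * sin z.1)).
Proof.
have e0 n : 0 < n.+1%:R^-1 :> R by rewrite invr_gt0.
(* These functions increase to the integrand everywhere, including the pole, where all of them are
   0. They lie below the inverse of the regularised chord, so their integrals are uniformly
   bounded. *)
pose g n z := chord xi z / (chord xi z ^+ 2 + n.+1%:R^-1) * sin z.1.
have den0 n z : 0 < chord xi z ^+ 2 + n.+1%:R^-1 by rewrite ltr_wpDl ?sqr_ge0.
have ng n : cts_meas (g n).
  apply: cts_meas_mul cts_meas_sin1; apply: cts_meas_mul (cts_meas_chord xi) _; apply: cts_meas_inv => //.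
  by apply: cts_meas_add (cts_meas_cst _); apply: cts_meas_exp; exact: cts_meas_chord.
have g0 n z : box z -> 0 <= g n z.
  by move=> bz; rewrite mulr_ge0 ?box_sin_ge0 // divr_ge0 ?chord_ge0 // ltW.
have mg n : measurable_fun box (EFin \o g n).
  by apply/measurable_EFinP; apply: measurable_funTS; exact: (ng n).2.
have limg z : (EFin \o g^~ z) n @[n --> \oo] --> (inv_chord z * sin z.1)%:E.
  apply: cvg_EFin; first exact: nearW.
  apply: cvgMr_tmp; rewrite /inv_chord; have [->|s0] := eqVneq (chord xi z) 0.
    by rewrite invr0; under eq_fun do rewrite mul0r; exact: cvg_cst.
  have -> : (chord xi z)^-1 = chord xi z * (chord xi z ^+ 2 + 0)^-1.
    by rewrite addr0; field.
  apply: cvgMl_tmp; apply: cvgV; first by rewrite addr0 expf_neq0.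
  by apply: cvgD; [exact: cvg_cst|exact: cvg_harmonic].
have ndg z : box z -> nondecreasing_seq (fun n => (EFin \o g n) z).
  move=> bz n n' nn'; rewrite lee_fin ler_wpM2r ?box_sin_ge0 //.
  rewrite ler_wpM2l ?chord_ge0 // lef_pV2 ?posrE // lerD2l.
  by rewrite lef_pV2 ?posrE ?ltr0n // ler_nat.
have cvgI := @cvg_monotone_convergence _ _ _ leb2 box measurable_box (fun n => EFin \o g n) mg
  (fun n z bz => g0 n z bz : (0 <= (EFin \o g n) z)%E) ndg.
apply/integrableP; split.
  apply/measurable_EFinP; apply: measurable_funTS; apply: measurable_funM.
    exact: measurable_inv_chord.
  exact: cts_meas_sin1.2.
rewrite (@le_lt_trans _ _ (3 / 2 * \int[leb2]_(z in box) (sin z.1))%:E) ?ltry //.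
have -> : (\int[leb2]_(z in box) `|(EFin \o (fun z => inv_chord z * sin z.1)%R) z| =
    \int[leb2]_(z in box) limn (fun n => (EFin \o g n) z))%E.
  apply: eq_integral => z /set_mem bz; rewrite /= (cvg_lim _ (limg z)) // ger0_norm //.
  by rewrite mulr_ge0 ?box_sin_ge0 // invr_ge0 chord_ge0.
rewrite -(cvg_lim _ cvgI) //; apply: lime_le; first by apply/cvg_ex; eexists; exact: cvgI.
apply: nearW => n.
rewrite -[leLHS]fineK; last by apply: integrable_fin_num; [exact: measurable_box|exact: cts_meas_integrable].
rewrite lee_fin (le_trans _ (int_rchordV_le (e0 n))) //.
apply: cts_meas_le_int.
- apply: cts_meas_mul (cts_meas_chord xi) _; apply: cts_meas_inv => //.
  by apply: cts_meas_add (cts_meas_cst _); apply: cts_meas_exp; exact: cts_meas_chord.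
- exact: cts_meas_rchordV.
- move=> z bz; rewrite -(sqr_rchord xi_unit z (e0 n)).
  have w0 := rchord_gt0 xi_unit z (e0 n); have w2 := sqr_rchord xi_unit z (e0 n).
  rewrite ler_pdivrMr ?exprn_gt0 // expr2 mulKf ?gt_eqF //.
  rewrite -(@ler_pXn2r _ 2) ?nnegrE ?chord_ge0 ?(ltW w0) // w2 lerDl.
  by rewrite invr_ge0.
Qed.

(** The whole coordinate line theta = acos xi_2 is taken, because every azimuth represents xi when
    xi lies on the polar axis. *)
Lemma chord0_negligible : exists N : set (R * R),
  [/\ measurable N, leb2 N = 0%E & forall z, box z -> chord xi z = 0 -> N z].
Proof.
exists ([set acos (xi 2)] `*` setT); split.
- by apply: measurableX => //; exact: measurable_set1.
- rewrite product_measure1E; [|exact: measurable_set1|exact: measurableT].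
  by rewrite /= lebesgue_measure_set1 mul0e.
- move=> -[a b] [/= ha _] c0; split => //=.
  have := chord2E xi_unit (a, b); rewrite -(sqr_chord xi_unit) c0 expr0n /= => /esym h.
  have /(_ 2 isT)/eqP := psumr_eq0P (fun i _ => sqr_ge0 (xi i - e_rad (a, b) i)) h.
  rewrite sqrf_eq0 subr_eq0 => /eqP ->; rewrite /e_rad /= cosK //.
Qed.

(** Convergence and domination are required only away from the pole. With a constant sequence, the
    first conclusion serves as an integrability criterion. *)
Lemma sphere_dominated (u : nat -> R * R -> R) f C :
  (forall n, measurable_fun [set: R * R] (u n)) -> measurable_fun [set: R * R] f ->
  (forall z, box z -> 0 < chord xi z -> u ^~ z @ \oo --> f z) ->
  (forall n z, box z -> 0 < chord xi z -> `|u n z| <= C * inv_chord z) ->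
  leb2.-integrable box (EFin \o (fun z => f z * sin z.1)) /\
  (fun n => \int[leb2]_(z in box) (u n z * sin z.1)) @ \oo -->
    \int[leb2]_(z in box) (f z * sin z.1).
Proof.
move=> mu mf uf uC; have [N [mN N0 hN]] := chord0_negligible.
have pos z : box z -> ~ N z -> 0 < chord xi z.
  by move=> bz nNz; rewrite lt0r chord_ge0 andbT; apply/eqP => /(hN z bz).
have ms (h : R * R -> R) : measurable_fun [set: R * R] h ->
    measurable_fun box (EFin \o (fun z => h z * sin z.1)).
  move=> mh; apply/measurable_EFinP; apply: measurable_funTS; apply: measurable_funM => //.
  exact: cts_meas_sin1.2.
have iC : leb2.-integrable box (EFin \o (fun z => C * (inv_chord z * sin z.1))).
  rewrite (_ : _ \o _ = fun z => (C%:E * (EFin \o (fun z => (inv_chord z * sin z.1)%R)) z)%E) //.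
  by apply: integrableZl => //; [exact: measurable_box|exact: integrable_inv_chord].
have [] := @dominated_convergence _ _ _ leb2 box measurable_box
  (fun n => EFin \o (fun z => u n z * sin z.1)) (EFin \o (fun z => f z * sin z.1))
  (EFin \o (fun z => C * (inv_chord z * sin z.1))).
- by move=> n; exact: ms.
- exact: ms.
- exists N; split => // z /= h; apply: contrapT => nNz; apply: h => bz.
  apply: cvg_EFin; first exact: nearW.
  by apply: cvgMr_tmp; apply: uf => //; exact: pos.
- exact: iC.
- exists N; split => // z /= h; apply: contrapT => nNz; apply: h => n bz.
  rewrite lee_fin normrM (ger0_norm (box_sin_ge0 bz)) mulrA ler_wpM2r ?box_sin_ge0 //.
  by apply: uC => //; exact: pos.
move=> fi _ cvI; split => //.
have fin : (\int[leb2]_(z in box) (EFin \o (fun z => (f z * sin z.1)%R)) z)%E \is a fin_num.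
  by apply: integrable_fin_num => //; exact: measurable_box.
by apply: fine_cvg; rewrite fineK.
Qed.

End WeaklySingular.

(** * Integrals of powers of the chord against polynomials *)

Section ChordPowers.
Variable xi : 'I_3 -> R.
Hypothesis xi_unit : \sum_i xi i ^+ 2 = 1.

(** The case j = 1 serves the term with [dkern]: it contains 1/rchord^2, while 1 - dotp^2 = chord^2
    (1 - chord^2/4), so a quotient of squared chords appears. It is at most 1 and tends to 1 off the
    pole. *)
Lemma kern_limit (j p : nat) b : cts_meas b ->
  (fun n => \int[leb2]_(z in box) (kern xi p n.+1%:R^-1 z *
      (chord xi z ^+ 2 / rchord xi n.+1%:R^-1 z ^+ 2) ^+ j * b z * sin z.1)) @ \oo -->
  \int[leb2]_(z in box) (chord xi z ^+ p * inv_chord xi z * b z * sin z.1).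
Proof.
move=> nb; have [M M0 bM] := cts_meas_bounded nb.
have e0 n : 0 < n.+1%:R^-1 :> R by rewrite invr_gt0.
have e1 n : n.+1%:R^-1 <= 1 :> R by rewrite invf_le1 // ler1n.
have mc := (cts_meas_chord xi).2.
(* The regularised chord satisfies rchord^2 <= 4 + 1, hence rchord <= 3. *)
apply: (sphere_dominated xi_unit (C := 3 ^+ p * M) _ _ _ _).2.
- move=> n; apply: (cts_meas_mul _ nb).2; apply: cts_meas_mul; first exact: cts_meas_kern.
  apply: cts_meas_exp; apply: cts_meas_mul; first by apply: cts_meas_exp; exact: cts_meas_chord.
  under eq_fun do rewrite -exprVn.
  by apply: cts_meas_exp; exact: cts_meas_rchordV.
- apply: measurable_funM; last exact: nb.2.
  apply: measurable_funM; last exact: measurable_inv_chord.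
  exact: (cts_meas_exp _ (cts_meas_chord xi)).2.
- move=> z bz s0.
  have cw : rchord xi n.+1%:R^-1 z @[n --> \oo] --> chord xi z.
    rewrite /rchord /chord -[X in _ --> Num.sqrt X]addr0.
    apply: continuous_cvg; first exact: sqrt_continuous.
    by apply: cvgD; [exact: cvg_cst|exact: cvg_harmonic].
  have cV : (rchord xi n.+1%:R^-1 z)^-1 @[n --> \oo] --> (chord xi z)^-1.
    by apply: cvgV => //; rewrite gt_eqF.
  have cX k (v : nat -> R) (l : R) : v @ \oo --> l -> (v n ^+ k) @[n --> \oo] --> l ^+ k.
    by move=> vl; exact: (cvg_comp v (fun x => x ^+ k) vl (@exprn_continuous R k l)).
  apply: cvgMr_tmp; rewrite /kern /inv_chord.
  have E : (chord xi z ^+ 2 * (chord xi z)^-1 ^+ 2) ^+ j = 1.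
    by rewrite exprVn divff ?expr1n // expf_neq0 // gt_eqF.
  have L : (rchord xi n.+1%:R^-1 z ^+ p / rchord xi n.+1%:R^-1 z *
      (chord xi z ^+ 2 / rchord xi n.+1%:R^-1 z ^+ 2) ^+ j) @[n --> \oo] -->
      chord xi z ^+ p * (chord xi z)^-1 * (chord xi z ^+ 2 * (chord xi z)^-1 ^+ 2) ^+ j.
    apply: cvgM.
      by apply: cvgM => //; exact: (cX p (fun n => rchord xi n.+1%:R^-1 z)).
    apply: (cX j (fun n => chord xi z ^+ 2 / rchord xi n.+1%:R^-1 z ^+ 2)).
    apply: cvgMl_tmp; under eq_fun do rewrite -exprVn.
    exact: (cX 2 (fun n => (rchord xi n.+1%:R^-1 z)^-1)).
  by rewrite E mulr1 in L.
- move=> n z bz s0.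
  have w0 := rchord_gt0 xi_unit z (e0 n); have w2 := sqr_rchord xi_unit z (e0 n).
  have s2 := chord_le2 xi_unit z.
  rewrite /kern /inv_chord; move: (e0 n) (e1 n) w0 w2.
  set w := rchord _ _ _; set e := _^-1; set s := chord xi z in s0 s2 * => e'0 e'1 w0 w2.
  have sw : s <= w by rewrite -(@ler_pXn2r _ 2) ?nnegrE ?(ltW w0) ?(ltW s0) // w2 lerDl ltW.
  have w3 : w <= 3 by rewrite -(@ler_pXn2r _ 2) ?nnegrE ?(ltW w0) // w2; nra.
  have h1 : w ^+ p <= 3 ^+ p by rewrite lerXn2r ?nnegrE ?(ltW w0).
  have h2 : w^-1 <= s^-1 by rewrite lef_pV2.
  have h3 : (s ^+ 2 / w ^+ 2) ^+ j <= 1.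
    rewrite exprn_ile1 ?divr_ge0 ?exprn_ge0 ?(ltW s0) ?(ltW w0) // ler_pdivrMr ?exprn_gt0 // mul1r.
    by rewrite lerXn2r ?nnegrE ?(ltW s0) ?(ltW w0).
  have j0 : 0 <= (s ^+ 2 / w ^+ 2) ^+ j by rewrite exprn_ge0 // divr_ge0 // exprn_ge0 // ltW.
  have k0 : 0 <= w ^+ p / w by rewrite divr_ge0 ?exprn_ge0 // ltW.
  rewrite normrM (ger0_norm (mulr_ge0 k0 j0)) [leRHS]mulrAC.
  apply: ler_pM; [exact: mulr_ge0|exact: normr_ge0| |exact: bM].
  rewrite -[3 ^+ p / s]mulr1; apply: ler_pM => //.
  by apply: ler_pM => //; [rewrite exprn_ge0 // ltW|rewrite invr_ge0 ltW].
Qed.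

(** The exponent p - 1 is split into p and [inv_chord] to include -1. For p = 1 the kernel is
    therefore 0, not 1, at the pole. *)
Definition chord_int p q : R :=
  \int[leb2]_(z in box) (chord xi z ^+ p * inv_chord xi z * peval q z * sin z.1).

Lemma cts_meas_peval (q : mpoly.mpoly 3 R) : cts_meas (peval q).
Proof. by have [] := C1_peval q. Qed.

Lemma integrable_chord_mul p b : cts_meas b -> leb2.-integrable box
  (EFin \o (fun z => chord xi z ^+ p * inv_chord xi z * b z * sin z.1)).
Proof.
move=> nb; have [M M0 bM] := cts_meas_bounded nb.
have mf : measurable_fun [set: R * R] (fun z => chord xi z ^+ p * inv_chord xi z * b z).
  apply: measurable_funM; last exact: nb.2.
  apply: measurable_funM; last exact: measurable_inv_chord.
  exact: (cts_meas_exp _ (cts_meas_chord xi)).2.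
apply: (sphere_dominated xi_unit (C := 2 ^+ p * M) (fun n => mf) mf _ _).1.
- by move=> z _ _; exact: cvg_cst.
- move=> n z bz s0; rewrite !normrM normfV normrX (gtr0_norm s0) mulrAC.
  rewrite /inv_chord ler_wpM2r ?invr_ge0 ?(ltW s0) //.
  by rewrite ler_pM ?bM ?exprn_ge0 ?(ltW s0) // lerXn2r ?nnegrE ?(ltW s0) // chord_le2.
Qed.

Lemma chord_int_linear p q1 q2 q3 (a1 a2 a3 : R) :
  \int[leb2]_(z in box) (chord xi z ^+ p * inv_chord xi z *
    (a1 * peval q1 z + a2 * (chord xi z ^+ 2 * peval q2 z) + a3 * peval q3 z) * sin z.1) =
  a1 * chord_int p q1 + a2 * chord_int p.+2 q2 + a3 * chord_int p q3.
Proof.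
rewrite /chord_int.
have i1 := integrable_chord_mul p (cts_meas_peval q1).
have i2 := integrable_chord_mul p.+2 (cts_meas_peval q2).
have i3 := integrable_chord_mul p (cts_meas_peval q3).
have zi (a : R) f : leb2.-integrable box (EFin \o f) ->
    leb2.-integrable box (EFin \o (fun z => a * f z)).
  move=> fi; rewrite (_ : _ \o _ = fun z => (a%:E * (EFin \o f) z)%E) //.
  by apply: integrableZl => //; exact: measurable_box.
have di f h : leb2.-integrable box (EFin \o f) -> leb2.-integrable box (EFin \o h) ->
    leb2.-integrable box (EFin \o (fun z => f z + h z)).
  move=> fi hi; rewrite (_ : _ \o _ = ((EFin \o f) \+ (EFin \o h))%E) //.
  by apply: integrableD => //; exact: measurable_box.
rewrite -!RintegralZl; try exact: measurable_box; try by [].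
rewrite -!RintegralD; try exact: measurable_box; try by auto.
congr Rintegral; apply/funext => z.
by rewrite !exprS; ring.
Qed.

(** The limit of [kern_identity1]: [b1] collects the term with [dkern], which carries the quotient
    of squared chords, and [b2] the other two. *)
Lemma chord_int_identity1 m q p : homogeneous m q ->
  ((p%:R - 1) / 4 + m.+2%:R / 2) * chord_int p.+2 q
    - (p%:R + m.+1%:R) * chord_int p q + chord_int p (mderiv_along xi q) = 0.
Proof.
move=> hq.
have nq := cts_meas_peval q; have nd := cts_meas_peval (mderiv_along xi q).
have ns := cts_meas_chord xi; have nt := cts_meas_dotp xi.
pose b1 z := - (p%:R - 1) * (1 - chord xi z ^+ 2 / 4) * peval q z.
pose b2 z := peval (mderiv_along xi q) z - m.+2%:R * (1 - chord xi z ^+ 2 / 2) * peval q z.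
have nb1 : cts_meas b1.
  apply: cts_meas_mul nq; apply: cts_meas_mul (cts_meas_cst _) _; apply: cts_meas_sub (cts_meas_cst _) _.
  by apply: cts_meas_mul (cts_meas_exp _ ns) (cts_meas_cst _).
have nb2 : cts_meas b2.
  apply: cts_meas_sub nd _; apply: cts_meas_mul nq; apply: cts_meas_mul (cts_meas_cst _) _.
  apply: cts_meas_sub (cts_meas_cst _) _.
  by apply: cts_meas_mul (cts_meas_exp _ ns) (cts_meas_cst _).
have e0 n : 0 < n.+1%:R^-1 :> R by rewrite invr_gt0.
pose u j b n z := kern xi p n.+1%:R^-1 z *
  (chord xi z ^+ 2 / rchord xi n.+1%:R^-1 z ^+ 2) ^+ j * b z * sin z.1.
have nu j b n : cts_meas b -> cts_meas (u j b n).
  move=> nb; apply: cts_meas_mul cts_meas_sin1; apply: cts_meas_mul nb; apply: cts_meas_mul.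
    exact: cts_meas_kern.
  apply: cts_meas_exp; apply: cts_meas_mul; first exact: cts_meas_exp.
  under eq_fun do rewrite -exprVn.
  by apply: cts_meas_exp; exact: cts_meas_rchordV.
have L : (fun n => \int[leb2]_(z in box) u 1%N b1 n z + \int[leb2]_(z in box) u 0%N b2 n z) @ \oo -->
    \int[leb2]_(z in box) (chord xi z ^+ p * inv_chord xi z * b1 z * sin z.1) +
    \int[leb2]_(z in box) (chord xi z ^+ p * inv_chord xi z * b2 z * sin z.1).
  by apply: cvgD; [exact: (kern_limit 1)|exact: (kern_limit 0)].
have L0 n : \int[leb2]_(z in box) u 1%N b1 n z + \int[leb2]_(z in box) u 0%N b2 n z = 0.
  rewrite -RintegralD; [|exact: measurable_box|exact: cts_meas_integrable (nu _ _ _ nb1)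
    |exact: cts_meas_integrable (nu _ _ _ nb2)].
  rewrite -[RHS](kern_identity1 xi_unit p hq (e0 n)); congr Rintegral; apply/funext => z.
  rewrite /u -mulrDl; congr (_ * _); rewrite /b1 /b2 (dotpE xi_unit) /kern /dkern expr1 expr0.
  have w0 := rchord_gt0 xi_unit z (e0 n).
  by field; rewrite gt_eqF.
have {L} : \int[leb2]_(z in box) (chord xi z ^+ p * inv_chord xi z * b1 z * sin z.1) +
    \int[leb2]_(z in box) (chord xi z ^+ p * inv_chord xi z * b2 z * sin z.1) = 0.
  rewrite -(cvg_lim (@norm_hausdorff _ R) L); apply: lim_near_cst; first exact: norm_hausdorff.
  exact: nearW.
have -> : \int[leb2]_(z in box) (chord xi z ^+ p * inv_chord xi z * b1 z * sin z.1) =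
    - (p%:R - 1) * chord_int p q + (p%:R - 1) / 4 * chord_int p.+2 q + 0 * chord_int p q.
  by rewrite -chord_int_linear; congr Rintegral; apply/funext => z; rewrite /b1; ring.
have -> : \int[leb2]_(z in box) (chord xi z ^+ p * inv_chord xi z * b2 z * sin z.1) =
    - m.+2%:R * chord_int p q + m.+2%:R / 2 * chord_int p.+2 q + 1 * chord_int p (mderiv_along xi q).
  by rewrite -chord_int_linear; congr Rintegral; apply/funext => z; rewrite /b2; ring.
move=> <-; rewrite -[m.+2%:R]natr1 -[m.+1%:R]natr1; ring.
Qed.

(** The limit of [kern_identity2] at exponent p + 2, chosen because the derivative of that kernel is
    -(p+1) times the kernel of index p: nothing more singular than the inverse chord occurs. *)
Lemma chord_int_identity2 m q p : homogeneous m q -> harmonic_poly q ->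
  - p.+1%:R * chord_int p (mderiv_along xi q) + m%:R * p.+1%:R * chord_int p q
    - m%:R * (p.+1%:R / 2 + m.+1%:R) * chord_int p.+2 q = 0.
Proof.
move=> hq hh.
have nq := cts_meas_peval q; have nd := cts_meas_peval (mderiv_along xi q).
have ns := cts_meas_chord xi; have nt := cts_meas_dotp xi.
pose b1 z := - p.+1%:R * peval (mderiv_along xi q) z
   + m%:R * p.+1%:R * (1 - chord xi z ^+ 2 / 2) * peval q z.
pose b2 z := - (m%:R * m.+1%:R) * peval q z.
have nb1 : cts_meas b1.
  apply: cts_meas_add; first exact: cts_meas_mul (cts_meas_cst _) nd.
  apply: cts_meas_mul nq; apply: cts_meas_mul (cts_meas_cst _) _; apply: cts_meas_sub (cts_meas_cst _) _.
  by apply: cts_meas_mul (cts_meas_exp _ ns) (cts_meas_cst _).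
have nb2 : cts_meas b2 by exact: cts_meas_mul (cts_meas_cst _) nq.
have e0 n : 0 < n.+1%:R^-1 :> R by rewrite invr_gt0.
pose u r b n z := kern xi r n.+1%:R^-1 z *
  (chord xi z ^+ 2 / rchord xi n.+1%:R^-1 z ^+ 2) ^+ 0 * b z * sin z.1.
have nu r b n : cts_meas b -> cts_meas (u r b n).
  move=> nb; apply: cts_meas_mul cts_meas_sin1; apply: cts_meas_mul nb.
  under eq_fun do rewrite expr0 mulr1.
  exact: cts_meas_kern.
have L : (fun n => \int[leb2]_(z in box) u p b1 n z + \int[leb2]_(z in box) u p.+2 b2 n z) @ \oo -->
    \int[leb2]_(z in box) (chord xi z ^+ p * inv_chord xi z * b1 z * sin z.1) +
    \int[leb2]_(z in box) (chord xi z ^+ p.+2 * inv_chord xi z * b2 z * sin z.1).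
  by apply: cvgD; exact: (kern_limit 0).
have L0 n : \int[leb2]_(z in box) u p b1 n z + \int[leb2]_(z in box) u p.+2 b2 n z = 0.
  rewrite -RintegralD; [|exact: measurable_box|exact: cts_meas_integrable (nu _ _ _ nb1)
    |exact: cts_meas_integrable (nu _ _ _ nb2)].
  rewrite -[RHS](kern_identity2 xi_unit p.+2 hq hh (e0 n)); congr Rintegral; apply/funext => z.
  rewrite /u -mulrDl; congr (_ * _); rewrite /b1 /b2 (dotpE xi_unit) /kern /dkern expr0.
  have w0 := rchord_gt0 xi_unit z (e0 n).
  by rewrite !(exprS (rchord _ _ _)); field; rewrite gt_eqF.
have {L} : \int[leb2]_(z in box) (chord xi z ^+ p * inv_chord xi z * b1 z * sin z.1) +
    \int[leb2]_(z in box) (chord xi z ^+ p.+2 * inv_chord xi z * b2 z * sin z.1) = 0.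
  rewrite -(cvg_lim (@norm_hausdorff _ R) L); apply: lim_near_cst; first exact: norm_hausdorff.
  exact: nearW.
have -> : \int[leb2]_(z in box) (chord xi z ^+ p * inv_chord xi z * b1 z * sin z.1) =
    m%:R * p.+1%:R * chord_int p q + - (m%:R * p.+1%:R) / 2 * chord_int p.+2 q +
    - p.+1%:R * chord_int p (mderiv_along xi q).
  by rewrite -chord_int_linear; congr Rintegral; apply/funext => z; rewrite /b1; ring.
have -> : \int[leb2]_(z in box) (chord xi z ^+ p.+2 * inv_chord xi z * b2 z * sin z.1) =
    - (m%:R * m.+1%:R) * chord_int p.+2 q + 0 * chord_int p.+4 q + 0 * chord_int p.+2 q.
  by rewrite -chord_int_linear; congr Rintegral; apply/funext => z; rewrite /b2; ring.
by move=> <-; field.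
Qed.

(* Eliminating [chord_int p.+2 q] between the two identities lowers the degree by one. *)
Lemma chord_int_mderiv m q p : homogeneous m q -> harmonic_poly q ->
  (2 * m%:R - p.+1%:R) * chord_int p (mderiv_along xi q) =
  m%:R * (2 * m%:R + p.+1%:R) * chord_int p q.
Proof.
move=> hq hh; have := chord_int_identity1 p hq; have := chord_int_identity2 p hq hh.
rewrite -[m.+2%:R]natr1 -[m.+1%:R]natr1 -[p.+1%:R]natr1 => h2 h1.
apply/eqP; rewrite -subr_eq0; apply/eqP.
set N := chord_int p q in h1 h2 *; set N2 := chord_int p.+2 q in h1 h2 *.
set D := chord_int p (mderiv_along xi q) in h1 h2 *.
(* Adding 2m times the first identity to the second cancels [N2]. *)
transitivity (2 * m%:R * 0 + (0 : R)); last by ring.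
by rewrite -{1}h1 -h2; field.
Qed.

End ChordPowers.

(** * Eigenvalues of the chord powers and of series in the chord *)

Section Eigenvalues.
Variable xi : 'I_3 -> R.
Hypothesis xi_unit : \sum_i xi i ^+ 2 = 1.

Lemma int_box_sin : \int[leb2]_(z in box) sin z.1 = 4 * pi.
Proof.
rewrite /Rintegral integral_mkcond -integral21_prod_meas1; last first.
  exact/(@integrable_mkcond _ _ _ leb2 box (EFin \o (fun z => sin z.1)) measurable_box)/cts_meas_integrable/cts_meas_sin1.
have I1 : (\int[lebesgue_measure]_(x in polar_range) (sin x)%:E = (2 : R)%:E)%E.
  rewrite (continuous_FTC2 (F := fun x => - cos x)).
  - by rewrite cospi cos0 opprK -EFinB opprK.
  - exact: pi_gt0.
  - by apply: continuous_subspaceT; exact: continuous_sin.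
  - split.
    + by move=> x _; exact: ex_derive.
    + by apply: cvgN; apply: cvg_at_right_filter; exact: continuous_cos.
    + by apply: cvgN; apply: cvg_at_left_filter; exact: continuous_cos.
  - by move=> x _; rewrite derive1E derive_val opprK.
transitivity (fine (\int[lebesgue_measure]_(y in (azimuth_range : set R)) (2 : R)%:E)%E).
  congr fine; rewrite [RHS]integral_mkcond; apply: eq_integral => y _.
  rewrite /fubini_G patchE; case: ifPn => yA.
    rewrite -I1 [RHS]integral_mkcond; apply: eq_integral => x _.
    by rewrite !patchE /box in_setX yA andbT.
  by apply: integral0_eq => x _; rewrite patchE /box in_setX (negbTE yA) andbF.
rewrite integral_cst //=; last exact: measurable_itv.
rewrite lebesgue_measure_itv /= lte_fin mulr_gt0 ?pi_gt0 // sube0 /=.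
by ring.
Qed.

Lemma peval1 z : peval (1 : mpoly.mpoly 3 R) z = 1.
Proof. by rewrite /peval mpoly.meval1. Qed.

(** The value is read off as a limit of regularised kernels, which for p = 1 equal 1 everywhere, the
    pole included. *)
Lemma chord_int11 : chord_int xi 1 1 = 4 * pi.
Proof.
have L := kern_limit xi_unit 0 (p := 1) (cts_meas_peval 1).
rewrite -int_box_sin /chord_int -(cvg_lim (@norm_hausdorff _ R) L); apply: lim_near_cst; first exact: norm_hausdorff.
apply: nearW => n; congr Rintegral; apply/funext => z.
have w0 := rchord_gt0 xi_unit z (_ : 0 < n.+1%:R^-1).
by rewrite /kern expr0 expr1 peval1 divff ?gt_eqF ?w0 ?invr_gt0 // !mul1r.
Qed.

Lemma chord_int1_rec p :
  (p%:R + 3) * chord_int xi p.+2 1 = 4 * (p%:R + 1) * chord_int xi p 1.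
Proof.
have := chord_int_identity1 xi_unit p homogeneous1.
have -> : chord_int xi p (mderiv_along xi 1) = 0.
  rewrite /chord_int /Rintegral integral0_eq // => z _.
  rewrite /peval meval_mderiv_along big1 ?mulr0 ?mul0r // => i _.
  by rewrite mderiv1 mpoly.meval0 mulr0.
move=> h; apply/eqP; rewrite -subr_eq0; apply/eqP.
by rewrite -[RHS](mulr0 4) -h; field.
Qed.

Lemma chord_int1_le p : chord_int xi p.+1 1 <= 2 * chord_int xi p 1.
Proof.
have ib r := integrable_chord_mul xi_unit r (cts_meas_peval 1).
rewrite /chord_int -RintegralZl; [|exact: measurable_box|exact: ib].
apply: le_Rintegral; [exact: measurable_box|exact: ib| |].
- rewrite (_ : _ \o _ = fun z => (2%:E * (EFin \o (fun z => (chord xi z ^+ p * inv_chord xi z * peval 1 z * sin z.1)%R)) z)%E) //.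
  by apply: integrableZl => //; exact: measurable_box.
- move=> z bz; rewrite !mulrA ler_wpM2r ?box_sin_ge0 // peval1 !mulr1.
  rewrite ler_wpM2r ?invr_ge0 ?chord_ge0 // exprS ler_wpM2r ?exprn_ge0 ?chord_ge0 //.
  exact: chord_le2.
Qed.

Lemma chord_int_odd l : (2 * l%:R + 2) * chord_int xi (2 * l).+1 1 = 4 * pi * 2 ^+ (2 * l).+1.
Proof.
elim: l => [|l IHl]; first by rewrite muln0 chord_int11 expr1; ring.
have l0 := ler0n R l.
have r := chord_int1_rec (2 * l).+1; rewrite mulnS !add2n.
have -> : 2 ^+ (2 * l).+3 = 4 * 2 ^+ (2 * l).+1 :> R by rewrite !exprS; ring.
have l1 : 2 * l%:R + 2 != 0 :> R by rewrite gt_eqF //; lra.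
apply: (mulfI l1); transitivity (4 * (2 * l%:R + 2) * (4 * pi * 2 ^+ (2 * l).+1) : R); last by ring.
rewrite -IHl; transitivity ((2 * l%:R + 2) * (((2 * l).+1%:R + 3) * chord_int xi (2 * l).+3 1)); first by ring.
by rewrite r; ring.
Qed.

Lemma chord_int_even l : (2 * l%:R + 1) * chord_int xi (2 * l) 1 =
  chord_int xi 0 1 * 2 ^+ (2 * l).
Proof.
elim: l => [|l IHl]; first by rewrite muln0 expr0; ring.
have l0 := ler0n R l.
have r := chord_int1_rec (2 * l); rewrite mulnS !add2n.
have -> : 2 ^+ (2 * l).+2 = 4 * 2 ^+ (2 * l) :> R by rewrite !exprS; ring.
have l1 : 2 * l%:R + 1 != 0 :> R by rewrite gt_eqF //; lra.
apply: (mulfI l1).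
transitivity (4 * (2 * l%:R + 1) * (chord_int xi 0 1 * 2 ^+ (2 * l))); last by ring.
rewrite -IHl; transitivity ((2 * l%:R + 1) * (((2 * l)%:R + 3) * chord_int xi (2 * l).+2 1)); first by ring.
by rewrite r; ring.
Qed.

Lemma le0_harmonic (x c : R) : (forall n, x <= c * n.+1%:R^-1) -> x <= 0.
Proof.
move=> h; have cv : (fun n => c * n.+1%:R^-1) @ \oo --> c * 0 by apply: cvgMl_tmp; exact: cvg_harmonic.
rewrite -(mulr0 c) -(cvg_lim (@norm_hausdorff _ R) cv); apply: limr_ge.
  by apply/cvg_ex; eexists; exact: cv.
exact: nearW.
Qed.

(* The values of [chord_int p 1 / 2 ^ p] decrease with [p], which interpolates
   the even moments between the odd ones. *)
Lemma chord_int01 : chord_int xi 0 1 = 4 * pi.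
Proof.
set K := chord_int xi 0 1.
have pi0 := pi_gt0 R.
(* Comparing the indices 2l + 1 and 2l gives K >= 4 pi (2l+1)/(2l+2). Comparing 2l + 2 and 2l + 1
   gives K <= 4 pi (2l+3)/(2l+2), used for the second bound. *)
have bound1 l : 4 * pi - K <= 4 * pi * l.+1%:R^-1.
  have l0 := ler0n R l.
  have := chord_int1_le (2 * l); have := chord_int_even l; have := chord_int_odd l.
  set a := chord_int _ _ _; set b := chord_int _ _ _; rewrite -/K exprS.
  have : 0 < 2 ^+ (2 * l) :> R by rewrite exprn_gt0.
  move: (2 ^+ (2 * l)) => P P0 ha hb ab.
  rewrite -natr1 ler_pdivlMr; last by lra.
  have : (2 * l%:R + 1) * ((2 * l%:R + 2) * a) <= (2 * l%:R + 1) * (2 * l%:R + 2) * (2 * b).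
    by rewrite mulrA ler_wpM2l // mulr_ge0 //; lra.
  rewrite ha (_ : _ * (2 * b) = 2 * (2 * l%:R + 2) * ((2 * l%:R + 1) * b)); last by ring.
  rewrite hb => h.
  have : P * ((2 * l%:R + 1) * (8 * pi)) <= P * (2 * (2 * l%:R + 2) * K) by lra.
  by rewrite ler_pM2l // => ?; nra.
have bound2 l : K - 4 * pi <= 4 * pi * l.+1%:R^-1.
  have l0 := ler0n R l.
  have := chord_int1_le (2 * l).+1; have := chord_int_even l.+1; have := chord_int_odd l.
  rewrite mulnS add2n.
  set a := chord_int _ _ _; set b := chord_int _ _ _; rewrite -/K.
  have -> : 2 ^+ (2 * l).+2 = 2 * 2 ^+ (2 * l).+1 :> R by rewrite exprS.
  have : 0 < 2 ^+ (2 * l).+1 :> R by rewrite exprn_gt0.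
  move: (2 ^+ (2 * l).+1) => P P0 ha hb ab.
  rewrite -natr1 ler_pdivlMr; last by lra.
  rewrite -[l.+1%:R]natr1 in hb.
  have : (2 * l%:R + 2) * ((2 * (l%:R + 1) + 1) * b) <= (2 * l%:R + 2) * (2 * (l%:R + 1) + 1) * (2 * a).
    by rewrite mulrA ler_wpM2l // mulr_ge0 //; lra.
  rewrite hb (_ : _ * (2 * a) = 2 * (2 * (l%:R + 1) + 1) * ((2 * l%:R + 2) * a)); last by ring.
  rewrite ha => h.
  have : P * ((2 * l%:R + 2) * (2 * K)) <= P * (2 * (2 * l%:R + 3) * (4 * pi)) by lra.
  by rewrite ler_pM2l // => ?; nra.
have h1 := le0_harmonic bound1; have h2 := le0_harmonic bound2.
by apply/eqP; rewrite eq_le; apply/andP; split; lra.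
Qed.

Lemma chord_int1 p : chord_int xi p 1 = alpha p 0.
Proof.
have p0 := ler0n R p./2.
rewrite /alpha big_ord0 mulr1 -[p]odd_double_half -muln2 mulnC; case: (odd p) => /=.
  rewrite add1n; apply: (canRL (mulfK _)); first by rewrite pnatr_eq0.
  by rewrite -chord_int_odd; ring.
rewrite add0n; apply: (canRL (mulfK _)); first by rewrite pnatr_eq0.
by rewrite -chord_int01 -chord_int_even; ring.
Qed.

Lemma homogeneous0_const (q : mpoly.mpoly 3 R) : homogeneous 0 q -> exists c, q = mpoly.mpolyC 3 c.
Proof.
move=> hq; exists (mpoly.mcoeff mpoly.mnm0 q); apply/mpoly.mpolyP => M.
rewrite mpoly.mcoeffC; have [->|M0] := eqVneq M mpoly.mnm0; first by rewrite mulr1.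
rewrite mulr0; apply: (mpoly.dhomog_nemf_coeff hq).
by rewrite /= mpoly.mdeg_eq0.
Qed.

Theorem chord_int_eigen m q p : homogeneous m q -> harmonic_poly q ->
  chord_int xi p q = alpha p m * mpoly.meval xi q.
Proof.
elim: m q => [|m IHm] q hq hh.
  have [c ->] := homogeneous0_const hq.
  rewrite mpoly.mevalC -chord_int1 mulrC /chord_int.
  rewrite -RintegralZl; [|exact: measurable_box|exact: integrable_chord_mul (cts_meas_peval 1)].
  by congr Rintegral; apply/funext => z; rewrite peval1 /peval mpoly.mevalC; ring.
have := chord_int_mderiv xi_unit p hq hh.
rewrite (IHm _ (homogeneous_mderiv_along xi hq) (harmonic_mderiv_along xi hh)).
rewrite meval_mderiv_along (euler_homogeneous xi hq) alphaS.
have m0 := ler0n R m; have p0 := ler0n R p.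
set N := chord_int xi p q; set a := alpha p m; set v := mpoly.meval xi q => h.
have k1 : m%:R + 1 != 0 :> R by rewrite gt_eqF //; lra.
have k2 : 2 * m%:R + 3 + p%:R != 0 :> R by rewrite gt_eqF //; lra.
(* The division is by the positive coefficient of the unknown integral. The coefficient 2m + 1 - p
   on the other side may vanish, and then the new eigenvalue vanishes with it. *)
apply: (mulfI (mulf_neq0 k1 k2)).
transitivity (m.+1%:R * (2 * m.+1%:R + p.+1%:R) * N); first by ring.
by rewrite -h; field; rewrite addrC.
Qed.

(** The kernel is H(chord)/chord, integrated term by term. Absolute convergence at 2, the largest
    value of the chord, bounds all partial sums uniformly, which supplies the multiple of the
    inverse chord needed for domination. *)
Theorem funk_hecke_series m q (h : nat -> R) (e : nat -> nat) (H : R -> R) (A : R) :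
  homogeneous m q -> harmonic_poly q ->
  cvgn [normed series (fun l => h l * 2 ^+ e l)] ->
  (forall s, 0 <= s <= 2 -> series (fun l => h l * s ^+ e l) @ \oo --> H s) ->
  measurable_fun [set: R * R] (fun z => H (chord xi z)) ->
  series (fun l => h l * alpha (e l) m) @ \oo --> A ->
  leb2.-integrable box
    (EFin \o (fun z => H (chord xi z) * inv_chord xi z * peval q z * sin z.1)) /\
  \int[leb2]_(z in box) (H (chord xi z) * inv_chord xi z * peval q z * sin z.1) =
    A * mpoly.meval xi q.
Proof.
move=> hq hh ch cH mH cA; have [M M0 qM] := cts_meas_bounded (cts_meas_peval q).
have nq := cts_meas_peval q; have s0 := chord_ge0 xi; have s2 := chord_le2 xi_unit.
pose u n z := series (fun l => h l * chord xi z ^+ e l) n * inv_chord xi z * peval q z.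
pose S := limn [normed series (fun l => h l * 2 ^+ e l)].
have part n z : `|series (fun l => h l * chord xi z ^+ e l) n| <= S.
  apply: (@le_trans _ _ ([normed series (fun l => h l * 2 ^+ e l)] n)).
    rewrite (le_trans (ler_norm_sum _ _ _)) // ler_sum // => l _ /=.
    rewrite !normrM ler_wpM2l // !ger0_norm ?exprn_ge0 //.
    by rewrite lerXn2r ?nnegrE.
  apply: nondecreasing_cvgn_le => //.
  by apply: nondecreasing_series => l _ _; exact: normr_ge0.
have S0 : 0 <= S by rewrite (le_trans _ (part 0%N (0, 0))).
have [||||] // := sphere_dominated xi_unit (u := u)
    (f := fun z => H (chord xi z) * inv_chord xi z * peval q z) (C := S * M).
- move=> n; apply: measurable_funM; last exact: nq.2.
  apply: measurable_funM; last exact: measurable_inv_chord.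
  have : cts_meas (fun z => \sum_(0 <= l < n) h l * chord xi z ^+ e l).
    apply: cts_meas_sum => l; apply: cts_meas_mul (cts_meas_cst _) _.
    exact: cts_meas_exp _ (cts_meas_chord xi).
  by case.
- apply: measurable_funM; last exact: nq.2.
  by apply: measurable_funM => //; exact: measurable_inv_chord.
- move=> z bz _; apply: cvgMr_tmp; apply: cvgMr_tmp; apply: cH.
  by rewrite s0 s2.
- move=> n z bz spos; rewrite !normrM mulrAC.
  rewrite [`|inv_chord xi z|]ger0_norm ?invr_ge0 // ler_wpM2r ?invr_ge0 //.
  by rewrite ler_pM ?part ?qM.
move=> iH cI; split => //.
rewrite -(cvg_lim (@norm_hausdorff _ R) cI); apply/cvg_lim; first exact: norm_hausdorff.
have -> : (fun n => \int[leb2]_(z in box) (u n z * sin z.1)) =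
    (fun n => series (fun l => h l * alpha (e l) m) n * mpoly.meval xi q).
  apply/funext; elim=> [|n IHn].
    rewrite /series/= big_nil mul0r /Rintegral integral0_eq // => z _.
    by rewrite /u /series/= big_nil !mul0r.
  rewrite seriesSr mulrDl -IHn -mulrA -(chord_int_eigen _ hq hh) /chord_int.
  have nS : cts_meas (fun z => series (fun l => h l * chord xi z ^+ e l) n * peval q z).
    apply: cts_meas_mul nq; apply: cts_meas_sum => l; apply: cts_meas_mul (cts_meas_cst _) _.
    exact: cts_meas_exp _ (cts_meas_chord xi).
  have iu : leb2.-integrable box (EFin \o (fun z => u n z * sin z.1)).
    have := integrable_chord_mul xi_unit 0 nS; congr (_.-integrable _ (EFin \o _)).
    by apply/funext => z; rewrite /u; ring.
  have ic := integrable_chord_mul xi_unit (e n) nq.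
  rewrite -RintegralZl; [|exact: measurable_box|exact: ic].
  rewrite -RintegralD; [|exact: measurable_box|exact: iu|].
    by congr Rintegral; apply/funext => z; rewrite /u seriesSr; ring.
  rewrite (_ : _ \o _ = fun z => ((h n)%:E * (EFin \o (fun z =>
    (chord xi z ^+ e n * inv_chord xi z * peval q z * sin z.1)%R)) z)%E) //.
  by apply: integrableZl => //; exact: measurable_box.
by apply: cvgMr_tmp.
Qed.

End Eigenvalues.

End SphereIntegral.

(** * Trigonometric kernels *)

Section ZonalKernels.
Set Implicit Arguments.
Unset Strict Implicit.
Context {R : realType}.
Implicit Types (z : R * R) (f h : R * R -> R).

Local Notation leb2 := (@lebesgue_measure R \x @lebesgue_measure R)%E.

(** * Eigenvalues of the cosine and sine kernels and of their radial derivatives *)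

Section TrigKernels.
Variables (xi : 'I_3 -> R) (k : R).
Hypothesis xi_unit : \sum_i xi i ^+ 2 = 1.
Hypothesis k_gt0 : 0 < k.

Lemma cvg_series_ext (u v : nat -> R) (l : R) : (forall n, u n = v n) ->
  series u @ \oo --> l -> series v @ \oo --> l.
Proof. by move=> /funext ->. Qed.

Lemma trig_summable (a : nat -> R) (d : nat) : (forall l, `|a l| <= (2 * l + 1)%:R) ->
  cvgn [normed series (fun l => a l * (-1) ^+ l * k ^+ (d + 2 * l) / (d + 2 * l)`!%:R * 2 ^+ (d + 2 * l))].
Proof.
move=> ha; have k0 := ltW k_gt0.
(* The weight is at most 2^(2l+1) and the factorial at least l!. Of 16^l, one factor 4^l comes from
   the weight and the other from the power of 2. *)
apply: (@series_le_cvg _ _ (fun l => (2 * (2 * k) ^+ d) * ((16 * k ^+ 2) ^+ l / l`!%:R))).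
- by move=> l; exact: normr_ge0.
- by move=> l; rewrite !(mulr_ge0, invr_ge0, exprn_ge0).
- move=> l /=; rewrite !normrM normrX normrN1 expr1n mulr1 normfV !normrX !normr_nat (gtr0_norm k_gt0).
  have -> : 2 * (2 * k) ^+ d * ((16 * k ^+ 2) ^+ l / l`!%:R) =
      2 ^+ (2 * l + 1) * k ^+ (d + 2 * l) / l`!%:R * 2 ^+ (d + 2 * l).
    have -> : (16 * k ^+ 2) ^+ l = 2 ^+ (2 * l) * 2 ^+ (2 * l) * k ^+ (2 * l) :> R.
      by rewrite !(exprM _ 2) -!exprMn; congr (_ ^+ l); ring.
    by rewrite !exprD expr1 exprMn; ring.
  rewrite ler_wpM2r ?exprn_ge0 //; apply: ler_pM; rewrite ?invr_ge0 //.
  + by rewrite mulr_ge0 ?exprn_ge0.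
  + rewrite ler_wpM2r ?exprn_ge0 // (le_trans (ha l)) // -natrX ler_nat ltnW //.
    exact: ltn_expl.
  + rewrite lef_pV2 ?posrE ?ltr0n ?fact_gt0 // ler_nat leq_fact //.
    by rewrite mul2n -addnn addnA leq_addl.
- by apply: is_cvg_seriesZ; exact: is_cvg_series_exp_coeff.
Qed.

(** Weighting a term by its exponent is the action of x d/dx. *)
Lemma cvg_cos_natM (x : R) :
  series (fun l => (2 * l)%:R * ((-1) ^+ l * x ^+ (2 * l) / (2 * l)`!%:R)) @ \oo --> - (x * sin x).
Proof.
rewrite -cvg_shiftS.
rewrite [X in X @ \oo --> _](_ : _ = fun n => - x * series (sin_coeff' x) n).
  by rewrite -mulNr; apply: cvgMl_tmp; exact: cvg_sin_coeff'.
apply/funext => n; rewrite /series/= big_nat_recl // !mul0r add0r mulr_sumr.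
apply: eq_bigr => l _; rewrite /sin_coeff' -exprnP -mul2n mulnS !add2n factS natrM !exprS.
have f0 : (2 * l).+1`!%:R != 0 :> R by rewrite pnatr_eq0 -lt0n fact_gt0.
by field; rewrite f0 gt_eqF //; have := ler0n R l; lra.
Qed.

Lemma cvg_sin_natM (x : R) :
  series (fun l => (2 * l).+1%:R * ((-1) ^+ l * x ^+ (2 * l).+1 / (2 * l).+1`!%:R)) @ \oo -->
  x * cos x.
Proof.
rewrite [X in X @ \oo --> _](_ : _ = fun n => x * series (cos_coeff' x) n).
  by apply: cvgMl_tmp; exact: cvg_cos_coeff'.
apply/funext => n; rewrite /series/= mulr_sumr.
apply: eq_bigr => l _; rewrite /cos_coeff' -exprnP -mul2n factS natrM exprS.
have f0 : (2 * l)`!%:R != 0 :> R by rewrite pnatr_eq0 -lt0n fact_gt0.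
by field; rewrite f0 gt_eqF //; have := ler0n R l; lra.
Qed.

Lemma cvg_cos (x : R) : series (fun l => (-1) ^+ l * x ^+ (2 * l) / (2 * l)`!%:R) @ \oo --> cos x.
Proof.
rewrite [X in series X](_ : _ = cos_coeff' x); first exact: cvg_cos_coeff'.
by apply/funext => l; rewrite /cos_coeff' -exprnP -mul2n.
Qed.

Lemma cvg_sin (x : R) :
  series (fun l => (-1) ^+ l * x ^+ (2 * l).+1 / (2 * l).+1`!%:R) @ \oo --> sin x.
Proof.
rewrite [X in series X](_ : _ = sin_coeff' x); first exact: cvg_sin_coeff'.
by apply/funext => l; rewrite /sin_coeff' -exprnP -mul2n.
Qed.

(* The kernel is [H (chord) / chord]. *)
Definition zonal_eigenvalue m (H : R -> R) (A : R) : Prop :=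
  forall q, homogeneous m q -> harmonic_poly q ->
  leb2.-integrable box
    (EFin \o (fun z => H (chord xi z) * inv_chord xi z * peval q z * sin z.1)) /\
  \int[leb2]_(z in box) (H (chord xi z) * inv_chord xi z * peval q z * sin z.1) =
    A * mpoly.meval xi q.

Lemma measurable_fun_chord (H : R -> R) : continuous H ->
  measurable_fun [set: R * R] (fun z => H (chord xi z)).
Proof. by move=> cH; apply: measurableT_comp; [exact: continuous_measurable_fun|exact: measurable_chord]. Qed.

(** The offset [d] selects the parity, 0 for cosine and 1 for sine. The weight [a] is 1 for the
    kernel itself and the exponent minus one for its radial derivative. *)
Lemma zonal_series m (a : nat -> R) d H A : (forall l, `|a l| <= (2 * l + 1)%:R) ->
  (forall x, series (fun l => a l * ((-1) ^+ l * x ^+ (d + 2 * l) / (d + 2 * l)`!%:R))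
     @ \oo --> H x) ->
  continuous H ->
  series (fun l => a l * ((-1) ^+ l * k ^+ (d + 2 * l) / (d + 2 * l)`!%:R) *
    alpha (d + 2 * l) m) @ \oo --> A ->
  zonal_eigenvalue m (fun s => H (k * s)) A.
Proof.
move=> ha cH contH cA q hq hh.
apply: (funk_hecke_series xi_unit
  (h := fun l => a l * (-1) ^+ l * k ^+ (d + 2 * l) / (d + 2 * l)`!%:R)
  (e := fun l => (d + 2 * l)%N) (H := fun s => H (k * s))) hq hh _ _ _ _.
- exact: trig_summable.
- move=> s _; apply: (cvg_series_ext _ (cH (k * s))) => l.
  by rewrite exprMn; ring.
- apply: (measurable_fun_chord (H := fun s => H (k * s))) => s.
  by apply: continuous_comp; [apply: cvgMl_tmp|exact: contH].
- by apply: (cvg_series_ext _ cA) => l; ring.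
Qed.

Lemma zonal_cos m :
  zonal_eigenvalue m (fun s => cos (k * s)) (- 4 * pi * (k * (sph_j m k * sph_y m k))).
Proof.
apply: (zonal_series (a := fun=> 1) (d := 0) (H := cos)).
- by move=> l; rewrite normr1 ler1n addn1.
- by move=> x; apply: (cvg_series_ext _ (@cvg_cos x)) => l; rewrite mul1r.
- exact: continuous_cos.
- have kn0 : k != 0 by rewrite gt_eqF.
  apply: (cvg_series_ext _ (@cvg_even_coef R m k kn0)) => l.
  by rewrite /even_coef add0n; ring.
Qed.

Lemma zonal_sin m :
  zonal_eigenvalue m (fun s => sin (k * s)) (4 * pi * (k * sph_j m k ^+ 2)).
Proof.
apply: (zonal_series (a := fun=> 1) (d := 1) (H := sin)).
- by move=> l; rewrite normr1 ler1n addn1.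
- by move=> x; apply: (cvg_series_ext _ (@cvg_sin x)) => l; rewrite mul1r.
- exact: continuous_sin.
- apply: (cvg_series_ext _ (@cvg_odd_coef R m k)) => l.
  by rewrite /odd_coef add1n; ring.
Qed.

(** The numerator is s^2 d/ds (cos(ks)/s). The division by s explains the weight exponent minus one,
    and the subtraction removes the summand j_m y_m without derivatives. *)
Lemma zonal_dcos m :
  zonal_eigenvalue m (fun s => - (k * s * sin (k * s)) - cos (k * s))
    (- 4 * pi * (k * (dsph_j m k * sph_y m k + sph_j m k * dsph_y m k))).
Proof.
have kn0 : k != 0 by rewrite gt_eqF.
apply: (zonal_series (a := fun l => (2 * l)%:R - 1) (d := 0)
  (H := fun x => - (x * sin x) - cos x)).
- move=> l; rewrite natrD; have := ler0n R (2 * l) => l0.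
  by rewrite ler_norml; apply/andP; split; lra.
- move=> x; rewrite [X in X @ \oo --> _](_ : _ =
    (fun n => series (fun l => (2 * l)%:R * ((-1) ^+ l * x ^+ (2 * l) / (2 * l)`!%:R)) n -
     series (fun l => (-1) ^+ l * x ^+ (2 * l) / (2 * l)`!%:R) n)).
    by apply: cvgB; [exact: cvg_cos_natM|exact: cvg_cos].
  by apply/funext => n; rewrite /series/= -sumrB; apply: eq_bigr => l _; rewrite add0n; ring.
- move=> x; apply: cvgB; last exact: continuous_cos.
  by apply: cvgN; apply: cvgM; [exact: cvg_id|exact: continuous_sin].
- rewrite [X in X @ \oo --> _](_ : _ =
    (fun n => series (fun p => (2 * p)%:R * even_coef p m * k ^+ (2 * p)) n -
     series (fun p => even_coef p m * k ^+ (2 * p)) n)); last first.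
    apply/funext => n; rewrite /series/= -sumrB; apply: eq_bigr => l _.
    by rewrite /even_coef add0n; ring.
  rewrite [X in _ --> X](_ : _ = - 4 * pi * (k * (sph_j m k * sph_y m k +
       dsph_j m k * sph_y m k + sph_j m k * dsph_y m k)) -
     - 4 * pi * (k * (sph_j m k * sph_y m k))); last by ring.
  by apply: cvgB; [exact: cvg_even_coef_natM|exact: cvg_even_coef].
Qed.

Lemma zonal_dsin m :
  zonal_eigenvalue m (fun s => k * s * cos (k * s) - sin (k * s))
    (8 * pi * (k * (sph_j m k * dsph_j m k))).
Proof.
apply: (zonal_series (a := fun l => (2 * l)%:R) (d := 1)
  (H := fun x => x * cos x - sin x)).
- by move=> l; rewrite normr_nat ler_nat leq_addr.
- move=> x; rewrite [X in X @ \oo --> _](_ : _ =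
    (fun n => series (fun l => (2 * l).+1%:R * ((-1) ^+ l * x ^+ (2 * l).+1 / (2 * l).+1`!%:R)) n -
     series (fun l => (-1) ^+ l * x ^+ (2 * l).+1 / (2 * l).+1`!%:R) n)).
    by apply: cvgB; [exact: cvg_sin_natM|exact: cvg_sin].
  apply/funext => n; rewrite /series/= -sumrB; apply: eq_bigr => l _.
  by rewrite add1n -(natr1 (2 * l)); ring.
- move=> x; apply: cvgB; last exact: continuous_sin.
  by apply: cvgM; [exact: cvg_id|exact: continuous_cos].
- rewrite [X in X @ \oo --> _](_ : _ =
    (fun n => series (fun p => (2 * p).+1%:R * odd_coef p m * k ^+ (2 * p).+1) n -
     series (fun p => odd_coef p m * k ^+ (2 * p).+1) n)); last first.
    apply/funext => n; rewrite /series/= -sumrB; apply: eq_bigr => l _.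
    by rewrite /odd_coef add1n -(natr1 (2 * l)); ring.
  rewrite [X in _ --> X](_ : _ =
    4 * pi * (k * (sph_j m k ^+ 2 + 2 * (sph_j m k * dsph_j m k))) -
    4 * pi * (k * sph_j m k ^+ 2)); last by ring.
  by apply: cvgB; [exact: cvg_odd_coef_natM|exact: cvg_odd_coef].
Qed.

End TrigKernels.
End ZonalKernels.

(** * Layer potentials on the sphere *)

Section WaveKernels.
Set Implicit Arguments.
Unset Strict Implicit.
Context {R : realType}.
Implicit Types (z : R * R) (f h : R * R -> R).

Local Notation leb2 := (@lebesgue_measure R \x @lebesgue_measure R)%E.

(** * Taking the real or the imaginary part [f] of the coefficients of a polynomial *)

Section ComplexPolynomials.
Variable f : {additive R[i] -> R}.
Hypothesis f_real : forall (c : R[i]) (x : R), f (c * x%:C) = f c * x.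
Implicit Type p : mpoly.mpoly 3 R[i].

Lemma map_mpoly_mderiv p (i : 'I_3) :
  mpoly.mderiv i (mpoly.map_mpoly f p) = mpoly.map_mpoly f (mpoly.mderiv i p).
Proof.
apply/mpoly.mpolyP => M.
by rewrite mpoly.mcoeff_map_mpoly !mpoly.mcoeff_mderiv mpoly.mcoeff_map_mpoly raddfMn.
Qed.

Lemma harmonic_map_mpoly p : \sum_(i < 3) mpoly.mderiv i (mpoly.mderiv i p) = 0 ->
  harmonic_poly (mpoly.map_mpoly f p).
Proof.
move=> hp; rewrite /harmonic_poly.
under eq_bigr do rewrite !map_mpoly_mderiv.
by rewrite -raddf_sum hp raddf0.
Qed.

Lemma homogeneous_map_mpoly m p : p \is mpoly.ishomog1 m mpoly.mdeg ->
  homogeneous m (mpoly.map_mpoly f p).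
Proof.
move=> hp; apply/mpoly.dhomogP => M.
rewrite mpoly.mcoeff_msupp mpoly.mcoeff_map_mpoly => fM.
apply/eqP; apply: contraNT fM => hM.
by rewrite (mpoly.dhomog_nemf_coeff hp hM) raddf0.
Qed.

Lemma meval_map_mpoly (x : 'I_3 -> R) p :
  mpoly.meval x (mpoly.map_mpoly f p) = f (mpoly.meval (fun i => (x i)%:C) p).
Proof.
rewrite {1 2}(mpoly.mpolyE p). rewrite (raddf_sum (mpoly.map_mpoly f)) (raddf_sum (mpoly.meval x)).
rewrite (raddf_sum (mpoly.meval _)) (raddf_sum f); apply: eq_bigr => M _.
have E c : mpoly.map_mpoly f (c *: mpoly.mpolyX R[i] M) = f c *: mpoly.mpolyX R M.
  apply/mpoly.mpolyP => M'; rewrite mpoly.mcoeff_map_mpoly !mpoly.mcoeffZ !mpoly.mcoeffX.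
  by case: (M == M'); rewrite ?mulr1 ?mulr0 ?raddf0.
apply: (etrans (congr1 (mpoly.meval x) (E _))).
rewrite mpoly.mevalZ mpoly.mevalX -f_real; apply: congr1.
apply: (etrans _ (esym (mpoly.mevalZ _ _ _))); rewrite mpoly.mevalX; congr (_ * _).
by rewrite rmorph_prod; apply: eq_bigr => i _; rewrite rmorphXn.
Qed.

End ComplexPolynomials.

Fact Re_additive : {morph (@complex.Re R) : x y / x - y}.
Proof. by move=> [a b] [c d]. Qed.
Fact Im_additive : {morph (@complex.Im R) : x y / x - y}.
Proof. by move=> [a b] [c d]. Qed.

Lemma spherical_harmonic_parts m Y : spherical_harmonic m Y ->
  exists qr qi : mpoly.mpoly 3 R,
    [/\ homogeneous m qr, harmonic_poly qr, homogeneous m qi, harmonic_poly qi &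
      forall s, enorm s = 1 ->
        Y s = mpoly.meval (fun i => s 0 i) qr +i* mpoly.meval (fun i => s 0 i) qi].
Proof.
move=> [p [hp lp Yp]].
pose re : {additive R[i] -> R} := HB.pack (@complex.Re R)
  (GRing.isZmodMorphism.Build R[i] R (@complex.Re R) Re_additive).
pose im : {additive R[i] -> R} := HB.pack (@complex.Im R)
  (GRing.isZmodMorphism.Build R[i] R (@complex.Im R) Im_additive).
have rre (c : R[i]) (x : R) : re (c * x%:C) = re c * x.
  by case: c => a b /=; rewrite mulr0 subr0.
have rim (c : R[i]) (x : R) : im (c * x%:C) = im c * x.
  by case: c => a b /=; rewrite mulr0 add0r.
exists (mpoly.map_mpoly re p), (mpoly.map_mpoly im p); split.
- exact: homogeneous_map_mpoly.
- exact: harmonic_map_mpoly.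
- exact: homogeneous_map_mpoly.
- exact: harmonic_map_mpoly.
- move=> s s1; rewrite !meval_map_mpoly // -Yp //=.
  by case: (Y s).
Qed.

(** * Principal values of weakly singular integrals *)

Section PrincipalValue.
Variables (xi : 'I_3 -> R) (r : R).
Hypothesis xi_unit : \sum_i xi i ^+ 2 = 1.
Hypothesis r_gt0 : 0 < r.

Lemma measurable_chord_gt e : measurable [set z | e < r * chord xi z].
Proof.
have := measurable_fun_ltr (D := [set: R * R]) (f := fun=> e) (g := fun z => r * chord xi z)
  (measurable_cst _) (measurable_funM (measurable_cst _) (measurable_chord xi)).
by move=> /(_ measurableT [set true] I); rewrite setTI; congr measurable; apply/funext => z.
Qed.

(** Along any sequence of radii decreasing to 0 or merely tending to it from the right, the
    indicators of the truncated domains tend to 1 off the pole, while the integrand stays below a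
    multiple of the inverse chord. *)
Lemma pv_weakly_singular b : cts_meas b ->
  let f z := b z * inv_chord xi z * sin z.1 in
  leb2.-integrable box (EFin \o f) /\
  \int[leb2]_(z in box `&` [set z | e < r * chord xi z]) f z @[e --> 0^'+] -->
    \int[leb2]_(z in box) f z.
Proof.
move=> nb f; have [M M0 bM] := cts_meas_bounded nb.
have mf : measurable_fun [set: R * R] (fun z => b z * inv_chord xi z).
  by apply: measurable_funM; [exact: nb.2|exact: measurable_inv_chord].
have ic z : 0 <= inv_chord xi z by rewrite invr_ge0 chord_ge0.
have bd z : box z -> `|b z * inv_chord xi z| <= M * inv_chord xi z.
  by move=> bz; rewrite normrM (ger0_norm (ic z)) ler_wpM2r ?bM.
split.
  have [||||] // := sphere_dominated xi_unit (u := fun _ z => b z * inv_chord xi z)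
    (f := fun z => b z * inv_chord xi z) (C := M).
  - by move=> z _ _; exact: cvg_cst.
  - by move=> n z bz _; exact: bd.
apply/cvg_at_rightP => u [u0 ucvg].
have -> : (fun n => \int[leb2]_(z in box `&` [set z | u n < r * chord xi z]) f z) =
    fun n => \int[leb2]_(z in box)
      (\1_[set z | u n < r * chord xi z] z * (b z * inv_chord xi z) * sin z.1).
  apply/funext => n; rewrite Rintegral_mkcondr; congr Rintegral; apply/funext => z.
  by rewrite patchE indicE; case: (z \in _); rewrite ?mul1r ?mul0r.
have [||||] // := sphere_dominated xi_unit
  (u := fun n z => \1_[set z | u n < r * chord xi z] z * (b z * inv_chord xi z))
  (f := fun z => b z * inv_chord xi z) (C := M).
- move=> n; apply: measurable_funM => //.
  by apply: measurable_indic; exact: measurable_chord_gt.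
- move=> z bz zpos; rewrite -[X in _ --> X]mul1r; apply: cvgMr_tmp.
  apply: cvg_near_cst.
  have /(cvgr_lt _ ucvg) : 0 < r * chord xi z by rewrite mulr_gt0.
  by apply: filterS => n un; rewrite indicE mem_set.
- move=> n z bz _; rewrite normrM; apply: le_trans (bd z bz).
  by rewrite ler_piMl // indicE; case: (_ \in _); rewrite ?normr1 ?normr0.
Qed.

End PrincipalValue.

(** The real and the imaginary part of a complex kernel times Y each mix two real kernels with two
    real polynomials. *)
Lemma zonal_combine xi m H1 H2 A1 A2 (a1 a2 : R) q1 q2 :
  zonal_eigenvalue xi m H1 A1 -> zonal_eigenvalue xi m H2 A2 ->
  homogeneous m q1 -> harmonic_poly q1 -> homogeneous m q2 -> harmonic_poly q2 ->
  let f z := (a1 * H1 (chord xi z) * peval q1 z + a2 * H2 (chord xi z) * peval q2 z) *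
    inv_chord xi z * sin z.1 in
  leb2.-integrable box (EFin \o f) /\
  \int[leb2]_(z in box) f z = a1 * A1 * mpoly.meval xi q1 + a2 * A2 * mpoly.meval xi q2.
Proof.
move=> z1 z2 hq1 hh1 hq2 hh2 f.
have [i1 e1] := z1 _ hq1 hh1; have [i2 e2] := z2 _ hq2 hh2.
have iZ (a : R) h : leb2.-integrable box (EFin \o h) ->
    leb2.-integrable box (EFin \o (fun z => a * h z)).
  move=> ih; rewrite (_ : _ \o _ = fun z => (a%:E * (EFin \o h) z)%E) //.
  by apply: integrableZl => //; exact: measurable_box.
have -> : f = fun z =>
    a1 * (H1 (chord xi z) * inv_chord xi z * peval q1 z * sin z.1) +
    a2 * (H2 (chord xi z) * inv_chord xi z * peval q2 z * sin z.1).
  by apply/funext => z; rewrite /f; ring.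
split.
  rewrite (_ : _ \o _ = fun z =>
    ((EFin \o (fun z => a1 * (H1 (chord xi z) * inv_chord xi z * peval q1 z * sin z.1))%R) z +
     (EFin \o (fun z => a2 * (H2 (chord xi z) * inv_chord xi z * peval q2 z * sin z.1))%R) z)%E) //.
  by apply: integrableD; [exact: measurable_box|exact: iZ|exact: iZ].
rewrite RintegralD; [|exact: measurable_box|exact: iZ|exact: iZ].
rewrite !RintegralZl; [|exact: measurable_box|exact: i2|exact: measurable_box|exact: i1].
by rewrite e1 e2 -!mulrA.
Qed.

(** * Distances on the sphere and along its normals *)

Section Geometry.
Implicit Types (x y v w : 'rV[R]_3).

Lemma sqr_enorm x : enorm x ^+ 2 = \sum_i x 0 i ^+ 2.
Proof. by rewrite sqr_sqrtr // sumr_ge0 // => i _; exact: sqr_ge0. Qed.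

Lemma enorm_ge0 x : 0 <= enorm x. Proof. exact: sqrtr_ge0. Qed.


Lemma enorm_eq x a : 0 <= a -> \sum_i x 0 i ^+ 2 = a ^+ 2 -> enorm x = a.
Proof. by move=> a0 h; rewrite /enorm h sqrtr_sqr ger0_norm. Qed.

Lemma hatE x i : hat x 0 i = (enorm x)^-1 * x 0 i.
Proof. by rewrite mxE. Qed.

Lemma hat_unit x : 0 < enorm x -> \sum_i hat x 0 i ^+ 2 = 1.
Proof.
move=> x0; under eq_bigr do rewrite hatE exprMn.
by rewrite -mulr_sumr -sqr_enorm -exprMn mulVf ?expr1n // gt_eqF.
Qed.

Lemma sph_coordE r z i : sph_coord r z 0 i = r * e_rad z i.
Proof. by rewrite !mxE. Qed.

Lemma enorm_sph_coord r z : 0 <= r -> enorm (sph_coord r z) = r.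
Proof.
move=> r0; apply: enorm_eq => //; under eq_bigr do rewrite sph_coordE exprMn.
by rewrite -mulr_sumr e_rad_unit mulr1.
Qed.

Lemma hat_sph_coord r z : 0 < r -> hat (sph_coord r z) = sph_coord 1 z.
Proof.
move=> r0; apply/rowP => i; rewrite hatE enorm_sph_coord ?ltW // !sph_coordE.
by rewrite mulKf ?mul1r // gt_eqF.
Qed.

Lemma enorm_sub_sph_coord x z : 0 < enorm x ->
  enorm (x - sph_coord (enorm x) z) = enorm x * chord (fun i => hat x 0 i) z.
Proof.
move=> x0; apply: enorm_eq; first by rewrite mulr_ge0 ?enorm_ge0 ?chord_ge0.
rewrite exprMn (sqr_chord (hat_unit x0)) (chord2E (hat_unit x0)) mulr_sumr.
apply: eq_bigr => i _; rewrite -exprMn mulrBr hatE mulVKf ?gt_eqF //.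
by rewrite -sph_coordE !mxE.
Qed.

(** The linear term is 2h (x - y) . hat x; equality of the two norms expresses it through |x - y|
    alone. *)
Lemma enorm_normal_line x y (h : R) : 0 < enorm x -> enorm y = enorm x ->
  enorm (h *: hat x + x - y) =
    Num.sqrt (h * h + h * (enorm (x - y) ^+ 2 / enorm x) + enorm (x - y) ^+ 2).
Proof.
move=> x0 yx; rewrite {1}/enorm; congr Num.sqrt.
have x2 := sqr_enorm x; have y2 := sqr_enorm y.
rewrite yx in y2; rewrite !sum3E in x2 y2.
rewrite sqr_enorm !sum3E !mxE.
set n := enorm x in x0 x2 y2 *.
have n0 : n != 0 by rewrite gt_eqF.
set x0' := x 0 0 in x2 y2 *; set x1' := x 0 1 in x2 y2 *; set x2' := x 0 2 in x2 y2 *.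
set y0' := y 0 0 in y2 *; set y1' := y 0 1 in y2 *; set y2' := y 0 2 in y2 *.
apply: (mulfI (mulf_neq0 n0 n0)); apply/eqP; rewrite -subr_eq0; apply/eqP.
(* Multiplied by n^2, the difference of the two sides is a combination of the equations |x|^2 = n^2
   and |x|^2 = |y|^2. *)
transitivity (h ^+ 2 * (x0' ^+ 2 + x1' ^+ 2 + x2' ^+ 2 - n ^+ 2) +
  h * n * ((x0' ^+ 2 + x1' ^+ 2 + x2' ^+ 2) - (y0' ^+ 2 + y1' ^+ 2 + y2' ^+ 2))).
  by field.
by rewrite -x2 -y2 !subrr !mulr0 addr0.
Qed.

Lemma derive_line (F : 'rV[R]_3 -> R) x v d :
  is_derive (0 : R) (1 : R) (fun t => F (t *: v + x)) d -> 'D_v F x = d.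
Proof.
move=> dg; rewrite -(@derive_val _ _ _ _ _ _ _ dg) /derive.
set A := (X in lim (X @ _)); set B := (X in _ = lim (X @ _)).
suff -> : A = B by [].
apply/funext => t; rewrite /A /B /=.
by rewrite [X in F (X *: v + x)](_ : _ = t) ?scale0r ?add0r //; exact: etrans (addr0 _) (mulr1 t).
Qed.

Lemma divc_real (a b c : R) : (a +i* b) / c%:C = (a / c) +i* (b / c).
Proof. by rewrite -fmorphV; apply/eqP; rewrite eq_complex /= !mulr0 subr0 add0r !eqxx. Qed.

Lemma G_parts k w : G k w =
  (- cos (k * enorm w) / (4 * pi * enorm w)) +i* (- sin (k * enorm w) / (4 * pi * enorm w)).
Proof. by rewrite /G -divc_real. Qed.

End Geometry.

Lemma is_derive_cos_over (k t : R) : 0 < t ->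
  is_derive t (1 : R) (fun u => - cos (k * u) / (4 * pi * u))
    ((k * t * sin (k * t) + cos (k * t)) / (4 * pi * t ^+ 2)).
Proof.
move=> t0; have pi0 : pi != 0 :> R by rewrite gt_eqF // pi_gt0.
have dk : is_derive t (1 : R) (fun u => k * u) k.
  by apply: (is_derive_cstM (f := id) (is_derive_id _ _)); rewrite mulr1.
have dc := is_derive_compE (is_derive_cos (k * t)) dk erefl.
have tn : t != 0 by rewrite gt_eqF.
have dv := is_deriveV (f := id) tn (is_derive_id t (1 : R)).
rewrite (_ : (fun u => _) = fun u => - (4 * pi)^-1 * (cos (k * u) * u^-1)).
  apply: (is_derive_cstM (f := fun u => cos (k * u) * u^-1)
    (is_derive_mul (f := fun u => cos (k * u)) (g := fun u => u^-1) dc dv erefl)).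
  rewrite /GRing.scale /=.
  by move: (pi : R) pi0 => p p0; field; rewrite tn p0.
by apply/funext => u; rewrite invfM; ring.
Qed.

Lemma is_derive_sin_over (k t : R) : 0 < t ->
  is_derive t (1 : R) (fun u => - sin (k * u) / (4 * pi * u))
    (- (k * t * cos (k * t) - sin (k * t)) / (4 * pi * t ^+ 2)).
Proof.
move=> t0; have pi0 : pi != 0 :> R by rewrite gt_eqF // pi_gt0.
have dk : is_derive t (1 : R) (fun u => k * u) k.
  by apply: (is_derive_cstM (f := id) (is_derive_id _ _)); rewrite mulr1.
have dc := is_derive_compE (is_derive_sin (k * t)) dk erefl.
have tn : t != 0 by rewrite gt_eqF.
have dv := is_deriveV (f := id) tn (is_derive_id t (1 : R)).
rewrite (_ : (fun u => _) = fun u => - (4 * pi)^-1 * (sin (k * u) * u^-1)).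
  apply: (is_derive_cstM (f := fun u => sin (k * u) * u^-1)
    (is_derive_mul (f := fun u => sin (k * u)) (g := fun u => u^-1) dc dv erefl)).
  rewrite /GRing.scale /=.
  by move: (pi : R) pi0 => p p0; field; rewrite tn p0.
by apply/funext => u; rewrite invfM; ring.
Qed.

(* On the sphere, [(x - y) . hat x = |x - y|^2 / (2 |x|)], so that the normal
   derivative of the distance to [y] is half the chord over the radius. *)
Lemma derive_radial (g : R -> R) (dg s : R) (x y : 'rV[R]_3) :
  0 < enorm x -> enorm y = enorm x -> 0 < s -> enorm (x - y) = enorm x * s ->
  is_derive (enorm x * s) (1 : R) g dg ->
  'D_(hat x) (fun w => g (enorm (w - y))) x = dg * (s / 2).
Proof.
move=> x0 yx s0 xy dgP; have xs0 : 0 < enorm x * s by rewrite mulr_gt0.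
apply: derive_line.
under eq_fun do rewrite enorm_normal_line // xy.
set c := _ / enorm x; set d := (enorm x * s) ^+ 2.
have cE : c = enorm x * s ^+ 2 by rewrite /c; field; rewrite gt_eqF.
have d0 : 0 < 0 * 0 + 0 * c + d by rewrite !mul0r !add0r exprn_gt0.
have dp : is_derive (0 : R) (1 : R) (fun t => t * t + t * c + d) c.
  have dq : is_derive (0 : R) (1 : R) (fun t => t * (t + c)) c.
    have da : is_derive (0 : R) (1 : R) (fun t => t + c) 1.
      exact: is_derive_add (is_derive_id _ _) (is_derive_cst _ _ _) (addr0 _).
    apply: (is_derive_mul (f := id) (g := fun t => t + c) (is_derive_id _ _) da).
    by rewrite mul0r addr0 mul1r add0r.
  rewrite (_ : (fun t => _) = fun t => t * (t + c) + d).
    exact: is_derive_add dq (is_derive_cst _ _ _) (addr0 _).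
  by apply/funext => t; ring.
have sE : Num.sqrt (0 * 0 + 0 * c + d) = enorm x * s.
  by rewrite !mul0r !add0r sqrtr_sqr gtr0_norm.
have ds := is_derive_compE (f := fun t => t * t + t * c + d) (t := 0) (is_derive1_sqrt d0) dp erefl.
apply: (is_derive_compE (F := g) (f := fun t => Num.sqrt (t * t + t * c + d)) _ ds).
  by rewrite sE; exact: dgP.
rewrite sE cE; field; rewrite !gt_eqF //.
Qed.

(** The numerators are put in the form of [zonal_dcos] and [zonal_dsin]. The factor s/2 from the
    normal derivative of the distance turns 4 into 8 and reduces the singularity from s^-2 to
    s^-1. *)
Lemma cderive_G (k s : R) (x y : 'rV[R]_3) :
  0 < enorm x -> enorm y = enorm x -> 0 < s -> enorm (x - y) = enorm x * s ->
  cderive (fun w => G k (w - y)) x (hat x) =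
  (- (8 * pi * enorm x ^+ 2)^-1 *
     (- (k * enorm x * s * sin (k * enorm x * s)) - cos (k * enorm x * s)) / s) +i*
  (- (8 * pi * enorm x ^+ 2)^-1 *
     (k * enorm x * s * cos (k * enorm x * s) - sin (k * enorm x * s)) / s).
Proof.
move=> x0 yx s0 xy; have xs0 : 0 < enorm x * s by rewrite mulr_gt0.
have pi0 : pi != 0 :> R by rewrite gt_eqF // pi_gt0.
rewrite /cderive; congr (_ +i* _).
- under eq_fun do rewrite G_parts /=.
  rewrite (derive_radial x0 yx s0 xy (is_derive_cos_over k xs0)) !mulrA.
  move: (enorm x) x0 (pi : R) pi0 => n n0 p p0; field; rewrite p0 !gt_eqF //.
- under eq_fun do rewrite G_parts /=.
  rewrite (derive_radial x0 yx s0 xy (is_derive_sin_over k xs0)) !mulrA.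
  move: (enorm x) x0 (pi : R) pi0 => n n0 p p0; field; rewrite p0 !gt_eqF //.
Qed.

Lemma sph_domE (r : R) (A : set 'rV[R]_3) : sph_dom r A = box `&` [set z | A (sph_coord r z)].
Proof.
by apply/seteqP; split=> z; rewrite /box /polar_range /azimuth_range /= !in_itv /=;
  [move=> [? ? ?]|move=> [[? ?] ?]].
Qed.

Lemma sph_dom_setT (r : R) : sph_dom r [set: 'rV[R]_3] = box.
Proof. by rewrite sph_domE (_ : [set z | _] = setT) ?setIT //; exact/seteqP. Qed.

Lemma sph_dom_gt (x : 'rV[R]_3) (e : R) : 0 < enorm x ->
  sph_dom (enorm x) [set y | e < enorm (x - y)] =
  box `&` [set z | e < enorm x * chord (fun i => hat x 0 i) z].
Proof.
move=> x0; rewrite sph_domE; congr (_ `&` _).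
by apply/seteqP; split=> z /=; rewrite enorm_sub_sph_coord.
Qed.

(** The density is compared with its weakly singular form only where the chord is positive, which
    holds on every truncated domain. *)
Lemma pv_weakly_singular_sphere (x : 'rV[R]_3) (g : 'rV[R]_3 -> R) b :
  let xi i := hat x 0 i in
  let f z := b z * inv_chord xi z * sin z.1 in
  0 < enorm x -> cts_meas b ->
  (forall z, box z -> 0 < chord xi z -> sph_dens (enorm x) g z = f z) ->
  (forall e, 0 < e -> leb2.-integrable (sph_dom (enorm x) [set y | e < enorm (x - y)])
    (EFin \o sph_dens (enorm x) g)) /\
  \int[leb2]_(z in sph_dom (enorm x) [set y | e < enorm (x - y)])
    sph_dens (enorm x) g z @[e --> 0^'+] --> \int[leb2]_(z in box) f z.
Proof.
move=> xi f x0 nb gf; have xi1 := hat_unit x0.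
have [fi fc] := pv_weakly_singular xi1 x0 nb.
have gfE e : 0 < e -> {in box `&` [set z | e < enorm x * chord xi z],
    sph_dens (enorm x) g =1 f}.
  move=> e0 z; rewrite inE /= => -[bz ez]; apply: gf => //.
  by rewrite -(pmulr_rgt0 _ x0); exact: lt_trans ez.
have mS e : measurable (box `&` [set z | e < enorm x * chord xi z]).
  by apply: measurableI; [exact: measurable_box|exact: measurable_chord_gt].
split=> [e e0|].
  rewrite sph_dom_gt //; apply: (@eq_integrable _ _ _ leb2 _ (mS e) (EFin \o f)).
    by move=> z /(gfE _ e0) /= ->.
  by apply: (@integrableS _ _ _ leb2 _ _ _ measurable_box (mS e) _ fi) => z [].
apply: cvg_trans fc; apply: near_eq_cvg; near=> e.
have e0 : 0 < e by near: e; exact: nbhs_right_gt.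
rewrite sph_dom_gt //; apply: eq_Rintegral => z /(gfE _ e0) ->.
by [].
Unshelve. all: by end_near.
Qed.

Lemma lambdaE m (k r : R) : k * r != 0 ->
  lambda m k r = (2^-1 + k * r * (dsph_j m (k * r) * sph_y m (k * r))) +i*
    (- (k * r * (dsph_j m (k * r) * sph_j m (k * r)))).
Proof.
move=> t0; rewrite /lambda derive1E (@derive_val _ _ _ _ _ _ _ (is_derive_sph_j m t0)).
have [k0 r0] : k != 0 /\ r != 0 by apply/andP; rewrite -negb_or -mulf_eq0.
by apply/eqP; rewrite eq_complex /=; apply/andP; split; apply/eqP; field; rewrite k0 r0.
Qed.

Lemma lambda_dh1 m (k r : R) : k * r != 0 ->
  lambda m k r = - 2^-1 - 'i%C * (k ^+ 2 * r ^+ 2 * sph_j m (k * r))%:C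
                    * cderive1 (sph_h1 m) (k * r).
Proof.
move=> t0; rewrite lambdaE // /cderive1 /sph_h1 /= !derive1E.
rewrite (@derive_val _ _ _ _ _ _ _ (is_derive_sph_j m t0)).
rewrite (@derive_val _ _ _ _ _ _ _ (is_derive_sph_y m t0)).
have [k0 r0] : k != 0 /\ r != 0 by apply/andP; rewrite -negb_or -mulf_eq0.
have dyE : k * r * (dsph_j m (k * r) * sph_y m (k * r)) =
    k * r * (sph_j m (k * r) * dsph_y m (k * r)) - 1.
  by rewrite -(sph_wronskian m t0); ring.
rewrite dyE; apply/eqP; rewrite eq_complex /=.
by apply/andP; split; apply/eqP; field; rewrite k0 r0.
Qed.

(** * Eigenvalues of the two layer potentials *)

Section LayerPotentials.
Variables (k : R) (x : 'rV[R]_3) (m : nat).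
Variables (qr qi : mpoly.mpoly 3 R) (Y : 'rV[R]_3 -> R[i]).
Hypotheses (k_gt0 : 0 < k) (x_gt0 : 0 < enorm x).
Hypotheses (hqr : homogeneous m qr) (hhr : harmonic_poly qr).
Hypotheses (hqi : homogeneous m qi) (hhi : harmonic_poly qi).
Hypothesis YE : forall s, enorm s = 1 ->
  Y s = mpoly.meval (fun i => s 0 i) qr +i* mpoly.meval (fun i => s 0 i) qi.

Local Notation r := (enorm x).
Local Notation xi := (fun i => hat x 0 i).
Let xi1 := hat_unit x_gt0.
Let kr_gt0 : 0 < k * r. Proof. exact: mulr_gt0. Qed.

Lemma Y_hat : Y (hat x) = mpoly.meval xi qr +i* mpoly.meval xi qi.
Proof. by rewrite YE //; apply: enorm_eq; rewrite ?ler01 // expr1n. Qed.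

Lemma Y_sph_coord z : Y (hat (sph_coord r z)) = peval qr z +i* peval qi z.
Proof.
rewrite hat_sph_coord // YE ?enorm_sph_coord //.
have -> : (fun i => sph_coord 1 z 0 i) = e_rad z; last by [].
by apply/funext => i; rewrite sph_coordE mul1r.
Qed.

(** The area element contributes r^2 and the distance r times the chord, so one factor r remains. *)
Lemma SL_density_Re z :
  sph_dens r (fun y => complex.Re (SL_integrand k (fun y => Y (hat y)) x y)) z =
  (- (r / (4 * pi)) * cos (k * r * chord xi z) * peval qr z +
   (r / (4 * pi)) * sin (k * r * chord xi z) * peval qi z) * inv_chord xi z * sin z.1.
Proof.
rewrite /sph_dens /SL_integrand G_parts Y_sph_coord enorm_sub_sph_coord //= /inv_chord.
have pi0 : pi != 0 :> R by rewrite gt_eqF // pi_gt0.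
rewrite (mulrA k) !invfM; move: (chord _ z)^-1 => c.
move: (enorm x) x_gt0 (pi : R) pi0 => n n0 p p0.
by field; rewrite p0 gt_eqF.
Qed.

Lemma SL_density_Im z :
  sph_dens r (fun y => complex.Im (SL_integrand k (fun y => Y (hat y)) x y)) z =
  (- (r / (4 * pi)) * sin (k * r * chord xi z) * peval qr z +
   (- (r / (4 * pi))) * cos (k * r * chord xi z) * peval qi z) * inv_chord xi z * sin z.1.
Proof.
rewrite /sph_dens /SL_integrand G_parts Y_sph_coord enorm_sub_sph_coord //= /inv_chord.
have pi0 : pi != 0 :> R by rewrite gt_eqF // pi_gt0.
rewrite (mulrA k) !invfM; move: (chord _ z)^-1 => c.
move: (enorm x) x_gt0 (pi : R) pi0 => n n0 p p0.
by field; rewrite p0 gt_eqF.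
Qed.

Lemma SL_eigen : sphere_integrable r setT (SL_integrand k (fun y => Y (hat y)) x) /\
  SL k r (fun y => Y (hat y)) x = chi m k r * Y (hat x).
Proof.
have zc := @zonal_cos R xi (k * r) xi1 kr_gt0 m.
have zs := @zonal_sin R xi (k * r) xi1 kr_gt0 m.
have [ir er] := zonal_combine (- (r / (4 * pi))) (r / (4 * pi)) zc zs hqr hhr hqi hhi.
have [ii ei] := zonal_combine (- (r / (4 * pi))) (- (r / (4 * pi))) zs zc hqr hhr hqi hhi.
rewrite /SL /sphere_integrable /sphere_int sph_dom_setT.
have -> := funext SL_density_Re; have -> := funext SL_density_Im.
split; first by split.
rewrite er ei Y_hat.
have pi0 : pi != 0 :> R by rewrite gt_eqF // pi_gt0.
apply/eqP; rewrite eq_complex /=; move: (pi : R) pi0 => p p0.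
by apply/andP; split; apply/eqP; field; rewrite p0.
Qed.

(** The continuous numerators of the density, with the inverse chord set apart. The r^2 of the area
    element cancels that of the normal derivative. *)
Let NP_re z := (- (8 * pi)^-1 *
    (- (k * r * chord xi z * sin (k * r * chord xi z)) - cos (k * r * chord xi z)) * peval qr z +
  (8 * pi)^-1 *
    (k * r * chord xi z * cos (k * r * chord xi z) - sin (k * r * chord xi z)) * peval qi z).
Let NP_im z := (- (8 * pi)^-1 *
    (k * r * chord xi z * cos (k * r * chord xi z) - sin (k * r * chord xi z)) * peval qr z +
  - (8 * pi)^-1 *
    (- (k * r * chord xi z * sin (k * r * chord xi z)) - cos (k * r * chord xi z)) * peval qi z).

Lemma NP_density_Re z : 0 < chord xi z ->
  sph_dens r (fun y => complex.Re (NP_integrand k (fun y => Y (hat y)) x y)) z =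
  NP_re z * inv_chord xi z * sin z.1.
Proof.
move=> c0; rewrite /sph_dens /NP_integrand Y_sph_coord.
rewrite (cderive_G k x_gt0 _ c0) ?enorm_sub_sph_coord ?enorm_sph_coord ?ltW //=.
have pi0 : pi != 0 :> R by rewrite gt_eqF // pi_gt0.
rewrite /NP_re /inv_chord; move: (chord _ z) c0 => c c0.
move: (enorm x) x_gt0 (pi : R) pi0 => n n0 p p0.
by field; rewrite p0 !gt_eqF.
Qed.

Lemma NP_density_Im z : 0 < chord xi z ->
  sph_dens r (fun y => complex.Im (NP_integrand k (fun y => Y (hat y)) x y)) z =
  NP_im z * inv_chord xi z * sin z.1.
Proof.
move=> c0; rewrite /sph_dens /NP_integrand Y_sph_coord.
rewrite (cderive_G k x_gt0 _ c0) ?enorm_sub_sph_coord ?enorm_sph_coord ?ltW //=.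
have pi0 : pi != 0 :> R by rewrite gt_eqF // pi_gt0.
rewrite /NP_im /inv_chord; move: (chord _ z) c0 => c c0.
move: (enorm x) x_gt0 (pi : R) pi0 => n n0 p p0.
by field; rewrite p0 !gt_eqF.
Qed.

Lemma cts_meas_NP : cts_meas NP_re /\ cts_meas NP_im.
Proof.
have nc : cts_meas (fun z => k * r * chord xi z) by apply: cts_meas_mul (cts_meas_cst _) (cts_meas_chord xi).
have ns := cts_meas_comp (@continuous_sin R) nc; have nk := cts_meas_comp (@continuous_cos R) nc.
have nC := cts_meas_sub (cts_meas_opp (cts_meas_mul nc ns)) nk; have nS := cts_meas_sub (cts_meas_mul nc nk) ns.
by split; apply: cts_meas_add; apply: cts_meas_mul (cts_meas_peval _); apply: cts_meas_mul (cts_meas_cst _) _.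
Qed.

Lemma NP_eigen : pv_exists r x (NP_integrand k (fun y => Y (hat y)) x) /\
  NP k r (fun y => Y (hat y)) x = lambda m k r * Y (hat x).
Proof.
have zc := @zonal_dcos R xi (k * r) xi1 kr_gt0 m.
have zs := @zonal_dsin R xi (k * r) xi1 kr_gt0 m.
have [ir er] := zonal_combine (- (8 * pi)^-1) (8 * pi)^-1 zc zs hqr hhr hqi hhi.
have [ii ei] := zonal_combine (- (8 * pi)^-1) (- (8 * pi)^-1) zs zc hqr hhr hqi hhi.
have [nre nim] := cts_meas_NP.
have [iR cR] := pv_weakly_singular_sphere x_gt0 nre (fun z _ => @NP_density_Re z).
have [iI cI] := pv_weakly_singular_sphere x_gt0 nim (fun z _ => @NP_density_Im z).
split.
  split=> [e e0||].
  - by split; [exact: iR|exact: iI].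
  - by apply/cvg_ex; eexists; exact: cR.
  - by apply/cvg_ex; eexists; exact: cI.
rewrite /NP /pv_int /pv_trunc /sphere_int /=.
rewrite (cvg_lim (@norm_hausdorff _ R) cR) (cvg_lim (@norm_hausdorff _ R) cI).
rewrite er ei Y_hat.
have t0 : k * r != 0 by rewrite gt_eqF.
have pi0 : pi != 0 :> R by rewrite gt_eqF // pi_gt0.
(* The series give half of t (t j_m y_m' + t j_m' y_m) at t = kr. Eliminating y_m' with the
   Wronskian produces the summand 1/2 of the eigenvalue. *)
have jdy : k * r * (sph_j m (k * r) * dsph_y m (k * r)) =
    1 + k * r * (dsph_j m (k * r) * sph_y m (k * r)).
  by rewrite -(sph_wronskian m t0); ring.
rewrite lambdaE // !(mulrDr (k * r)) jdy.
apply/eqP; rewrite eq_complex /=; move: (pi : R) pi0 => p p0.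
by apply/andP; split; apply/eqP; field; rewrite p0.
Qed.

End LayerPotentials.

End WaveKernels.

Theorem theorem3p1 (R : realType) (k r : R) (k_gt0 : 0 < k) (r_gt0 : 0 < r)
    (Hj : forall n : nat, sph_j n (k * r) <> sph_j (n + 2)%N (k * r))
    (m : nat) (Y : 'rV[R]_3 -> R[i]) (HY : spherical_harmonic m Y)
    (x : 'rV[R]_3) (Hx : enorm x = r) :
  [/\ pv_exists r x (NP_integrand k (fun y => Y (hat y)) x),
      NP k r (fun y => Y (hat y)) x = lambda m k r * Y (hat x),
      lambda m k r =
        - 2^-1 - 'i%C * (k ^+ 2 * r ^+ 2 * sph_j m (k * r))%:C
                    * cderive1 (sph_h1 m) (k * r),
      sphere_integrable r setT (SL_integrand k (fun y => Y (hat y)) x)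
    & SL k r (fun y => Y (hat y)) x = chi m k r * Y (hat x)].
Proof.
have [qr [qi [hqr hhr hqi hhi YE]]] := spherical_harmonic_parts HY.
subst r.
have [pvx npx] := NP_eigen k_gt0 r_gt0 hqr hhr hqi hhi YE.
have [slx sle] := SL_eigen k_gt0 r_gt0 hqr hhr hqi hhi YE.
by split=> //; apply: lambda_dh1; rewrite mulf_neq0 // gt_eqF.
Qed.
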